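(* Let $K$ be a field, $S=K[x_1,\ldots,x_n]$ the polynomial ring with its standard $\mathbb{Z}$-grading, and $\operatorname{gr} S$ the category of finitely generated graded $S$-modules. Let $\omega^\bullet$ be a minimal graded injective resolution of $S(-n)[n]$ and $\mathbf{D}_S(-)=\operatorname{Hom}_S^\bullet(-,\omega^\bullet)$. For every $M^\bullet\in D^b(\operatorname{gr} S)$ the following hold. (1) A pair $(d,i)\in\mathbb{N}\times\mathbb{Z}$ is distinguished for $M^\bullet$ if and only if $(d,-d-i)$ is distinguished for $\mathbf{D}_S(M^\bullet)$. (2) If $(d,i)$ is a distinguished pair for $M^\bullet$, then $$\deg_S H^i(M^\bullet)=\deg_S \operatorname{Ext}_S^{-d-i}(M^\bullet,\omega^\bullet).$$
   Context: $\mathbb{N}=\{0,1,2,\ldots\}$. For a graded module $M$, $M(j)$ is the shift with $M(j)_i=M_{i+j}$; for a complex, $M^\bullet[j]$ is the translation with $M^\bullet[j]^i=M^{i+j}$. Morphisms in $\operatorname{gr} S$ are degree-preserving. $D^b(\operatorname{gr} S)$ is the bounded derived category; it is identified with the full subcategory of the bounded derived category of all graded $S$-modules consisting of complexes with finitely generated cohomology. The complex $\omega^\bullet$ is the normalized graded dualizing complex of $S$; $\mathbf{D}_S$ is a duality functor on $D^b(\operatorname{gr} S)$, and $\operatorname{Ext}_S^i(M^\bullet,\omega^\bullet)=H^i(\mathbf{D}_S(M^\bullet))$. For $M^\bullet\in D^b(\operatorname{gr} S)$ set $d_i(M^\bullet):=\dim_S H^i(M^\bullet)$ (Krull dimension,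 with the zero module having dimension $-\infty$). Definition. A pair $(d,i)\in\mathbb{N}\times\mathbb{Z}$ is a distinguished pair for $M^\bullet\in D^b(\operatorname{gr} S)$ if $d=d_i(M^\bullet)$ and $d_j(M^\bullet)<d+i-j$ for all $j<i$. For $0\neq M\in\operatorname{gr} S$ of dimension $d$, $\deg_S(M)$ is the multiplicity of $M$: writing the Hilbert series of $M$ as $Q(t)/(1-t)^d$ with $Q\in\mathbb{Z}[t,t^{-1}]$, $\deg_S(M)=Q(1)$. *)

(* Defs.v *)
From HB Require Import structures.
From mathcomp Require Import all_boot all_order all_algebra.
From mathcomp Require Import mpoly.
From mathcomp Require Import boolp classical_sets constructive_ereal.

Set Implicit Arguments.
Unset Strict Implicit.
Unset Printing Implicit Defensive.

Import Order.TTheory GRing.Theory Num.Theory.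
Local Open Scope ring_scope.
Local Open Scope quotient_scope.

Section GradedModules.
Variables (K : fieldType) (n : nat).
Local Notation S := {mpoly K[n]}.

(* The grading is internal: [gdeg i] is the set of homogeneous elements of    *)
(* degree [i], and the last two fields say that the module is their direct    *)
(* sum. Homogeneous parts of negative degree of the ring are zero, hence the  *)
(* natural number in [gdegZ].                                                 *)
Record gmod := Gmod {
  gcar :> lmodType S;
  gdeg : int -> gcar -> Prop;
  gdeg0 : forall i, gdeg i 0;
  gdegB : forall i x y, gdeg i x -> gdeg i y -> gdeg i (x - y);
  gdegZ : forall i k (p : S) x,
    p \is k.-homog -> gdeg i x -> gdeg (i + k%:Z) (p *: x);
  gdec : forall x : gcar, exists (m : nat) (e : 'I_m -> int) (y : 'I_m -> gcar),
    (forall k, gdeg (e k) (y k)) /\ x = \sum_(k < m) y k;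
  gindep : forall (s : seq int) (y : int -> gcar), uniq s ->
    (forall i, gdeg i (y i)) -> \sum_(i <- s) y i = 0 ->
    forall i, i \in s -> y i = 0
}.

Lemma gdegN (M : gmod) i (x : M) : gdeg i x -> gdeg i (- x).
Proof. by move=> hx; rewrite -sub0r; apply: gdegB => //; exact: gdeg0. Qed.

Lemma gdegD (M : gmod) i (x y : M) : gdeg i x -> gdeg i y -> gdeg i (x + y).
Proof. by move=> hx /gdegN hy; rewrite -[y]opprK; exact: gdegB. Qed.

Lemma gdeg_sum (M : gmod) i (I : Type) (r : seq I) (P : pred I) (F : I -> M) :
  (forall k, P k -> gdeg i (F k)) -> gdeg i (\sum_(k <- r | P k) F k).
Proof.
by move=> h; elim/big_rec: _ => [|k x Pk hx]; [exact: gdeg0|apply: gdegD => //; exact: h].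
Qed.

Lemma sum_supp (V : zmodType) (s t : seq int) (c : int -> V) :
  uniq s -> uniq t -> {subset s <= t} -> (forall i, i \notin s -> c i = 0) ->
  \sum_(i <- s) c i = \sum_(i <- t) c i.
Proof.
move=> us ut st c0; rewrite [RHS](bigID (mem s)) /= [X in _ + X]big1 ?addr0 //.
rewrite -[RHS]big_filter; apply: perm_big; apply: uniq_perm; rewrite ?filter_uniq //.
by move=> i; rewrite mem_filter; case: (boolP (i \in s)) => //= /st ->.
Qed.

Lemma gdec_uniq (M : gmod) (x : M) : exists (c : int -> M) (s : seq int),
  [/\ uniq s, forall i, gdeg i (c i), forall i, i \notin s -> c i = 0
    & x = \sum_(i <- s) c i].
Proof.
have [m [e [y [hy ->]]]] := gdec x.
pose s := undup [seq e k | k <- enum 'I_m].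
exists (fun i => \sum_(k < m | e k == i) y k), s; split.
- exact: undup_uniq.
- by move=> i; apply: gdeg_sum => k /eqP <-.
- move=> i; rewrite mem_undup => hi; rewrite big_pred0 // => k.
  by apply: contraNF hi => /eqP <-; apply: map_f; rewrite mem_enum.
- rewrite (exchange_big_dep xpredT) //=; apply: eq_bigr => k _.
  rewrite (eq_bigl (pred1 (e k))); last by move=> i; rewrite /= eq_sym.
  rewrite -big_filter filter_pred1_uniq ?big_seq1 ?undup_uniq //.
  by rewrite mem_undup; apply: map_f; rewrite mem_enum.
Qed.

Definition is_gmorphism (A B : gmod) (f : A -> B) : Prop :=
  linear f /\ forall i x, gdeg i x -> gdeg i (f x).

Definition fin_gen (A : gmod) : Prop :=
  exists (m : nat) (g : 'I_m -> A),
    forall x, exists c : 'I_m -> S, x = \sum_(k < m) c k *: g k.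

(* [S] itself; [Posz k] is the integer [k : nat].                             *)
Definition ring_deg (i : int) (p : S^o) : Prop :=
  if i is Posz k then (p : S) \is k.-homog else p = 0.

Fact ring_deg0 i : ring_deg i 0.
Proof. by case: i => k //=; exact: rpred0. Qed.

Fact ring_degB i x y : ring_deg i x -> ring_deg i y -> ring_deg i (x - y).
Proof. by case: i => k /=; [exact: rpredB | move=> -> ->; rewrite subr0]. Qed.

Fact ring_degZ i k (p : S) (x : S^o) :
  p \is k.-homog -> ring_deg i x -> ring_deg (i + k%:Z) (p *: x).
Proof.
move=> hp; case: i => a /= => [hx|->].
  by rewrite [(a + k)%N]addnC; exact: (dhomogM hp hx).
by rewrite scaler0; exact: ring_deg0.
Qed.

Fact ring_dec (x : S^o) : exists (m : nat) (e : 'I_m -> int) (y : 'I_m -> S^o),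
  (forall k, ring_deg (e k) (y k)) /\ x = \sum_(k < m) y k.
Proof.
exists (msize (x : S)), (fun k => Posz k),
  (fun k => pihomog mdeg k (x : S)); split=> [k|] /=.
  exact: pihomogP.
exact: (pihomog_partitionE (mf := mdeg) (leqnn _)).
Qed.

Fact ring_indep (s : seq int) (y : int -> S^o) : uniq s ->
  (forall i, ring_deg i (y i)) -> \sum_(i <- s) y i = 0 ->
  forall i, i \in s -> y i = 0.
Proof.
move=> us hy s0 [k|k] ks; last exact: (hy (Negz k)).
have h : pihomog mdeg k (\sum_(i <- s) (y i : S)) = 0 by rewrite s0 raddf0.
rewrite raddf_sum (bigD1_seq (Posz k)) //= in h.
rewrite (pihomog_dE (hy (Posz k))) big1 ?addr0 // in h => -[j|j] jk.
  by rewrite (pihomog_ne0 _ (hy (Posz j))).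
by rewrite (hy (Negz j)) raddf0.
Qed.

Definition ring_gmod : gmod :=
  @Gmod S^o ring_deg ring_deg0 ring_degB ring_degZ ring_dec ring_indep.

Section Shift.
Variables (j : int) (M : gmod).

Definition shift_deg (i : int) (x : M) : Prop := gdeg (i + j) x.

Fact shift_degZ i k (p : S) x :
  p \is k.-homog -> shift_deg i x -> shift_deg (i + k%:Z) (p *: x).
Proof. by move=> hp hx; rewrite /shift_deg addrAC; exact: gdegZ. Qed.

Fact shift_dec (x : M) : exists (m : nat) (e : 'I_m -> int) (y : 'I_m -> M),
  (forall k, shift_deg (e k) (y k)) /\ x = \sum_(k < m) y k.
Proof.
have [m [e [y [hy ->]]]] := gdec x.
by exists m, (fun k => e k - j), y; split=> // k; rewrite /shift_deg subrK.
Qed.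

Fact shift_indep (s : seq int) (y : int -> M) : uniq s ->
  (forall i, shift_deg i (y i)) -> \sum_(i <- s) y i = 0 ->
  forall i, i \in s -> y i = 0.
Proof.
move=> us hy s0 i si.
have := @gindep M [seq i + j | i <- s] (fun i => y (i - j)) _ _ _ (i + j).
rewrite addrK; apply.
- by rewrite map_inj_uniq //; exact: addIr.
- by move=> k; have := hy (k - j); rewrite /shift_deg subrK.
- by rewrite big_map -[RHS]s0; apply: eq_bigr => k _; rewrite addrK.
- exact: map_f.
Qed.

Definition gshift : gmod :=
  @Gmod M shift_deg (fun i => gdeg0 M (i + j)) (fun i => @gdegB M (i + j))
    shift_degZ shift_dec shift_indep.

End Shift.

Fact zero_dec (x : 'rV[S]_0) :
  exists (m : nat) (e : 'I_m -> int) (y : 'I_m -> 'rV[S]_0),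
  (forall k, (fun _ _ => True) (e k) (y k)) /\ x = \sum_(k < m) y k.
Proof. by exists 0%N, (fun=> 0), (fun=> 0); rewrite big_ord0 [x]thinmx0. Qed.

Definition zero_gmod : gmod :=
  @Gmod 'rV[S]_0 (fun _ _ => True) (fun _ => I) (fun _ _ _ _ _ => I)
    (fun _ _ _ _ _ _ => I) zero_dec (fun _ y _ _ _ i _ => thinmx0 (y i)).

(* The Krull dimension of a module is that of [S / Ann N]: the supremum of    *)
(* the lengths of the chains of prime ideals containing the annihilator. It   *)
(* is -oo when there is no such prime ideal, i.e. for the zero module.        *)
Definition prime_chain (N : lmodType S) (l : nat) (P : nat -> prime_idealr S) :=
  (forall a : S, (forall x : N, a *: x = 0) -> a \in P 0%N) /\
  (forall i, (i < l)%N -> {subset P i <= P i.+1} /\ ~ {subset P i.+1 <= P i}).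

Definition kdim (N : lmodType S) : \bar int :=
  supremum -oo%E [set l%:Z%:E | l in [set l : nat | exists P, @prime_chain N l P]].

Definition piece_dim (M : gmod) (i : int) (r : nat) : Prop :=
  exists b : 'I_r -> M, (forall k, gdeg i (b k)) /\
    forall x, gdeg i x -> exists! c : 'rV[K]_r, x = \sum_(k < r) (c 0 k)%:MP *: b k.

(* The Hilbert series of [M] is [t ^ m * q(t) / (1 - t) ^ d] in Z((t)), where *)
(* [d] is the dimension of [M] and every Laurent polynomial [Q] is written as *)
(* [t ^ m * q(t)] with [q] a polynomial; both sides are multiplied by         *)
(* [(1 - t) ^ d]. The multiplicity is [Q(1) = q(1)].                          *)
Definition has_multiplicity (M : gmod) (e : int) : Prop :=
  exists (d : nat) (h : int -> nat) (m : int) (q : {poly int}),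
    [/\ kdim M = d%:Z%:E,
        forall i, piece_dim M i (h i),
        forall i, i < m -> h i = 0%N,
        forall k : nat, \sum_(l < k.+1) ((1 - 'X) ^+ d)`_l * (h (m + k%:Z - l%:Z))%:Z = q`_k
      & e = q.[1]].

(* Injective object of the category of all graded modules.                    *)
Definition gr_injective (E : gmod) : Prop :=
  forall (A B : gmod) (u : A -> B) (f : A -> E),
    is_gmorphism u -> injective u -> is_gmorphism f ->
    exists g : B -> E, is_gmorphism g /\ forall x, g (u x) = f x.

Definition graded_submodule (M : gmod) (W : {pred M}) : Prop :=
  GRing.submod_closed W /\
  forall x, x \in W -> exists (m : nat) (e : 'I_m -> int) (y : 'I_m -> M),
    (forall k, gdeg (e k) (y k) /\ y k \in W) /\ x = \sum_(k < m) y k.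

Definition gr_essential (M : gmod) (Z : {pred M}) : Prop :=
  forall W : {pred M}, graded_submodule W ->
    (exists2 w, w \in W & w != 0) ->
    exists2 w, w \in W & (w \in Z) && (w != 0).

End GradedModules.

Arguments is_gmorphism {K n A B} f.

Arguments ring_gmod K n : clear implicits.

Section Complexes.
Variables (K : fieldType) (n : nat).
Local Notation S := {mpoly K[n]}.
Local Notation gmod := (gmod K n).

(* To avoid transporting along equalities of degrees, there is a map          *)
(* [cdiff i j] for all [i] and [j], zero unless [j = i + 1].                  *)
Record gcomplex := GComplex {
  cobj :> int -> gmod;
  cdiff : forall i j, cobj i -> cobj j;
  cdiff_gmorphism : forall i j, is_gmorphism (@cdiff i j);
  cdiff_shape : forall i j x, j != i + 1 -> @cdiff i j x = 0;
  cdiffK : forall i j k x, @cdiff j k (@cdiff i j x) = 0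
}.

Section Cohomology.
Variables (C : gcomplex) (i : int).

Fact cdiff_linear j : linear (@cdiff C i j).
Proof. by case: (cdiff_gmorphism C i j). Qed.

HB.instance Definition _ j :=
  GRing.isLinear.Build S (C i) (C j) _ (@cdiff C i j) (cdiff_linear j).

Lemma cdiff_deg j a x : gdeg a x -> gdeg a (@cdiff C i j x).
Proof. by case: (cdiff_gmorphism C i j) => _; exact. Qed.

Definition cocycles : {pred C i} := [pred x | @cdiff C i (i + 1) x == 0].

Fact cocycles_closed : GRing.submod_closed cocycles.
Proof.
split=> [|a x y]; rewrite !inE ?linear0 // => /eqP x0 /eqP y0.
by rewrite linearP /= x0 y0 scaler0 addr0.
Qed.

HB.instance Definition _ := GRing.isSubmodClosed.Build S (C i) cocycles cocycles_closed.

Record cocycle := Cocycle { cocycle_val : C i; _ : cocycle_val \in cocycles }.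

HB.instance Definition _ := [isSub for cocycle_val].
HB.instance Definition _ := [Choice of cocycle by <:].
HB.instance Definition _ := [SubChoice_isSubLmodule of cocycle by <:].

End Cohomology.

Arguments cocycles : clear implicits.

Section Cohomology2.
Variables (C : gcomplex) (i : int).

Definition coboundaries : {pred cocycle C i} :=
  [pred z | `[< exists x, val z = @cdiff C (i - 1) i x >]].

Fact coboundaries_closed : GRing.submod_closed coboundaries.
Proof.
split=> [|a x y].
  by apply/asboolP; exists 0; rewrite !linear0.
move=> /asboolP[u hu] /asboolP[v hv]; apply/asboolP; exists (a *: u + v).
by rewrite !linearP /= -hu -hv.
Qed.

HB.instance Definition _ :=
  GRing.isSubmodClosed.Build S (cocycle C i) coboundaries coboundaries_closed.

Definition coh_car := Quotient.quot coboundaries.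
HB.instance Definition _ := ZmodQuotient.on coh_car.

Definition coh_scale (a : S) (u : coh_car) : coh_car :=
  \pi_coh_car (a *: repr u).

Lemma coh_piE (x y : cocycle C i) :
  (\pi_coh_car x == \pi_coh_car y) = (x - y \in coboundaries).
Proof. by rewrite Quotient.idealrBE. Qed.

Lemma coh_scaleE a (x : cocycle C i) :
  coh_scale a (\pi_coh_car x) = \pi_coh_car (a *: x).
Proof.
apply/eqP; rewrite coh_piE -scalerBr; apply: rpredZ.
by rewrite -coh_piE reprK.
Qed.


Fact coh_scaleA a b v : coh_scale a (coh_scale b v) = coh_scale (a * b) v.
Proof. by rewrite -[v]reprK (coh_scaleE b) !coh_scaleE scalerA. Qed.

Fact coh_scale1 : left_id 1 coh_scale.
Proof. by move=> v; rewrite -[v]reprK coh_scaleE scale1r. Qed.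

Fact coh_scaleDr : right_distributive coh_scale +%R.
Proof.
move=> a u v; rewrite -[u]reprK -[v]reprK -raddfD !coh_scaleE -raddfD.
by rewrite -scalerDr.
Qed.

Fact coh_scaleDl v : {morph coh_scale^~ v : a b / a + b}.
Proof. by move=> a b; rewrite -[v]reprK !coh_scaleE -raddfD -scalerDl. Qed.

HB.instance Definition _ := GRing.Zmodule_isLmodule.Build S coh_car
  coh_scaleA coh_scale1 coh_scaleDr coh_scaleDl.

Definition coh_deg (j : int) (u : coh_car) : Prop :=
  exists2 z : cocycle C i, gdeg j (val z) & u = \pi_coh_car z.

Fact coh_deg0 j : coh_deg j 0.
Proof. by exists 0; [exact: gdeg0 | rewrite raddf0]. Qed.

Fact coh_degB j x y : coh_deg j x -> coh_deg j y -> coh_deg j (x - y).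
Proof.
move=> [u hu ->] [v hv ->]; exists (u - v); first exact: gdegB.
by rewrite raddfB.
Qed.

Fact coh_degZ j k (p : S) x :
  p \is k.-homog -> coh_deg j x -> coh_deg (j + k%:Z) (p *: x).
Proof.
move=> hp [u hu ->]; exists (p *: u); first exact: gdegZ.
exact: coh_scaleE.
Qed.

Fact coh_dec (x : coh_car) : exists (m : nat) (e : 'I_m -> int) (y : 'I_m -> coh_car),
  (forall k, coh_deg (e k) (y k)) /\ x = \sum_(k < m) y k.
Proof.
rewrite -[x]reprK; move: (repr x) => z.
have [c [s [us hc c0 zE]]] := gdec_uniq (val z).
have dc j : c j \in cocycles C i.
  case: (boolP (j \in s)) => [js|/c0 ->]; last by rewrite rpred0.
  have hz : \sum_(k <- s) cdiff (i + 1) (c k) = 0.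
    by rewrite -linear_sum -zE; case: z {zE} => z /= /eqP.
  rewrite inE; apply/eqP.
  by apply: (gindep (y := fun k => cdiff (i + 1) (c k))) hz j js => // k; exact: cdiff_deg.
exists (size s), (fun k => nth 0 s k),
  (fun k => \pi_coh_car (Cocycle (dc (nth 0 s k)))); split=> [k|].
  by exists (Cocycle (dc (nth 0 s k))).
rewrite -raddf_sum; congr (\pi_coh_car _); apply: val_inj; rewrite zE raddf_sum /=.
by rewrite (big_nth 0) big_mkord.
Qed.

Fact coh_indep (s : seq int) (y : int -> coh_car) : uniq s ->
  (forall j, coh_deg j (y j)) -> \sum_(j <- s) y j = 0 ->
  forall j, j \in s -> y j = 0.
Proof.
move=> us hy s0.
have [z hz] : exists z : int -> cocycle C i,
    forall j, gdeg j (val (z j)) /\ y j = \pi_coh_car (z j).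
  have /choice[z hz] : forall j, exists w : cocycle C i,
    gdeg j (val w) /\ y j = \pi_coh_car w.
    by move=> j; have [w ? ?] := hy j; exists w.
  by exists z.
have : \sum_(j <- s) z j \in coboundaries.
  rewrite -[X in X \in _]subr0 -coh_piE raddf0 raddf_sum.
  have E : \sum_(j <- s) \pi_coh_car (z j) = \sum_(j <- s) y j.
    by apply: eq_bigr => j _; case: (hz j).
  by apply/eqP; rewrite -[RHS]s0 -E.
move=> /asboolP[x]; rewrite raddf_sum /= => hx.
have [c [s' [us' hc c0 xE]]] := gdec_uniq x.
pose t := undup (s ++ s').
pose w j := if j \in s then val (z j) else 0.
have ws : \sum_(j <- s) val (z j) = \sum_(j <- t) w j.
  rewrite -(sum_supp us (undup_uniq _)).
  - by apply: eq_big_seq => j js; rewrite /w js.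
  - by move=> j js; rewrite mem_undup mem_cat js.
  - by move=> j /negPf js; rewrite /w js.
have xt : x = \sum_(j <- t) c j.
  rewrite xE; apply: sum_supp => //; first exact: undup_uniq.
  by move=> j js; rewrite mem_undup mem_cat js orbT.
have h0 : \sum_(j <- t) (w j - cdiff i (c j)) = 0.
  by rewrite sumrB -ws hx xt linear_sum subrr.
have hd j : gdeg j (w j - cdiff i (c j)).
  apply: gdegB; last exact: cdiff_deg.
  by rewrite /w; case: ifP => _; [case: (hz j) | exact: gdeg0].
move=> j js; have [_ ->] := hz j; rewrite -(raddf0 \pi_coh_car); apply/eqP.
rewrite coh_piE subr0; apply/asboolP; exists (c j).
have jt : j \in t by rewrite mem_undup mem_cat js.
have /eqP := gindep (undup_uniq _) hd h0 jt.
by rewrite subr_eq0 /w js => /eqP.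
Qed.

Definition cohomology : gmod :=
  @Gmod K n coh_car coh_deg coh_deg0 coh_degB coh_degZ coh_dec coh_indep.

End Cohomology2.

Definition bounded_complex (C : gcomplex) : Prop :=
  exists a b : int, forall i, i < a \/ b < i -> forall x : C i, x = 0.

Definition bounded_below (C : gcomplex) : Prop :=
  exists a : int, forall i, i < a -> forall x : C i, x = 0.

Definition in_Db (C : gcomplex) : Prop :=
  bounded_complex C /\ forall i, fin_gen (cohomology C i).

Definition chain_map (A B : gcomplex) (f : forall i, A i -> B i) : Prop :=
  (forall i, is_gmorphism (f i)) /\
  forall i j x, f j (cdiff j x) = cdiff j (f i x).

(* The map induced by [f] on cohomology is injective and surjective in every  *)
(* degree.                                                                    *)
Definition quasi_iso (A B : gcomplex) (f : forall i, A i -> B i) : Prop :=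
  chain_map f /\ forall i,
    (forall x, x \in cocycles A i ->
      (exists y, f i x = cdiff i (y : B (i - 1))) ->
      exists y, x = cdiff i (y : A (i - 1))) /\
    (forall z, z \in cocycles B i -> exists2 x, x \in cocycles A i &
      exists y, z - f i x = cdiff i (y : B (i - 1))).

Section Single.
Variable M : gmod.

Definition single_obj (i : int) : gmod := if i == 0 then M else zero_gmod K n.

Fact single_gmorphism i j : is_gmorphism (fun _ : single_obj i => 0 : single_obj j).
Proof.
by split=> [a x y|k x _]; [rewrite scaler0 addr0 | exact: gdeg0].
Qed.

Definition single : gcomplex :=
  @GComplex single_obj (fun i j _ => 0) single_gmorphism
    (fun _ _ _ _ => erefl) (fun _ _ _ _ => erefl).

End Single.

Section Translate.
Variables (j : int) (C : gcomplex).

Definition translate_diff i k (x : C (i + j)) : C (k + j) :=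
  (-1) ^+ absz j *: cdiff (k + j) x.

Fact translate_gmorphism i k : is_gmorphism (@translate_diff i k).
Proof.
split=> [a x y|l x hx]; rewrite /translate_diff.
  by rewrite linearP scalerDr !scalerA mulrC.
rewrite -signr_odd; case: odd; rewrite ?expr0 ?expr1 ?scale1r ?scaleN1r.
  by apply: gdegN; exact: cdiff_deg.
exact: cdiff_deg.
Qed.

Fact translate_shape i k (x : C (i + j)) : k != i + 1 -> translate_diff k x = 0.
Proof.
move=> h; rewrite /translate_diff cdiff_shape ?scaler0 //.
by apply: contraNneq h; rewrite addrAC => /addIr ->.
Qed.

Fact translate_diffK i k l (x : C (i + j)) :
  translate_diff l (translate_diff k x) = 0.
Proof. by rewrite /translate_diff linearZ /= cdiffK !scaler0. Qed.

Definition translate : gcomplex :=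
  GComplex translate_gmorphism translate_shape translate_diffK.

End Translate.

(* Minimality: the cocycles form an essential submodule in every degree.      *)
Definition minimal_injective_resolution (A I : gcomplex) : Prop :=
  [/\ bounded_below I,
      forall i, gr_injective (I i),
      exists f : forall i, A i -> I i, quasi_iso f
    & forall i, gr_essential (cocycles I i)].

Section HomComplex.
Variables M N : gcomplex.

(* In degree [k] the complex is the product of the graded modules             *)
(* [Hom(M p, N (p + k))], taken among graded modules: a homogeneous element   *)
(* of degree [j] is a family of linear maps raising internal degrees by [j],  *)
(* and the elements are the finite sums of homogeneous ones. As for the       *)
(* differentials, families are indexed by all pairs [(p, q)].                 *)
Local Notation homfam := (forall p q : int, M p -> N q).

Definition hom_homog (k j : int) (f : homfam) : Prop :=
  [/\ forall p q, linear (f p q),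
      forall p q x, q != p + k -> f p q x = 0
    & forall p q a x, gdeg a x -> gdeg (a + j) (f p q x)].

Definition is_hom (k : int) (f : homfam) : Prop :=
  exists (m : nat) (e : 'I_m -> int) (g : 'I_m -> homfam),
    (forall l, hom_homog k (e l) (g l)) /\
    forall p q x, f p q x = \sum_(l < m) g l p q x.

Record hom_car (k : int) := Hom { hom_val :> homfam; hom_valP : is_hom k hom_val }.

HB.instance Definition _ k := gen_eqMixin (hom_car k).
HB.instance Definition _ k := gen_choiceMixin (hom_car k).

Lemma hom_eqP k (f g : hom_car k) : (forall p q x, f p q x = g p q x) -> f = g.
Proof.
case: f g => [f hf] [g hg] /= h.
have fg : f = g.
  by do 2 (apply: functional_extensionality_dep => ?); apply/funext.
by subst g; congr Hom; exact: Prop_irrelevance.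
Qed.

Fact hom_linear k (f : hom_car k) p q : linear (f p q).
Proof.
have [m [e [u [hu uE]]]] := hom_valP f; move=> a x y; rewrite !uE.
rewrite scaler_sumr -big_split; apply: eq_bigr => l _.
by case: (hu l) => h _ _; rewrite h.
Qed.

Fact hom_shape k (f : hom_car k) p q x : q != p + k -> f p q x = 0.
Proof.
have [m [e [u [hu uE]]]] := hom_valP f; move=> h; rewrite uE big1 // => l _.
by case: (hu l) => _ -> .
Qed.

HB.instance Definition _ k (f : hom_car k) p q :=
  GRing.isLinear.Build S (M p) (N q) _ (f p q) (@hom_linear k f p q).

Fact hom_homog0 k j : hom_homog k j (fun _ _ _ => 0).
Proof.
split=> // [p q a x y|p q a x _]; first by rewrite scaler0 addr0.
exact: gdeg0.
Qed.

Fact hom_homogZ k j l (a : S) (f : homfam) : a \is l.-homog ->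
  hom_homog k j f -> hom_homog k (j + l%:Z) (fun p q x => a *: f p q x).
Proof.
move=> ha [f1 f2 f3]; split=> [p q b x y|p q x h|p q b x hx].
- by rewrite f1 scalerDr !scalerA mulrC.
- by rewrite f2 // scaler0.
- by rewrite addrA; apply: gdegZ => //; exact: f3.
Qed.

Fact is_hom0 k : is_hom k (fun _ _ _ => 0).
Proof.
by exists 0%N, (fun=> 0), (fun _ _ _ _ => 0); split=> [[]//|p q x]; rewrite big_ord0.
Qed.

Fact is_homD k (f g : homfam) : is_hom k f -> is_hom k g ->
  is_hom k (fun p q x => f p q x + g p q x).
Proof.
move=> [m [e [u [hu uE]]]] [m' [e' [v [hv vE]]]].
exists (m + m')%N,
  (fun l => match split l with inl l => e l | inr l => e' l end),
  (fun l => match split l with inl l => u l | inr l => v l end).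
split=> [l|p q x]; first by case: (split l).
rewrite big_split_ord uE vE; congr (_ + _); apply: eq_bigr => l _.
  by rewrite (unsplitK (inl l)).
by rewrite (unsplitK (inr l)).
Qed.

Fact is_hom_sum k m (F : 'I_m -> homfam) : (forall l, is_hom k (F l)) ->
  is_hom k (fun p q x => \sum_(l < m) F l p q x).
Proof.
move=> hF; elim: m F hF => [|m IH] F hF.
  have -> : (fun p q x => \sum_(l < 0) F l p q x) = fun p q (x : M p) => 0 : N q.
    do 2 (apply: functional_extensionality_dep => ?); apply/funext => x.
    by rewrite big_ord0.
  exact: is_hom0.
have -> : (fun p q x => \sum_(l < m.+1) F l p q x) = fun p q (x : M p) =>
    \sum_(l < m) F (widen_ord (leqnSn m) l) p q x + F ord_max p q x :> N q.
  do 2 (apply: functional_extensionality_dep => ?); apply/funext => x.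
  by rewrite big_ord_recr.
by apply: is_homD => //; exact: IH.
Qed.

Fact is_homZ k (a : S) (f : homfam) : is_hom k f ->
  is_hom k (fun p q x => a *: f p q x).
Proof.
move=> [m [e [u [hu uE]]]].
have -> : (fun p q x => a *: f p q x) = fun p q (x : M p) =>
    \sum_(d < msize a) \sum_(l < m) pihomog mdeg d a *: u l p q x :> N q.
  do 2 (apply: functional_extensionality_dep => ?); apply/funext => x.
  rewrite uE {1}(pihomog_partitionE (mf := mdeg) (leqnn (msize a))).
  by rewrite scaler_suml; apply: eq_bigr => d _; rewrite scaler_sumr.
apply: is_hom_sum => d; exists m, (fun l => e l + d%:Z),
  (fun l p q x => pihomog mdeg d a *: u l p q x).
by split=> // l; apply: hom_homogZ => //; exact: pihomogP.
Qed.

Fact is_homN k (f : homfam) : is_hom k f -> is_hom k (fun p q x => - f p q x).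
Proof.
move=> /(is_homZ (-1)); congr (is_hom k _).
do 2 (apply: functional_extensionality_dep => ?); apply/funext => x.
by rewrite scaleN1r.
Qed.

Section HomModule.
Variable k : int.
Implicit Types f g : hom_car k.

Definition hom_zero : hom_car k := Hom (is_hom0 k).
Definition hom_add f g : hom_car k := Hom (is_homD (hom_valP f) (hom_valP g)).
Definition hom_opp f : hom_car k := Hom (is_homN (hom_valP f)).
Definition hom_scale (a : S) f : hom_car k := Hom (is_homZ a (hom_valP f)).

Fact hom_addA : associative hom_add.
Proof. by move=> f g h; apply: hom_eqP => p q x /=; rewrite addrA. Qed.
Fact hom_addC : commutative hom_add.
Proof. by move=> f g; apply: hom_eqP => p q x /=; rewrite addrC. Qed.
Fact hom_add0 : left_id hom_zero hom_add.
Proof. by move=> f; apply: hom_eqP => p q x /=; rewrite add0r. Qed.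
Fact hom_addN : left_inverse hom_zero hom_opp hom_add.
Proof. by move=> f; apply: hom_eqP => p q x /=; rewrite addNr. Qed.

HB.instance Definition _ :=
  GRing.isZmodule.Build (hom_car k) hom_addA hom_addC hom_add0 hom_addN.

Fact hom_scaleA a b f : hom_scale a (hom_scale b f) = hom_scale (a * b) f.
Proof. by apply: hom_eqP => p q x /=; rewrite scalerA. Qed.
Fact hom_scale1 : left_id 1 hom_scale.
Proof. by move=> f; apply: hom_eqP => p q x /=; rewrite scale1r. Qed.
Fact hom_scaleDr : right_distributive hom_scale +%R.
Proof. by move=> a f g; apply: hom_eqP => p q x /=; rewrite scalerDr. Qed.
Fact hom_scaleDl f : {morph hom_scale^~ f : a b / a + b}.
Proof. by move=> a b; apply: hom_eqP => p q x /=; rewrite scalerDl. Qed.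

HB.instance Definition _ := GRing.Zmodule_isLmodule.Build S (hom_car k)
  hom_scaleA hom_scale1 hom_scaleDr hom_scaleDl.

Lemma hom_sumE (I : Type) (r : seq I) (F : I -> hom_car k) p q x :
  (\sum_(l <- r) F l) p q x = \sum_(l <- r) F l p q x.
Proof.
by elim: r => [|l r IH]; rewrite ?big_nil // !big_cons -IH.
Qed.

Definition hom_deg (j : int) f : Prop := hom_homog k j f.

Fact hom_deg0 j : hom_deg j 0.
Proof. exact: hom_homog0. Qed.

Fact hom_degB j f g : hom_deg j f -> hom_deg j g -> hom_deg j (f - g).
Proof.
move=> [f1 f2 f3] [g1 g2 g3]; split=> [p q a x y|p q x h|p q a x hx] /=.
- by rewrite f1 g1 scalerBr opprD addrACA.
- by rewrite f2 // g2 // subr0.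
- by apply: gdegB; [exact: f3 | exact: g3].
Qed.

Fact hom_degZ j l (a : S) f :
  a \is l.-homog -> hom_deg j f -> hom_deg (j + l%:Z) (a *: f).
Proof. exact: hom_homogZ. Qed.

Fact hom_dec f : exists (m : nat) (e : 'I_m -> int) (y : 'I_m -> hom_car k),
  (forall l, hom_deg (e l) (y l)) /\ f = \sum_(l < m) y l.
Proof.
have [m [e [u [hu uE]]]] := hom_valP f.
have hu' l : is_hom k (u l).
  exists 1%N, (fun=> e l), (fun=> u l); split=> // p q x.
  by rewrite big_ord1.
exists m, e, (fun l => Hom (hu' l)); split=> //.
by apply: hom_eqP => p q x; rewrite uE hom_sumE.
Qed.

Fact hom_indep (s : seq int) (y : int -> hom_car k) : uniq s ->
  (forall j, hom_deg j (y j)) -> \sum_(j <- s) y j = 0 ->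
  forall j, j \in s -> y j = 0.
Proof.
move=> us hy s0 j js; apply: hom_eqP => p q x /=.
have [m [e [z [hz ->]]]] := gdec x.
rewrite linear_sum big1 // => l _ /=.
have us' : uniq [seq e l + i | i <- s] by rewrite map_inj_uniq //; exact: addrI.
have := @gindep K n (N q) _ (fun b => y (b - e l) p q (z l)) us' _ _ (e l + j).
rewrite addrAC subrr add0r; apply.
- move=> b; have [_ _ h] := hy (b - e l).
  by have := h p q _ _ (hz l); rewrite addrC subrK.
- rewrite big_map -[RHS]/((0 : hom_car k) p q (z l)) -s0 hom_sumE.
  by apply: eq_bigr => i _; rewrite addrAC subrr add0r.
- exact: map_f.
Qed.

Definition hom_gmod : gmod :=
  @Gmod K n (hom_car k) hom_deg hom_deg0 hom_degB hom_degZ hom_dec hom_indep.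

End HomModule.

(* d(f) = d_N o f - (-1)^k f o d_M for [f] of degree [k].                     *)
Definition hom_dfam (k : int) (f : homfam) : homfam := fun p q x =>
  cdiff q (f p (q - 1) x) - (-1) ^+ absz k *: f (p + 1) q (cdiff (p + 1) x).

Arguments hom_dfam : clear implicits.

Fact hom_dfam_homog k j f : hom_homog k j f -> hom_homog (k + 1) j (hom_dfam k f).
Proof.
move=> [f1 f2 f3]; split=> [p q a x y|p q x h|p q a x hx]; rewrite /hom_dfam.
- rewrite linearP /= f1 f1 linearP /= scalerDr scalerBr !scalerA.
  by rewrite [a * _]mulrC opprD addrACA.
- rewrite f2 ?linear0 ?f2 ?scaler0 ?subr0 //.
    by rewrite -addrA [1 + k]addrC.
  by rewrite subr_eq addrA in h *.
- apply: gdegB; first by apply: cdiff_deg; exact: f3.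
  have h : gdeg (a + j) (f (p + 1) q (cdiff (p + 1) x)).
    by apply: f3; exact: cdiff_deg.
  rewrite -signr_odd; case: odd; rewrite ?expr0 ?expr1 ?scale1r ?scaleN1r //.
  exact: gdegN.
Qed.

Fact hom_dfam_is_hom k f : is_hom k f -> is_hom (k + 1) (hom_dfam k f).
Proof.
move=> [m [e [u [hu uE]]]]; exists m, e, (fun l => hom_dfam k (u l)).
split=> [l|p q x]; first exact: hom_dfam_homog.
by rewrite /hom_dfam !uE linear_sum scaler_sumr -sumrB.
Qed.

Fact hom_diff_is_hom k l (f : hom_car k) :
  is_hom l (fun p q x => if l == k + 1 then hom_dfam k f p q x else 0).
Proof.
case: eqP => [->|_]; last exact: is_hom0.
exact: hom_dfam_is_hom (hom_valP f).
Qed.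

Definition hom_diff k l (f : hom_gmod k) : hom_gmod l :=
  Hom (hom_diff_is_hom l f).

Fact sign_succ (k : int) : (-1) ^+ absz (k + 1) = - (-1) ^+ absz k :> S.
Proof.
case: k => m; first by rewrite -PoszD addn1 !absz_nat exprS mulN1r.
have -> : Negz m + 1 = - m%:Z by rewrite NegzE -addn1 PoszD opprD subrK.
by rewrite abszN /= exprS mulN1r opprK.
Qed.

Fact hom_diff_gmorphism k l : is_gmorphism (@hom_diff k l).
Proof.
split=> [a f g|j f hf].
  apply: hom_eqP => p q x /=; case: ifP => _; last by rewrite scaler0 addr0.
  rewrite /hom_dfam /= linearP /= scalerDr scalerBr !scalerA.
  by rewrite [a * _]mulrC opprD addrACA.
rewrite /hom_diff /= /hom_deg /=.
case: eqP => [->|_]; last exact: hom_homog0.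
exact: hom_dfam_homog.
Qed.

Fact hom_diff_shape k l (f : hom_gmod k) : l != k + 1 -> hom_diff l f = 0.
Proof. by move=> /negPf h; apply: hom_eqP => p q x /=; rewrite h. Qed.

Fact hom_diffK k l m (f : hom_gmod k) : hom_diff m (hom_diff l f) = 0.
Proof.
apply: hom_eqP => p q x /=; case: eqP => // _.
rewrite /hom_dfam /=; case: eqP => [->|_]; last by rewrite linear0 scaler0 subr0.
rewrite /hom_dfam linearB /= cdiffK sub0r cdiffK linear0 scaler0 subr0.
rewrite linearZ /= sign_succ scaleNr opprK.
exact: addNr.
Qed.

Definition hom_complex : gcomplex :=
  @GComplex hom_gmod hom_diff hom_diff_gmorphism hom_diff_shape hom_diffK.

End HomComplex.

Definition distinguished (C : gcomplex) (d : nat) (i : int) : Prop :=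
  kdim (cohomology C i) = d%:Z%:E /\
  forall j, j < i -> (kdim (cohomology C j) < (d%:Z + i - j)%:E)%E.

Definition Ext (i : int) (M N : gcomplex) : gmod := cohomology (hom_complex M N) i.

End Complexes.

(* Main.v *)
(* Write D = Hom(-, omega). For a finitely generated N with Hilbert series     *)
(* q(t) / (1 - t) ^ d and q(1) = e, where q(1) = 0 is allowed, the modules     *)
(* E^c = H^c(D(N)) satisfy: dim E^c <= -c, E^c = 0 for c < -d, and E^(-d) has  *)
(* again a Hilbert series with denominator (1 - t) ^ d and value e of the      *)
(* numerator at 1. For N = S / I this follows by Noetherian induction on I     *)
(* from the sequence relating S / (I : x), S / I and S / (I + x), starting     *)
(* from S and from the residue field; general N are filtered by shifted S / I. *)
(*                                                                             *)
(* Dualizing the truncations of M expresses H^k(D(M)) through the modules      *)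
(* E^(k + j) of H^j(M). If (d, i) is distinguished and k = -d - i, the terms   *)
(* with j < i vanish and those with j > i have dimension < d, also in degree   *)
(* k + 1, so that H^k(D(M)) has the dimension and multiplicity of H^i(M).      *)
(*                                                                             *)
(* The converse does not use biduality: if (d, k) is distinguished for D(M),   *)
(* take the least i with dim H^i(M) + i >= -k. Then (d', i) is distinguished   *)
(* for d' = dim H^i(M), hence (d', -d' - i) is for D(M), and this forces       *)
(* k = -d' - i and d = d'.                                                     *)

Require Import Defs.
From HB Require Import structures.
From mathcomp Require Import all_boot all_order all_algebra.
From mathcomp Require Import mpoly zify.
From mathcomp Require Import boolp classical_sets constructive_ereal.

Set Implicit Arguments.
Unset Strict Implicit.
Unset Printing Implicit Defensive.

Import Order.TTheory GRing.Theory Num.Theory.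
Local Open Scope ring_scope.

(** * Rational generating series *)

Section RationalFunctions.

(** Dimensions and multiplicities are read off Hilbert functions. [rat d h e] says that the series
    of [h] has denominator (1 - t)^d and a numerator with value e at 1. If e > 0, then d is the
    Krull dimension ([kdim_rat]) and e the multiplicity ([has_multiplicity_rat]). Admitting e = 0
    makes e additive in exact sequences for a fixed d, whatever the dimensions of the single terms
    are.

    For a module N write E^c = Ext^c(N, omega). The duality statement for modules is [dual_dims]:
    dim E^c <= -c, E^c = 0 for c < -d, and E^(-d) has in order d the same value e as N. It passes
    through extensions ([dual_dims_ext]), because the only disturbance at -d is a connecting map
    into a module of dimension < d. It also passes from S / (I + x) to S / I when the variable x is
    regular on S / I ([dual_dims_regular]). Together with the sequence relating (I : x), I and I + x
    this gives all S / I by Noetherian induction ([dual_dims_extq]). The induction starts from the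
    residue field, whose Ext is found by dividing S by one variable after the other
    ([concentrated_step]).

    For a complex M, passing from the truncation at p to the one at p + 1 changes the dual by the
    modules E^(k + p + 1) of H^(p + 1)(M), up to a long exact sequence ([homq_step], [tower_les]).
    Let (d, i) be distinguished and k = -d - i. For j < i one has dim H^j(M) < -(k + j), so H^j(M)
    contributes nothing in degrees k and k - 1. For j > i the contributions in degrees k and k + 1
    have dimension < d. There remains E^(-d) of H^i(M), so H^k(D(M)) has pole order d with the value
    of H^i(M) ([tower_rat], [dist_rat]). The same estimates in degrees below k show that (d, k) is
    distinguished ([dist_dual]).

    Conversely ([dist_of_dual]), if (d, k) is distinguished for D(M), some H^j(M) contributes a
    module of dimension at least d in degree k, whence dim H^j(M) + j >= -k. The least index with
    this inequality carries a distinguished pair of M, and its dual pair has to be (d, k). *)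

Lemma int_ge_ind (P : int -> Prop) m :
  P m -> (forall i, m <= i -> P i -> P (i + 1)) -> forall i, m <= i -> P i.
Proof.
move=> Pm PS i mi; have -> : i = m + (absz (i - m)%R)%:Z by lia.
elim: (absz (i - m)%R) => [|k IH]; first by rewrite addr0.
have -> : m + k.+1%:Z = m + k%:Z + 1 by lia.
by apply: PS => //; lia.
Qed.

Definition bounded_left (h : int -> int) : Prop := exists m : int, forall i : int, i < m -> h i = 0.

(** Multiplication of the generating series by 1 - t. *)
Definition delta (h : int -> int) i := h i - h (i - 1).

Definition eventually_cst h (e : int) :=
  bounded_left h /\ exists N : int, forall i : int, N <= i -> h i = e.

(* The generating series of [h] is [t ^ m * q(t) / (1 - t) ^ d] with [q] a    *)
(* polynomial and [q(1) = e].                                                 *)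
Fixpoint rat d (h : int -> int) (e : int) : Prop :=
  if d is d'.+1 then bounded_left h /\ rat d' (delta h) e
  else exists2 g, eventually_cst g e & delta g =1 h.

Lemma bounded_left_delta h : bounded_left h -> bounded_left (delta h).
Proof.
by move=> [m hm]; exists m => i im; rewrite /delta !hm ?subr0 //; lia.
Qed.

Lemma delta_inj g h : bounded_left g -> bounded_left h ->
  delta g =1 delta h -> g =1 h.
Proof.
move=> [m hm] [m' hm'] gh i.
have [im|mi] := ltP i (Num.min m m').
  by rewrite hm ?hm' //; move: im; rewrite lt_min => /andP[].
move: i mi; apply: int_ge_ind => [|i mi e].
  have := gh (Num.min m m'); rewrite /delta [g (_ - 1)]hm ?[h (_ - 1)]hm'; lia.
have := gh (i + 1); rewrite /delta addrK; lia.
Qed.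

Lemma delta_surj h : bounded_left h -> exists2 g, bounded_left g & delta g =1 h.
Proof.
move=> [m hm].
exists (fun i => if i < m then 0 else \sum_(k < (absz (i - m)%R).+1) h (m + k%:Z)).
  by exists m => i ->.
move=> i; rewrite /delta; case: ltP => im; first by rewrite ifT ?hm //; lia.
case: ltP => im1.
  have -> : i = m by lia.
  by rewrite subrr big_ord1 addr0 subr0.
have -> : absz (i - m)%R = (absz (i - 1 - m)%R).+1 by lia.
rewrite big_ord_recr /= addrAC subrr add0r; congr h; lia.
Qed.

Lemma rat_bounded_left d h e : rat d h e -> bounded_left h.
Proof.
case: d => [[g [bg _] gh]|d []//].
by have [m hm] := bounded_left_delta bg; exists m => i /hm; rewrite gh.
Qed.

Lemma eq_rat d h h' e : h =1 h' -> rat d h e -> rat d h' e.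
Proof. by move/funext => ->. Qed.

Lemma bounded_leftD (a : int) g h : bounded_left g -> bounded_left h ->
  bounded_left (fun i => a * g i + h i).
Proof.
move=> [m hm] [m' hm']; exists (Num.min m m') => i.
by rewrite lt_min => /andP[/hm -> /hm' ->]; rewrite mulr0 addr0.
Qed.

Lemma rat_lin d (a : int) g h e e' : rat d g e -> rat d h e' ->
  rat d (fun i => a * g i + h i) (a * e + e').
Proof.
elim: d g h => [|d IH] g h /=.
  move=> [g' [bg [N hN]] dg] [h' [bh [N' hN']] dh].
  exists (fun i => a * g' i + h' i); last by move=> i; rewrite -dg -dh /delta; lia.
  split; first exact: bounded_leftD.
  by exists (Num.max N N') => i; rewrite ge_max => /andP[/hN -> /hN' ->].
move=> [bg rg] [bh rh]; split; first exact: bounded_leftD.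
by apply: eq_rat (IH _ _ rg rh) => i; rewrite /delta; lia.
Qed.

Lemma rat0 d : rat d (fun=> 0) 0.
Proof.
elim: d => [|d IH] /=; last first.
  by split; [exists 0 | apply: eq_rat IH => i; rewrite /delta subrr].
by exists (fun=> 0) => [|i]; [split; exists 0 | rewrite /delta subrr].
Qed.

Lemma ratD d g h e e' : rat d g e -> rat d h e' -> rat d (fun i => g i + h i) (e + e').
Proof.
move=> rg rh; have := rat_lin 1 rg rh; rewrite mul1r.
by apply: eq_rat => i; rewrite mul1r.
Qed.

Lemma ratB d g h e e' : rat d g e -> rat d h e' -> rat d (fun i => g i - h i) (e - e').
Proof.
move=> rg rh; have := rat_lin (-1) rh rg; rewrite mulN1r addrC.
by apply: eq_rat => i; rewrite mulN1r addrC.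
Qed.

Lemma bounded_left_shift s h : bounded_left h -> bounded_left (fun i => h (i + s)).
Proof. by move=> [m hm]; exists (m - s) => i im; apply: hm; lia. Qed.

Lemma rat_shift s d h e : rat d h e -> rat d (fun i => h (i + s)) e.
Proof.
elim: d h => [|d IH] h /=.
  move=> [g [bg [N hN]] gh]; exists (fun i => g (i + s)).
    split; first exact: bounded_left_shift.
    by exists (N - s) => i Ni; apply: hN; lia.
  by move=> i; rewrite -gh /delta; congr (_ - g _); lia.
move=> [bh rh]; split; first exact: bounded_left_shift.
by apply: eq_rat (IH _ rh) => i; rewrite /delta; congr (_ - h _); lia.
Qed.

Lemma rat1P h e : rat 1 h e <-> eventually_cst h e.
Proof.
split=> [[bh [g [bg cg] gh]]|[bh ch]] /=; last by split=> //; exists h.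
by have /funext <- := delta_inj bg bh gh.
Qed.

Lemma rat_raise d h e : rat d h e -> rat d.+1 h 0.
Proof.
elim: d h => [|d IH] h rh; last by case: rh => bh rh; split=> //; exact: IH.
apply/rat1P; split; first exact: rat_bounded_left rh.
have [g [_ [N hN]] gh] := rh; exists (N + 1) => i Ni.
rewrite -gh /delta !hN ?subrr //; lia.
Qed.

(** A numerator that vanishes at 1 is divisible by 1 - t, so one factor of the denominator cancels.
    In the base case the new value is the sum of all values of [h]. *)
Lemma rat_lower d h : rat d.+1 h 0 -> exists e, rat d h e.
Proof.
elim: d h => [|d IH] h; last first.
  by move=> [bh /IH[e rh]]; exists e.
move=> /rat1P[bh [N hN]]; have [g bg gh] := delta_surj bh.
exists (g N), g => //; split=> //; exists N; apply: int_ge_ind => // i Ni <-.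
by have := gh (i + 1); rewrite /delta addrK hN; lia.
Qed.

Lemma rat_raiseS d d' h e : (d < d')%N -> rat d h e -> rat d' h 0.
Proof.
move=> /subnKC <-; elim: (d' - d.+1)%N => [|k IH] rh.
  by rewrite addn0; exact: rat_raise rh.
by rewrite addnS; exact: rat_raise (IH rh).
Qed.

Lemma rat_uniq d h e e' : rat d h e -> rat d h e' -> e = e'.
Proof.
elim: d h => [|d IH] h /=; last by move=> [_ rh] [_ rh']; exact: IH rh rh'.
move=> [g [bg [N hN]] gh] [g' [bg' [N' hN']] gh'].
have E : g =1 g' by apply: delta_inj => // i; rewrite gh gh'.
by rewrite -(hN (Num.max N N')) ?le_max ?lexx // E hN' // le_max lexx orbT.
Qed.

(** Induction on d: differences that are eventually negative are integers, hence at most -1, and so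
    the function itself falls below 0. *)
Lemma rat_lt0 d h e : rat d.+1 h e -> e < 0 -> exists N, forall i, N <= i -> h i < 0.
Proof.
move=> rh e0; elim: d h rh => [|d IH] h rh.
  by have /rat1P[_ [N hN]] := rh; exists N => i /hN ->.
have [bh /IH[N hN]] := rh.
exists (N + `|h N| + 1) => i Ni.
suff H : h i <= h N - (i - N) by lia.
move: i Ni; suff H i : N <= i -> h i <= h N - (i - N) by move=> i Ni; apply: H; lia.
move: i; apply: int_ge_ind => [|i Ni IHi]; first by lia.
by have := hN (i + 1); rewrite /delta addrK; lia.
Qed.

Lemma rat_ge0 d (h : int -> int) e : (forall i, 0 <= h i) -> rat d h e -> 0 <= e.
Proof.
move=> h0; case: d => [|d] rh; last first.
  rewrite leNgt; apply/negP => /(rat_lt0 rh)[N /(_ N (lexx _))].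
  by have := h0 N; lia.
have [g [[m hm] [N hN]] gh] := rh.
have g0 i : m <= i -> 0 <= g i.
  move: i; apply: int_ge_ind => [|i _ gi].
    by have := h0 m; rewrite -gh /delta [g (m - 1)]hm; lia.
  by have := h0 (i + 1); rewrite -gh /delta addrK; lia.
by rewrite -(hN (Num.max m N)) ?le_max ?lexx ?orbT //; apply: g0; rewrite le_max lexx.
Qed.

(** While r > d, the nonnegative functions [g] and h - g have the values e' and -e' in order r.
    Hence e' = 0, and r can be lowered. *)
Lemma rat_le d r (g h : int -> int) e e' : (forall i, 0 <= g i) -> (forall i, g i <= h i) ->
  rat d h e -> rat r g e' -> exists e'', rat d g e''.
Proof.
move=> g0 gh rh; move: {2}(r - d)%N (leqnn (r - d)%N) => k; elim: k r e' => [|k IH] r e'.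
  rewrite leqn0 subn_eq0 leq_eqVlt => /orP[/eqP <-|rd] rg; first by exists e'.
  by exists 0; exact: rat_raiseS rd rg.
have [rd|dr] := leqP r d.
  by move=> _; apply: IH; move: rd; rewrite -subn_eq0 => /eqP ->.
case: r dr => // r dr rk rg.
have e0 : e' = 0.
  have := rat_ge0 g0 rg; have := ratB (rat_raiseS dr rh) rg.
  by move=> /rat_ge0 H; have := H (fun i => etrans (subr_ge0 _ _) (gh i)); lia.
rewrite e0 in rg; have [e2 rg2] := rat_lower rg.
by apply: IH rg2; move: rk; rewrite subSn.
Qed.

Lemma rat_cumul d h e : rat d h e -> exists2 g, delta g =1 h & rat d.+1 g e.
Proof.
move=> rh; have [g bg gh] := delta_surj (rat_bounded_left rh).
by exists g => //; split=> //; apply: eq_rat rh => i; rewrite gh.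
Qed.

Lemma delta_le (g h : int -> int) : bounded_left g -> bounded_left h ->
  (forall i, delta g i <= delta h i) -> forall i, g i <= h i.
Proof.
move=> [m hm] [m' hm'] gh i.
have [im|mi] := ltP i (Num.min m m').
  by rewrite hm ?hm' //; move: im; rewrite lt_min => /andP[].
move: i mi; apply: int_ge_ind => [|i mi e].
  have := gh (Num.min m m'); rewrite /delta [g (_ - 1)]hm ?[h (_ - 1)]hm'; lia.
have := gh (i + 1); rewrite /delta addrK; lia.
Qed.

(** Factors 1 - t are cancelled as long as the numerator vanishes at 1. If this is still so when the
    denominator is used up, the partial sums of [h] are monotone and run from 0 to 0. *)
Lemma rat_minimal d (h : int -> int) e : (forall i, 0 <= h i) -> rat d h e ->
  (exists d' e', rat d' h e' /\ 0 < e') \/ h =1 fun=> 0.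
Proof.
move=> h0; elim: d e => [|d IH] e rh; have := rat_ge0 h0 rh;
  rewrite le_eqVlt => /orP[/eqP e0|e0].
- right; have [g [bg [N hN]] gh] := rh; rewrite -e0 in hN.
  have gge : forall i j : int, i <= j -> g i <= g j.
    move=> i; apply: int_ge_ind => [//|j _ gij].
    by have := h0 (j + 1); rewrite -gh /delta addrK; lia.
  have [m hm] := bg.
  have g0 i : g i = 0.
    have := gge (Num.min (m - 1) i) i; rewrite ge_min lexx orbT => /(_ isT).
    have := gge i (Num.max N i); rewrite le_max lexx orbT => /(_ isT).
    by rewrite [g (Num.max _ _)]hN ?[g (Num.min _ _)]hm; lia.
  by move=> i; rewrite -gh /delta !g0.
- by left; exists 0%N, e.
- by rewrite -e0 in rh; have [e' re'] := rat_lower rh; exact: IH re'.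
- by left; exists d.+1, e.
Qed.

(** A pole of order d + 1 allows growth of degree d at most: every summation raises the degree of
    the bound by one. *)
Lemma rat_growth d h e : rat d.+1 h e -> exists m, exists2 C : nat,
  forall i, i < m -> h i = 0
  & forall k : nat, h (m + k%:Z) <= (C * k.+1 ^ d)%N%:Z /\ - (C * k.+1 ^ d)%N%:Z <= h (m + k%:Z).
Proof.
elim: d h e => [|d IH] h e rh.
  have /rat1P[[m hm] [N hN]] := rh.
  pose L := absz (N - m)%R.
  exists m, (absz e + \sum_(k < L) absz (h (m + k%:Z)%R))%N => // k.
  rewrite expn0 muln1; have [Lk|kL] := leqP L k.
    by rewrite hN; lia.
  by rewrite (bigD1 (Ordinal kL)) //=; lia.
have [[m0 hm0] /IH[m1 [C hm1 hC]]] := rh.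
have hm i : i < m1 -> h i = 0.
  move=> im; have [|mi] := ltP i m0; first exact: hm0.
  move: i mi im; apply: int_ge_ind => [|i mi IHi] im.
    by have := hm1 _ im; rewrite /delta [h (_ - 1)]hm0; lia.
  by have := hm1 _ im; rewrite /delta addrK IHi; lia.
exists m1, C => //.
suff H (k : nat) : h (m1 + k%:Z) <= (C * (k.+1 * k.+1 ^ d))%N%:Z /\
    - (C * (k.+1 * k.+1 ^ d))%N%:Z <= h (m1 + k%:Z).
  by move=> k; rewrite expnS; exact: H.
elim: k => [|k IHk].
  by have := hC 0%N; rewrite exp1n !muln1 /delta addr0 [h (_ - 1)]hm; lia.
have := hC k.+1; rewrite /delta.
have -> : m1 + k.+1%:Z - 1 = m1 + k%:Z by lia.
have : (k.+1 ^ d <= k.+2 ^ d)%N by case: (d) => // d'; rewrite leq_exp2r.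
set a := (k.+1 ^ d)%N in IHk *; set b := (k.+2 ^ d)%N; move=> ab.
have : (C * (k.+1 * a) <= C * (k.+1 * b))%N by rewrite !leq_mul.
have -> : (C * (k.+2 * b) = C * b + C * (k.+1 * b))%N by rewrite -mulnDr mulSn.
lia.
Qed.

End RationalFunctions.

(** * Dimensions of quotients of vector spaces *)

Section VectorSpaces.
Variables (K : fieldType) (n : nat).
Local Notation S := {mpoly K[n]}.
Implicit Types A : lmodType S.

Section Linear.
Variables (A A' : lmodType S) (f : A -> A').
Hypothesis lf : linear f.

Lemma lin0 : f 0 = 0.
Proof. by have := lf (-1) 0 0; rewrite scaler0 addr0 scaleN1r addNr. Qed.

Lemma linZ a x : f (a *: x) = a *: f x.
Proof. by have := lf a x 0; rewrite lin0 !addr0. Qed.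

Lemma linD x y : f (x + y) = f x + f y.
Proof. by have := lf 1 x y; rewrite !scale1r. Qed.

Lemma linB x y : f (x - y) = f x - f y.
Proof. by have := lf (-1) y x; rewrite !scaleN1r ![- _ + _]addrC. Qed.

Lemma lin_sum (I : Type) (r : seq I) (P : pred I) (F : I -> A) :
  f (\sum_(i <- r | P i) F i) = \sum_(i <- r | P i) f (F i).
Proof. exact: (big_morph f linD lin0). Qed.

End Linear.

Definition subspace A (B : A -> Prop) :=
  [/\ B 0, forall x y, B x -> B y -> B (x - y) & forall (c : K) x, B x -> B (c%:MP *: x)].

Section Subspace.
Variables (A : lmodType S) (B : A -> Prop).
Hypothesis sB : subspace B.

Lemma subsp0 : B 0. Proof. by case: sB. Qed.
Lemma subspB x y : B x -> B y -> B (x - y). Proof. by case: sB => _ + _; apply. Qed.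
Lemma subspZ c x : B x -> B (c%:MP *: x). Proof. by case: sB => _ _; apply. Qed.
Lemma subspN x : B x -> B (- x).
Proof. by move=> Bx; rewrite -sub0r; apply: subspB => //; exact: subsp0. Qed.
Lemma subspD x y : B x -> B y -> B (x + y).
Proof. by move=> Bx /subspN By; rewrite -[y]opprK; exact: subspB. Qed.
Lemma subsp_sum (I : Type) (r : seq I) (F : I -> A) :
  (forall i, B (F i)) -> B (\sum_(i <- r) F i).
Proof. by move=> BF; elim/big_rec: _ => [|i x _ Bx]; [exact: subsp0|exact: subspD]. Qed.
Lemma subsp_trans x y z : B (x - y) -> B (y - z) -> B (x - z).
Proof. by move=> h1 h2; have := subspD h1 h2; rewrite addrA subrK. Qed.
End Subspace.

Definition spans A (B Z : A -> Prop) r (b : 'I_r -> A) :=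
  forall x, Z x -> exists c : 'I_r -> K, B (x - \sum_(k < r) (c k)%:MP *: b k).

Definition free_mod A (B : A -> Prop) r (b : 'I_r -> A) :=
  forall c : 'I_r -> K, B (\sum_(k < r) (c k)%:MP *: b k) -> forall k, c k = 0.

(** The dimension over K of [Z] modulo [B]. Spanning and freeness are both taken modulo [B], so that
    no quotient has to be formed. *)
Definition hasdim A (B Z : A -> Prop) r :=
  exists b : 'I_r -> A, [/\ forall k, Z (b k), spans B Z b & free_mod B b].

(** If s > r, the coordinates of the [u k] in terms of [b] satisfy a linear relation, obtained from
    the left kernel of their matrix. *)
Lemma free_le_span A (B Z : A -> Prop) r (b : 'I_r -> A) s (u : 'I_s -> A) :
  subspace B -> spans B Z b -> (forall k, Z (u k)) -> free_mod B u -> (s <= r)%N.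
Proof.
move=> sB sp Zu fu; rewrite leqNgt; apply/negP => rs.
have /choice[C hC] k := sp _ (Zu k).
pose M : 'M[K]_(s, r) := \matrix_(k, l) C k l.
have : kermx M != 0.
  rewrite -mxrank_eq0 mxrank_ker subn_eq0 -ltnNge.
  by apply: leq_ltn_trans (rank_leq_col M) rs.
move=> /rowV0Pn[v /sub_kermxP vM v0]; case/negP: v0; apply/eqP/rowP => k; rewrite mxE.
apply: (fu (fun k => v 0 k)) k.
have -> : \sum_(k < s) (v 0 k)%:MP *: u k =
    \sum_(k < s) (v 0 k)%:MP *: (u k - \sum_(l < r) (C k l)%:MP *: b l).
  rewrite -[LHS]subr0; under [RHS]eq_bigr do rewrite scalerBr.
  rewrite [RHS]sumrB; congr (_ - _).
  under eq_bigr do rewrite scaler_sumr.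
  rewrite exchange_big big1 // => l _.
  under eq_bigr do rewrite scalerA -mpolyCM.
  rewrite -scaler_suml -raddf_sum /=.
  have /rowP/(_ l) := vM; rewrite !mxE => vl.
  by rewrite (eq_bigr (fun k => v 0 k * M k l)) => [|k _]; rewrite ?mxE // vl raddf0 scale0r.
by apply: subsp_sum => // k; apply: subspZ.
Qed.

Lemma hasdim_uniq A (B Z : A -> Prop) r s :
  subspace B -> hasdim B Z r -> hasdim B Z s -> r = s.
Proof.
move=> sB [b [Zb sb fb]] [u [Zu su fu]]; apply/eqP.
by rewrite eqn_leq (free_le_span sB su Zb fb) (free_le_span sB sb Zu fu).
Qed.

Lemma split_lshift a c (k : 'I_a) : split (lshift c k) = inl k.
Proof. exact: (unsplitK (inl k)). Qed.

Lemma split_rshift a c (k : 'I_c) : split (rshift a k) = inr k.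
Proof. exact: (unsplitK (inr k)). Qed.

Lemma sum_split_ord (V : zmodType) a c (F : 'I_(a + c) -> V) :
  \sum_(k < a + c) F k = \sum_(k < a) F (lshift c k) + \sum_(k < c) F (rshift a k).
Proof. exact: big_split_ord. Qed.

Definition fcons A r (x : A) (u : 'I_r -> A) : 'I_(1 + r) -> A :=
  fun k => match split k with inl _ => x | inr l => u l end.

(** A free family in [U] of maximal size spans: an x outside its span would give the larger free
    family [fcons x u]. *)
Lemma hasdim_sub A (B Z U : A -> Prop) r (b : 'I_r -> A) :
  subspace B -> spans B Z b -> (forall x, U x -> Z x) -> exists s, hasdim B U s.
Proof.
move=> sB sp UZ.
pose P s := `[< exists u : 'I_s -> A, (forall k, U (u k)) /\ free_mod B u >].
have P0 : exists s, P s.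
  exists 0%N; apply/asboolP; exists (fun=> 0); split; first by case.
  by move=> c _ [].
have Pr s : P s -> (s <= r)%N.
  move=> /asboolP[u [Uu fu]]; apply: (free_le_span sB sp _ fu) => k.
  exact: UZ.
case: (ex_maxnP P0 Pr) => s /asboolP[u [Uu fu]] smax.
exists s, u; split=> // x Ux; apply: contrapT => nx.
suff /smax : P (1 + s)%N by rewrite ltnn.
apply/asboolP; exists (fcons x u); split=> [k|c].
  by rewrite /fcons; case: split.
rewrite sum_split_ord big_ord1 /fcons.
rewrite split_lshift; set c0 := c (lshift _ _).
under eq_bigr => k _ do rewrite split_rshift.
have [z0|z0] := eqVneq c0 0.
  rewrite z0 mpolyC0 scale0r add0r => /(fu (fun k => c (rshift 1 k))) h k.
  case: (splitP k) => [j kj|j kj]; last by rewrite -(h j); congr c; apply: val_inj.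
  by rewrite -z0 /c0; congr c; apply: val_inj; rewrite /= kj; case: j {kj} => -[].
move=> h; case: nx; exists (fun k => - (c0^-1 * c (rshift 1 k))).
have := subspZ sB c0^-1 h; rewrite scalerDr scalerA -mpolyCM mulVf // scale1r.
rewrite scaler_sumr; congr (B (_ + _)); rewrite -sumrN; apply: eq_bigr => k _.
by rewrite scalerA -mpolyCM mpolyCN scaleNr opprK.
Qed.

Lemma hasdim_add A (B U Z : A -> Prop) a c : subspace B -> subspace U ->
  (forall x, B x -> U x) -> (forall x, U x -> Z x) ->
  hasdim B U a -> hasdim U Z c -> hasdim B Z (a + c).
Proof.
move=> sB sU BU UZ [u [Uu su fu]] [v [Zv sv fv]].
exists (fun k => match split k with inl k => u k | inr k => v k end); split.
- by move=> k; case: split => // j; exact: UZ.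
- move=> x /sv[q /su[p hp]].
  exists (fun k => match split k with inl k => p k | inr k => q k end).
  rewrite sum_split_ord [X in x - X]addrC opprD addrA.
  under eq_bigr => k _ do rewrite split_rshift.
  under [X in _ - X]eq_bigr => k _ do rewrite split_lshift.
  exact: hp.
- move=> p; rewrite sum_split_ord.
  under eq_bigr => k _ do rewrite split_lshift.
  under [X in _ + X]eq_bigr => k _ do rewrite split_rshift.
  move=> h.
  have q0 : forall k, p (rshift a k) = 0.
    apply: (fv (fun k => p (rshift a k))).
    set w := \sum_(k < a) _ in h.
    have Uw : U w by apply: subsp_sum => // k; apply: subspZ.
    by have := subspB sU (BU _ h) Uw; rewrite addrC addKr.
  move=> k; case: (splitP k) => [j kj|j kj]; last first.
    by rewrite -(q0 j); congr p; apply: val_inj.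
  rewrite -(fu (fun k => p (lshift c k)) _ j); first by congr p; apply: val_inj.
  by rewrite [X in _ + X]big1 ?addr0 // in h => l _; rewrite q0 mpolyC0 scale0r.
Qed.

Lemma hasdim_iso A A' (B Z : A -> Prop) (B' Z' : A' -> Prop) (f : A -> A') r :
  linear f -> subspace Z -> subspace B' ->
  (forall x, Z x -> Z' (f x)) -> (forall x, B x -> B' (f x)) ->
  (forall x, Z x -> B' (f x) -> B x) ->
  (forall y, Z' y -> exists2 x, Z x & B' (y - f x)) ->
  hasdim B Z r -> hasdim B' Z' r.
Proof.
move=> lf sZ sB' ZZ BB inj sur [b [Zb sb fb]].
exists (f \o b); split=> [k|y|c]; first exact: ZZ.
- move=> /sur[x /sb[c hc] hx]; exists c; apply: subsp_trans hx _ => //.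
  have := BB _ hc; rewrite (linB lf) (lin_sum lf).
  by under eq_bigr => k _ do rewrite (linZ lf).
- under eq_bigr => k _ do rewrite /= -(linZ lf).
  rewrite -(lin_sum lf) => /inj h; apply: fb; apply: h.
  by apply: subsp_sum => // k; apply: subspZ.
Qed.

End VectorSpaces.

(** * Graded subquotients and Hilbert functions *)

Section Subquotients.
Variables (K : fieldType) (n : nat).
Local Notation S := {mpoly K[n]}.

Definition gsubmod (A : lmodType S) (U : int -> A -> Prop) :=
  [/\ forall i, U i 0, forall i x y, U i x -> U i y -> U i (x - y)
    & forall i k (p : S) x, p \is k.-homog -> U i x -> U (i + k%:Z) (p *: x)].

Lemma gsubmod_subspace (A : lmodType S) (U : int -> A -> Prop) i :
  gsubmod U -> subspace (U i).
Proof.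
move=> [U0 UB UZ]; split=> [||c x Ux]; [exact: U0|exact: UB|].
rewrite -[i]addr0; apply: UZ => //; rewrite -[c%:MP]mulr1 mul_mpolyC.
by apply: dhomogZ; exact: dhomog1.
Qed.

Lemma gsubmodZ (A : lmodType S) (U : int -> A -> Prop) i j (p : S) x :
  gsubmod U -> ring_deg j p -> U i x -> U (i + j) (p *: x).
Proof.
move=> [U0 _ UZ]; case: j => k /=; first exact: UZ.
by move=> -> _; rewrite scale0r; exact: U0.
Qed.

(* A subquotient [numer / denom] of a graded module, given by its homogeneous *)
(* elements only.                                                             *)
Record gsq := Gsq {
  amb : lmodType S;
  numer : int -> amb -> Prop;
  denom : int -> amb -> Prop;
  numerP : gsubmod numer;
  denomP : gsubmod denom;
  denom_numer : forall i x, denom i x -> numer i x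
}.
Implicit Types X Y W : gsq.
Arguments numer : clear implicits.
Arguments denom : clear implicits.

Lemma numer_sub X i : subspace (numer X i).
Proof. exact/gsubmod_subspace/numerP. Qed.
Lemma denom_sub X i : subspace (denom X i).
Proof. exact/gsubmod_subspace/denomP. Qed.

(** The Hilbert function. The default 0 is taken where there is no finite dimension, which [fin_dim]
    excludes. *)
Definition hf X (i : int) : int :=
  (xget 0%N [set r | hasdim (denom X i) (numer X i) r])%:Z.

Definition fin_dim X := forall i, exists r, hasdim (denom X i) (numer X i) r.

Lemma hf_eq X i r : hasdim (denom X i) (numer X i) r -> hf X i = r%:Z.
Proof.
move=> h; rewrite /hf; congr (Posz _).
have := @xgetPex _ 0%N [set r | hasdim (denom X i) (numer X i) r] (ex_intro _ r h).
by move=> /= h'; apply: hasdim_uniq h' h; exact: denom_sub.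
Qed.

Lemma hf_ge0 X i : 0 <= hf X i. Proof. by []. Qed.

Lemma hf_hasdim X i : fin_dim X -> hasdim (denom X i) (numer X i) (absz (hf X i)).
Proof. by move=> /(_ i)[r h]; rewrite (hf_eq h). Qed.

Lemma hf0P X i : fin_dim X ->
  hf X i = 0 <-> (forall x, numer X i x -> denom X i x).
Proof.
move=> fX; split=> [h0|h]; last first.
  apply: (@hf_eq _ _ 0); exists (fun=> 0); split=> [[]//|x /h|c _ []//].
  by exists (fun=> 0); rewrite big_ord0 subr0.
have [b [_ sb _]] := hf_hasdim i fX; rewrite h0 in b sb.
by move=> x /sb[c]; rewrite big_ord0 subr0.
Qed.

Section SubQuo.
Variables (X : gsq) (U : int -> amb X -> Prop).
Hypotheses (gU : gsubmod U) (BU : forall i x, denom X i x -> U i x)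
  (UZ : forall i x, U i x -> numer X i x).

Definition subq := @Gsq (amb X) U (denom X) gU (denomP X) BU.
Definition quoq := @Gsq (amb X) (numer X) U (numerP X) gU UZ.

Lemma fin_dim_sub : fin_dim X -> fin_dim subq.
Proof.
move=> fX i; have [b [_ sb _]] := hf_hasdim i fX.
apply: (hasdim_sub (denom_sub X i) sb); exact: UZ.
Qed.

Lemma fin_dim_quo : fin_dim X -> fin_dim quoq.
Proof.
move=> fX i; have [b [_ sb _]] := hf_hasdim i fX.
apply: (@hasdim_sub _ _ _ (U i) (numer X i) (numer X i) _ b) => //.
  exact: gsubmod_subspace.
by move=> x /sb[c hc]; exists c; apply: BU.
Qed.

Lemma hf_subquo i : fin_dim X -> hf X i = hf subq i + hf quoq i.
Proof.
move=> fX; have h1 := hf_hasdim i (fin_dim_sub fX).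
have h2 := hf_hasdim i (fin_dim_quo fX).
have := hasdim_add (denom_sub X i) (gsubmod_subspace i gU) (BU (i := i)) (UZ (i := i)) h1 h2.
by move=> /hf_eq ->; rewrite PoszD !gez0_abs.
Qed.

End SubQuo.

Definition gmor X Y (s : int) (f : amb X -> amb Y) :=
  [/\ linear f, forall i x, numer X i x -> numer Y (i + s) (f x)
    & forall i x, denom X i x -> denom Y (i + s) (f x)].

Lemma fin_dim_iso X Y s f : @gmor X Y s f ->
  (forall i x, numer X i x -> denom Y (i + s) (f x) -> denom X i x) ->
  (forall i y, numer Y (i + s) y -> exists2 x, numer X i x & denom Y (i + s) (y - f x)) ->
  fin_dim X -> fin_dim Y /\ forall i, hf X i = hf Y (i + s).
Proof.
move=> [lf ZZ BB] inj sur fX.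
have h i : hasdim (denom Y (i + s)) (numer Y (i + s)) (absz (hf X i)).
  apply: (hasdim_iso lf) (hf_hasdim i fX).
  - exact: numer_sub.
  - exact: denom_sub.
  - exact: ZZ.
  - exact: BB.
  - exact: inj.
  - exact: sur.
split=> i; last by rewrite (hf_eq (h i)).
by have := h (i - s); rewrite subrK; eexists; eassumption.
Qed.

Section Kernel.
Variables (X Y : gsq) (s : int) (f : amb X -> amb Y).
Hypothesis gf : gmor s f.

Definition kerZ i x := numer X i x /\ denom Y (i + s) (f x).

Lemma kerZ_gsubmod : gsubmod kerZ.
Proof.
have [lf _ _] := gf; have [Z0 ZB ZZ] := numerP X; have [B0 BB BZ] := denomP Y.
split=> [i|i x y [x1 x2] [y1 y2]|i k p x hp [x1 x2]]; split.
- exact: Z0.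
- by rewrite (lin0 lf); exact: B0.
- exact: ZB.
- by rewrite (linB lf); exact: BB.
- exact: ZZ.
- by rewrite (linZ lf) addrAC; exact: BZ.
Qed.

Lemma denom_kerZ i x : denom X i x -> kerZ i x.
Proof. by have [_ _ h] := gf; move=> Bx; split; [exact: denom_numer|exact: h]. Qed.

Lemma kerZ_numer i x : kerZ i x -> numer X i x. Proof. by case. Qed.

Definition kerq := subq kerZ_gsubmod denom_kerZ.
Definition coimq := quoq kerZ_gsubmod kerZ_numer.

Definition imZ i y := numer Y i y /\ exists2 x, numer X (i - s) x & denom Y i (y - f x).

Lemma imZ_gsubmod : gsubmod imZ.
Proof.
have [lf _ _] := gf; have [Z0 ZB ZZ] := numerP X; have [B0 BB BZ] := denomP Y.
have [Z0' ZB' ZZ'] := numerP Y.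
split=> [i|i x y [x1 [u u1 u2]] [y1 [v v1 v2]]|i k p x hp [x1 [u u1 u2]]]; split.
- exact: Z0'.
- by exists 0; [exact: Z0|rewrite (lin0 lf) subr0; exact: B0].
- exact: ZB'.
- exists (u - v); first exact: ZB.
  have := BB _ _ _ u2 v2; congr (denom _ _ _).
  by rewrite (linB lf) !opprD !opprK addrACA.
- exact: ZZ'.
- exists (p *: u); first by rewrite addrAC; exact: ZZ.
  by rewrite (linZ lf) -scalerBr; exact: BZ.
Qed.

Lemma denom_imZ i y : denom Y i y -> imZ i y.
Proof.
move=> By; split; first exact: denom_numer.
have [lf _ _] := gf; have [Z0 _ _] := numerP X.
by exists 0; [exact: Z0|rewrite (lin0 lf) subr0].
Qed.

Definition imq := subq imZ_gsubmod denom_imZ.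

(** The rank of [f], indexed by the degree in the source; [fin_dim_im] relates it to the image, in
    degree i + s. *)
Definition rk i := hf coimq i.

Lemma fin_dim_im : fin_dim X -> forall i, rk i = hf imq (i + s).
Proof.
move=> fX; have fc := fin_dim_quo kerZ_gsubmod denom_kerZ kerZ_numer fX.
have [lf fZ fB] := gf.
apply: (@fin_dim_iso coimq imq s f _ _ _ fc).2.
- split=> // i x; last by case.
  move=> Zx; split; first exact: fZ.
  by exists x; [rewrite addrK|rewrite subrr; case: (denomP Y)].
- by [].
- by move=> i y [_ [x Zx Bx]]; exists x => //; rewrite addrK in Zx.
Qed.

Lemma rk_ge0 i : 0 <= rk i. Proof. exact: hf_ge0. Qed.

Lemma hf_ker i : fin_dim X -> hf X i = hf kerq i + rk i.
Proof. exact: hf_subquo. Qed.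

End Kernel.

Lemma eq_hf_numer X Y (U V : int -> amb Y -> Prop) (gU : gsubmod U) (gV : gsubmod V) BU BV :
  (forall i x, U i x <-> V i x) -> hf (@subq Y U gU BU) =1 hf (@subq Y V gV BV).
Proof.
by move=> UV i; rewrite /hf /=; have -> : U i = V i by apply/funext => x; apply/propext.
Qed.

Definition exact_at X Y W s t (f : amb X -> amb Y) (g : amb Y -> amb W) :=
  (forall i x, numer X i x -> denom W (i + s + t) (g (f x))) /\
  (forall i y, numer Y i y -> denom W (i + t) (g y) ->
    exists2 x, numer X (i - s) x & denom Y i (y - f x)).

(** Rank-nullity for [g], whose kernel is the image of [f]. *)
Lemma hf_exact X Y W s t f g (gf : @gmor X Y s f) (gg : @gmor Y W t g) :
  exact_at s t f g -> fin_dim X -> fin_dim Y ->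
  forall i, hf Y (i + s) = rk gf i + rk gg (i + s).
Proof.
move=> [gf0 ex] fX fY i; rewrite (hf_ker gg) // (fin_dim_im gf) //.
congr (_ + _); apply: eq_hf_numer => //= {}i y; split=> [[Zy By]|[Zy [x Zx Bx]]].
  by split=> //; exact: ex.
split=> //; have := gf0 _ _ Zx; rewrite subrK => h.
have [lg _ /(_ _ _ Bx)] := gg; rewrite (linB lg) => h'.
by have := subspD (denom_sub W _) h' h; rewrite subrK.
Qed.

End Subquotients.
Arguments numer {K n} g.
Arguments denom {K n} g.

(** * Noetherian graded modules *)

Section Ideals.
Variables (K : fieldType) (n : nat).
Local Notation S := {mpoly K[n]}.
Local Notation pih := (pihomog mdeg).

Lemma pihomog_mull k d (p a : S) : a \is d.-homog ->
  pih k (p * a) = if (d <= k)%N then pih (k - d) p * a else 0.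
Proof.
move=> ha; rewrite [in LHS](pihomog_partitionE (mf := mdeg) (leqnn (msize p))).
rewrite mulr_suml raddf_sum /=.
have h j : pih j p * a \is (j + d).-homog by apply: dhomogM => //; exact: pihomogP.
case: leqP => [dk|kd]; last first.
  rewrite big1 // => j _; apply: (pihomog_ne0 _ (h j)).
  by rewrite neq_ltn (leq_trans kd) ?leq_addl ?orbT.
have [kp|pk] := ltnP (k - d) (msize p); last first.
  rewrite big1 ?[pih (k - d) p]big1_seq ?mul0r //.
    move=> m /andP[/eqP mk mp]; have := msize_mdeg_lt mp.
    by rewrite mk ltnNge pk.
  move=> j _; apply: (pihomog_ne0 _ (h j)); apply: contraTneq pk => jk.
  by rewrite -ltnNge -jk addnK.
rewrite (bigD1 (Ordinal kp)) //= (pihomog_dE (d := k)) => [|].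
  rewrite big1 ?addr0 // => j jk; apply: (pihomog_ne0 _ (h j)).
  by apply: contraNneq jk => jk; rewrite -val_eqE /= -jk addnK.
by rewrite -[in X in X.-homog](subnK dk).
Qed.

Lemma pihomog_decomp (P : S -> Prop) (p : S) : P 0 -> (forall a b, P a -> P b -> P (a + b)) ->
  (forall k, P (pih k p)) -> P p.
Proof.
move=> P0 PD h; rewrite (pihomog_partitionE (mf := mdeg) (leqnn (msize p))).
by elim/big_rec: _ => // k x _; apply: PD.
Qed.

Definition hideal (I : S -> Prop) :=
  [/\ I 0, forall a b, I a -> I b -> I (a - b), forall p a, I a -> I (p * a)
    & forall k a, I a -> I (pih k a)].

Section IdealTheory.
Variable I : S -> Prop.
Hypothesis hI : hideal I.

Lemma hid0 : I 0. Proof. by case: hI. Qed.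
Lemma hidB a b : I a -> I b -> I (a - b). Proof. by case: hI => _ + _ _; apply. Qed.
Lemma hidM p a : I a -> I (p * a). Proof. by case: hI => _ _ + _; apply. Qed.
Lemma hidMr p a : I a -> I (a * p). Proof. by rewrite mulrC; exact: hidM. Qed.
Lemma hidH k a : I a -> I (pih k a). Proof. by case: hI => _ _ _; apply. Qed.
Lemma hidN a : I a -> I (- a).
Proof. by move=> Ia; rewrite -sub0r; apply: hidB => //; exact: hid0. Qed.
Lemma hidD a b : I a -> I b -> I (a + b).
Proof. by move=> Ia /hidN Ib; rewrite -[b]opprK; exact: hidB. Qed.
Lemma hidBr a b : I b -> I (a - b) -> I a.
Proof. by move=> Ib Iab; rewrite -(subrK b a); exact: hidD. Qed.
Lemma hid_comp a : (forall k, I (pih k a)) -> I a.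
Proof. by apply: pihomog_decomp; [exact: hid0|exact: hidD]. Qed.

End IdealTheory.

Definition addid (I : S -> Prop) (a p : S) := exists q, I (p - q * a).
Definition colid (I : S -> Prop) (a p : S) := I (p * a).

Lemma hideal_add I d a : hideal I -> a \is d.-homog -> hideal (addid I a).
Proof.
move=> hI ha; split=> [|p q [u hu] [v hv]|p q [u hu]|k p [u hu]].
- by exists 0; rewrite mul0r subr0; exact: hid0.
- exists (u - v); have := hidB hI hu hv; congr I.
  by rewrite mulrBl !opprD !opprK addrACA.
- by exists (p * u); rewrite -mulrA -mulrBr; exact: hidM.
- have := hidH hI k hu; rewrite raddfB /= (pihomog_mull _ _ ha); case: leqP => _ h.
    by exists (pih (k - d) u).
  by exists 0; rewrite mul0r.
Qed.

Lemma hideal_col I d a : hideal I -> a \is d.-homog -> hideal (colid I a).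
Proof.
move=> hI ha; split=> [|p q|p q|k p]; rewrite /colid.
- by rewrite mul0r; exact: hid0.
- by rewrite mulrBl; exact: hidB.
- by rewrite -mulrA; exact: hidM.
- by move=> /(hidH hI (k + d)); rewrite (pihomog_mull _ _ ha) leq_addl addnK.
Qed.

Lemma addid_sub I a p : I p -> addid I a p.
Proof. by exists 0; rewrite mul0r subr0. Qed.

Lemma addid_mem I a : hideal I -> addid I a a.
Proof. by exists 1; rewrite mul1r subrr; exact: hid0. Qed.

Lemma colid_sub I a p : hideal I -> I p -> colid I a p.
Proof. by move=> hI Ip; exact: hidMr. Qed.

Lemma hideal0 : hideal (fun p : S => p = 0).
Proof.
split=> // [a b -> ->|p a ->|k a ->]; rewrite ?subr0 ?mulr0 //; exact: raddf0.
Qed.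

Section Dickson.

(** Beyond each chosen index take one where the minimum of [v] over the remaining indices is
    attained; such minima never decrease. *)
Lemma mono_subseq (v : nat -> nat) : exists f : nat -> nat,
  (forall k, (f k < f k.+1)%N) /\ (forall k, (v (f k) <= v (f k.+1))%N).
Proof.
have /choice[g hg] N : exists i, (N <= i)%N /\ forall j, (N <= j)%N -> (v i <= v j)%N.
  have ex : exists m, `[< exists2 i, (N <= i)%N & v i = m >].
    by exists (v N); apply/asboolP; exists N.
  case: (ex_minnP ex) => m /asboolP[i Ni <-] mmin.
  by exists i; split=> // j Nj; apply: mmin; apply/asboolP; exists j.
exists (fun k => iter k (fun i => g i.+1) (g 0%N)); split=> k /=; first exact: (hg _).1.
case: k => [|k] /=; first by apply: (hg 0%N).2.
by apply: (hg _).2; apply: leq_trans (hg _).1; apply: leqW; exact: (hg _).1.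
Qed.

(** Thinning out once for every variable leaves a subsequence along which all exponents are
    nondecreasing. *)
Lemma dickson (u : nat -> 'X_{1..n}) : exists i j, (i < j)%N /\ (u i <= u j)%MM.
Proof.
have lt_homo (f : nat -> nat) : (forall k, (f k < f k.+1)%N) ->
    forall i j, (i < j)%N -> (f i < f j)%N.
  by move=> h; exact: (@homo_ltn _ f (fun a b => (a < b)%N) ltn_trans h).
have H (s : seq 'I_n) : exists f : nat -> nat, (forall k, (f k < f k.+1)%N) /\
    forall l, l \in s -> forall k, (u (f k) l <= u (f k.+1) l)%N.
  elim: s => [|l s [f [f1 f2]]]; first by exists id.
  have [g [g1 g2]] := mono_subseq (fun k => u (f k) l).
  exists (f \o g); split=> [k|l' l's]; first by apply: lt_homo f1 _ _ (g1 k).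
  move: l's; rewrite inE => /orP[/eqP ->|/f2 h] k /=; first exact: g2.
  suff : {homo (fun k => u (f k) l') : a b / (a <= b)%N} by apply; exact: ltnW.
  exact: (@homo_leq _ _ (fun a b => (a <= b)%N) leqnn leq_trans h).
have [f [f1 f2]] := H (enum 'I_n).
exists (f 0%N), (f 1%N); split=> //; apply/mnm_lepP => l; apply: f2.
by rewrite mem_enum.
Qed.

End Dickson.

Definition subid (I J : S -> Prop) := forall a, I a -> J a.

(* Noetherian induction: along a strictly increasing chain, choose new        *)
(* homogeneous elements with minimal leading monomials; by Dickson's lemma    *)
(* one of them can be reduced by an earlier one.                              *)
Lemma hideal_ind (P : (S -> Prop) -> Prop) :
  (forall I, hideal I -> (forall J, hideal J -> subid I J -> ~ subid J I -> P J) -> P I) ->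
  forall I, hideal I -> P I.
Proof.
move=> IH I0 hI0; apply: contrapT => nP0.
pose T := {I : S -> Prop | hideal I /\ ~ P I}.
have /choice[nxt hn] (I : T) : exists J : T,
    subid (sval I) (sval J) /\ ~ subid (sval J) (sval I).
  case: I => I [hI nPI] /=; apply: contrapT => nJ; apply: nPI.
  apply: (IH _ hI) => J hJ IJ JI; apply: contrapT => nPJ.
  by apply: nJ; exists (exist _ J (conj hJ nPJ)).
pose C k := sval (iter k nxt (exist _ I0 (conj hI0 nP0))).
have hC k : hideal (C k) by case: (svalP (iter k nxt (exist _ I0 (conj hI0 nP0)))).
have CS k : subid (C k) (C k.+1) by case: (hn (iter k nxt (exist _ I0 (conj hI0 nP0)))).
have CN k : ~ subid (C k.+1) (C k) by case: (hn (iter k nxt (exist _ I0 (conj hI0 nP0)))).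
have Cle i j : (i <= j)%N -> subid (C i) (C j).
  by move=> /subnKC <-; elim: (j - i)%N => [|k h] a Ca; rewrite ?addn0 ?addnS //; apply/CS/h.
pose new k a := [/\ exists d, a \is d.-homog, C k.+1 a & ~ C k a].
have /choice[a ha] k : exists a, new k a /\
    forall b, new k b -> ~ (mlead b < mlead a)%O.
  apply: contrapT => nex.
  have none a : ~ new k a.
    elim/mleadrect: a => a h na; apply: nex; exists a; split=> // b nb ba.
    exact: h ba nb.
  apply: (CN k) => b Cb; apply: hid_comp => // d; apply: contrapT => nC.
  by apply: (none (pih d b)); split=> //; [exists d; exact: pihomogP|exact: hidH].
have [i [j [ij le]]] := dickson (fun k => mlead (a k)).
have [[[di hi] Ci Ni] _] := ha i; have [[[dj hj] Cj Nj] aj] := ha j.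
have ai0 : a i != 0 by apply: contra_not_neq Ni => ->; exact: hid0.
have aj0 : a j != 0 by apply: contra_not_neq Nj => ->; exact: hid0.
have [m mE] : exists m, (m + mlead (a i) = mlead (a j))%MM.
  by exists (mlead (a j) - mlead (a i))%MM; rewrite submK.
(* [q] is the multiple of [a i] with the leading term of [a j]. Thus a j - q is again new at stage j
   and has a smaller leading monomial, against the choice of [a j]. *)
pose c := mleadc (a j) / mleadc (a i).
pose q := c *: 'X_[m] * a i.
have c0 : c != 0 by rewrite mulf_neq0 ?invr_eq0 ?mleadc_eq0.
have qE : q = c *: ('X_[m] * a i) by rewrite /q scalerAl.
have q0 : 'X_[m] * a i != 0 :> S.
  by rewrite mulf_neq0 // -mleadc_eq0 mleadXm mcoeffX eqxx oner_eq0.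
have ql : mlead q = mlead (a j).
  by rewrite qE mleadZ // mleadM -?mE ?mleadXm // -mleadc_eq0 mleadXm mcoeffX eqxx oner_eq0.
have Cq : C j q by apply: hidM => //; apply: Cle Ci.
have nb : ~ C j (a j - q) by move=> h; apply: Nj; apply: hidBr h.
have b0 : a j - q != 0 by apply: contra_not_neq nb => ->; exact: hid0.
apply: (aj (a j - q)).
  split=> //; last by apply: hidB => //; exact: CS.
  exists dj; apply: rpredB => //; rewrite qE; apply: dhomogZ.
  have -> : dj = (mdeg m + di)%N.
    have <- : mdeg (mlead (a j)) = dj := dhomog_mf hj (mlead_supp aj0).
    have <- : mdeg (mlead (a i)) = di := dhomog_mf hi (mlead_supp ai0).
    by rewrite -mE mdegD.
  by apply: dhomogM => //; rewrite dhomogX.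
have le2 : (mlead (a j - q) <= mlead (a j))%O.
  by apply: le_trans (mleadB_le _ _) _; rewrite ql joinxx.
rewrite lt_neqAle le2 andbT; apply: contraNneq b0 => e.
rewrite -mleadc_eq0 e mcoeffB.
have -> : q@_(mlead (a j)) = c * mleadc (a i).
  by rewrite qE mcoeffZ -mE ['X_[m] * _]mulrC mcoeffMX.
by rewrite /c divfK ?subrr // mleadc_eq0.
Qed.

Lemma hideal_ext (I J : S -> Prop) : subid I J -> subid J I -> I = J.
Proof.
by move=> h1 h2; apply/funext => p; apply/propext; split; [exact: h1|exact: h2].
Qed.

(** Noetherian induction on an ideal J inside I: as long as J differs from I, some homogeneous
    element of I can be adjoined to J. *)
Lemma hideal_gen_ind (P : (S -> Prop) -> Prop) :
  P (fun p => p = 0) ->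
  (forall I a d, hideal I -> a \is d.-homog -> P I -> P (addid I a)) ->
  forall I, hideal I -> P I.
Proof.
move=> P0 PS I hI.
suff H J : hideal J -> subid J I -> P J -> P I.
  by apply: (H _ hideal0) => // _ ->; exact: hid0.
move: J; apply: hideal_ind => J hJ IH JI PJ.
have [IJ|nIJ] := pselect (subid I J); first by rewrite (hideal_ext IJ JI).
have [d [a [ha Ia nJa]]] : exists d a, [/\ a \is d.-homog, I a & ~ J a].
  apply: contrapT => nex; apply: nIJ => b Ib; apply: hid_comp => // d.
  apply: contrapT => nJ; apply: nex; exists d, (pih d b).
  by split=> //; [exact: pihomogP|exact: hidH].
apply: (IH (addid J a)); first exact: hideal_add ha.
- by move=> b; exact: addid_sub.
- by move=> h; apply: nJa; apply: h; exact: addid_mem.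
- move=> b [q Jb]; apply: hidBr (JI _ Jb) => //; exact: hidM.
- exact: PS ha PJ.
Qed.

End Ideals.

(** * Finitely generated graded subquotients are Noetherian *)

Section FiniteGeneration.
Variables (K : fieldType) (n : nat).
Local Notation S := {mpoly K[n]}.
Local Notation pih := (pihomog mdeg).
Local Notation gsq := (gsq K n).
Implicit Types X Y W : gsq.

Lemma numer0 X i : numer X i 0. Proof. by case: (numerP X). Qed.
Lemma denom0 X i : denom X i 0. Proof. by case: (denomP X). Qed.

Lemma rdeg0 i : ring_deg i (0 : S^o). Proof. exact: ring_deg0. Qed.
Lemma rdegB i (p q : S^o) : ring_deg i p -> ring_deg i q -> ring_deg i (p - q).
Proof. exact: ring_degB. Qed.
Lemma ring_gsubmod : gsubmod (fun i (p : S^o) => ring_deg i p).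
Proof.
split=> [i|i x y|i k p x]; [exact: rdeg0|exact: rdegB|exact: ring_degZ].
Qed.

Lemma rdegM i j (p q : S) : ring_deg i (p : S^o) -> ring_deg j (q : S^o) ->
  ring_deg (i + j) (p * q : S^o).
Proof. by move=> hp hq; rewrite addrC; exact: (gsubmodZ ring_gsubmod hp hq). Qed.

Definition pihz (i : int) (p : S) : S := if i is Posz k then pih k p else 0.

Lemma pihz_deg i p : ring_deg i (pihz i p : S^o).
Proof. by case: i => k //=; exact: pihomogP. Qed.

Lemma pihz_dE i (p : S) : ring_deg i (p : S^o) -> pihz i p = p.
Proof. by case: i => k /=; [exact: pihomog_dE|move=> ->]. Qed.

Lemma pihzB i (p q : S) : pihz i (p - q) = pihz i p - pihz i q.
Proof. by case: i => k /=; [exact: raddfB|rewrite subr0]. Qed.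

Lemma pihz_mull i d (p a : S) : a \is d.-homog -> pihz i (p * a) = pihz (i - d%:Z) p * a.
Proof.
move=> ha; case: i => k /=; last first.
  have -> : Negz k - d%:Z = Negz (k + d) by lia.
  by rewrite mul0r.
rewrite (pihomog_mull _ _ ha); case: leqP => h; first by rewrite subzn.
by case E: (k%:Z - d%:Z) => [j|j] /=; [exfalso; lia|rewrite mul0r].
Qed.

Definition span_deg (A : lmodType S) (B : int -> A -> Prop) m (e : 'I_m -> int)
    (g : 'I_m -> A) i x :=
  exists c : 'I_m -> S, (forall k, ring_deg (i - e k) (c k : S^o)) /\
    B i (x - \sum_(k < m) c k *: g k).

Definition fg X := exists m (e : 'I_m -> int) (g : 'I_m -> amb X),
  (forall k, numer X (e k) (g k)) /\
  forall i x, numer X i x -> span_deg (denom X) e g i x.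

Lemma span_gsubmod (A : lmodType S) (B : int -> A -> Prop) m (e : 'I_m -> int) g :
  gsubmod B -> gsubmod (span_deg B e g).
Proof.
move=> gB; have [B0 BB BZ] := gB; split=> [i|i x y [c [hc Bc]] [d [hd Bd]]|i k p x hp [c [hc Bc]]].
- exists (fun=> 0); split=> [k|]; first exact: rdeg0.
  by rewrite big1 ?subr0 // => k _; rewrite scale0r.
- exists (fun k => c k - d k); split=> [k|]; first exact: rdegB.
  have := BB _ _ _ Bc Bd; congr (B _ _).
  under [in RHS]eq_bigr do rewrite scalerBl.
  by rewrite sumrB !opprD !opprK addrACA.
- exists (fun k => p * c k); split=> [l|].
    by rewrite [i + _]addrC -addrA; apply: rdegM.
  under eq_bigr do rewrite -scalerA.
  by rewrite -scaler_sumr -scalerBr; exact: BZ.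
Qed.

Lemma denom_span (A : lmodType S) (B : int -> A -> Prop) m (e : 'I_m -> int) g i x :
  B i x -> span_deg B e g i x.
Proof.
exists (fun=> 0); split=> [k|]; first exact: rdeg0.
by rewrite big1 ?subr0 // => k _; rewrite scale0r.
Qed.

Lemma gsubmod_sum (A : lmodType S) (U : int -> A -> Prop) m (e : 'I_m -> int)
    (g : 'I_m -> A) (c : 'I_m -> S) i :
  gsubmod U -> (forall k, U (e k) (g k)) -> (forall k, ring_deg (i - e k) (c k : S^o)) ->
  U i (\sum_(k < m) c k *: g k).
Proof.
move=> gU Ug hc; apply: subsp_sum => [|k]; first exact: gsubmod_subspace.
by have := gsubmodZ gU (hc k) (Ug k); rewrite addrC subrK.
Qed.

Lemma span_numer X m (e : 'I_m -> int) (g : 'I_m -> amb X) i x :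
  (forall k, numer X (e k) (g k)) -> span_deg (denom X) e g i x -> numer X i x.
Proof.
move=> hg [c [hc Bc]]; rewrite -(subrK (\sum_(k < m) c k *: g k) x).
apply: (subspD (numer_sub X i)); first exact: denom_numer.
by apply: (gsubmod_sum (numerP X) hg hc).
Qed.

(** Degree i is spanned by the products of the generators with the monomials of degree below [N];
    the finite type [T] indexes these products. *)
Lemma fg_fin_dim X : fg X -> fin_dim X.
Proof.
move=> [m [e [g [hg sg]]]] i.
pose N := (\sum_(k < m) absz (i - e k)%R).+1.
have Nk k : (absz (i - e k)%R < N)%N by rewrite ltnS (bigD1 k) //= leq_addr.
pose T := ('I_m * 'X_{1..n < N})%type.
pose b (t : T) : amb X := 'X_[bmnm t.2] *: g t.1.
suff sp : spans (denom X i) (numer X i) (fun k : 'I_#|{: T}| => b (enum_val k)).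
  exact: (hasdim_sub (denom_sub X i) sp (fun x h => h)).
move=> x /sg[c [hc Bc]]; exists (fun k => (c (enum_val k).1)@_(bmnm (enum_val k).2)).
suff -> : \sum_(k < #|{: T}|) ((c (enum_val k).1)@_(bmnm (enum_val k).2))%:MP *: b (enum_val k) =
  \sum_(k < m) c k *: g k by [].
rewrite -(reindex (fun k : 'I_#|{: T}| => enum_val k) (P := predT)
  (F := fun t : T => ((c t.1)@_(bmnm t.2))%:MP *: b t)); last first.
  exact/onW_bij/enum_val_bij.
rewrite -(pair_bigA _ (fun k (t : 'X_{1..n < N}) => ((c k)@_t)%:MP *: b (k, t))) /=.
apply: eq_bigr => k _.
rewrite [c k in RHS](mpolywE (k := N)) ?scaler_suml => [|]; last first.
  have := hc k; have := Nk k; case: (i - e k) => d /= dN hd; last by rewrite hd msize0.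
  have [->|c0] := eqVneq (c k) 0; first by rewrite msize0.
  rewrite -mlead_deg //.
  by have -> : mdeg (mlead (c k)) = d := dhomog_mf hd (mlead_supp c0).
by apply: eq_bigr => t _; rewrite /b scalerA mul_mpolyC.
Qed.

Lemma fg_bounded X : fg X -> bounded_left (hf X).
Proof.
move=> fX; have fd := fg_fin_dim fX; have [m [e [g [hg sg]]]] := fX.
exists (- (\sum_(k < m) absz (e k))%N%:Z) => i hi; apply/hf0P => // x /sg[c [hc]].
rewrite big1 ?subr0 // => k _; suff -> : c k = 0 by rewrite scale0r.
have : i - e k < 0 by move: hi; rewrite (bigD1 k) //=; lia.
by move: (hc k); case: (i - e k).
Qed.

Record noeth X : Prop := Noeth {
  noeth_subq : forall U (gU : gsubmod U) (BU : forall i x, denom X i x -> U i x),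
    (forall i x, U i x -> numer X i x) -> fg (subq gU BU)
}.

Lemma noeth_fg X : noeth X -> fg X.
Proof.
move=> /noeth_subq/(_ _ (numerP X) (@denom_numer _ _ X) (fun _ _ h => h)).
by case=> m [e [g [hg sg]]]; exists m, e, g.
Qed.

Lemma noeth_fin_dim X : noeth X -> fin_dim X.
Proof. by move=> /noeth_fg /fg_fin_dim. Qed.

Lemma noeth_bounded X : noeth X -> bounded_left (hf X).
Proof. by move=> /noeth_fg /fg_bounded. Qed.

Lemma noeth_sub X U (gU : gsubmod U) BU (UZ : forall i x, U i x -> numer X i x) :
  noeth X -> noeth (@subq _ _ X U gU BU).
Proof. by move=> nX; split=> V gV BV VU; apply: (noeth_subq nX) => i x /VU /UZ. Qed.

Lemma noeth_quo X U (gU : gsubmod U) (BU : forall i x, denom X i x -> U i x) UZ :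
  noeth X -> noeth (@quoq _ _ X U gU UZ).
Proof.
move=> nX; split=> V gV UV VZ.
have [m [e [g [hg sg]]]] := noeth_subq nX gV (fun i x h => UV i x (BU i x h)) VZ.
exists m, e, g; split=> // i x /sg[c [hc Bc]]; exists c; split=> //; exact: (BU _ _ Bc).
Qed.

Lemma noeth_zero X : (forall i x, numer X i x -> denom X i x) -> noeth X.
Proof.
move=> ZB; split=> U gU BU UZ; exists 0%N, (fun=> 0), (fun=> 0); split=> [[]//|i x /UZ /ZB Bx].
exact: denom_span.
Qed.

(** A submodule of Y is generated by lifts of generators of its image in W together with the images
    of generators of its preimage in X. *)
Lemma noeth_exact X Y W s t f g : @gmor _ _ X Y s f -> @gmor _ _ Y W t g ->
  (forall i y, numer Y i y -> denom W (i + t) (g y) ->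
    exists2 x, numer X (i - s) x & denom Y i (y - f x)) ->
  noeth X -> noeth W -> noeth Y.
Proof.
move=> [lf fZ fB] [lg gZ gB] ex nX nW; split=> U gU BU UZ.
have [U0 UB UZ'] := gU.
pose V j w := numer W j w /\ exists2 u, U (j - t) u & denom W j (w - g u).
have gV : gsubmod V.
  have [W0 WB WZ] := numerP W; have [w0 wB wZ] := denomP W.
  split=> [i|i x y [x1 [u u1 u2]] [y1 [v v1 v2]]|i k p x hp [x1 [u u1 u2]]]; split.
  - exact: W0.
  - by exists 0; [exact: U0|rewrite (lin0 lg) subr0; exact: w0].
  - exact: WB.
  - exists (u - v); first exact: UB.
    have := wB _ _ _ u2 v2; congr (denom _ _ _).
    by rewrite (linB lg) !opprD !opprK addrACA.
  - exact: WZ.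
  - exists (p *: u); first by rewrite addrAC; exact: UZ'.
    by rewrite (linZ lg) -scalerBr; exact: wZ.
have BV i w : denom W i w -> V i w.
  move=> Bw; split; first exact: denom_numer.
  by exists 0; [exact: U0|rewrite (lin0 lg) subr0].
have VZ i w : V i w -> numer W i w by case.
have [m [e [w [hw sw]]]] := noeth_subq nW gV BV VZ.
have /choice[u hu] k : exists u, U (e k - t) u /\ denom W (e k) (w k - g u).
  by case: (hw k) => _ [u u1 u2]; exists u.
pose T i x := numer X i x /\ U (i + s) (f x).
have gT : gsubmod T.
  have [W0 WB WZ] := numerP X.
  split=> [i|i x y [x1 x2] [y1 y2]|i k p x hp [x1 x2]]; split.
  - exact: W0.
  - by rewrite (lin0 lf); exact: U0.
  - exact: WB.
  - by rewrite (linB lf); exact: UB.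
  - exact: WZ.
  - by rewrite (linZ lf) addrAC; exact: UZ'.
have BT i x : denom X i x -> T i x.
  by move=> Bx; split; [exact: denom_numer|exact/BU/fB].
have [m' [e' [x [hx sx]]]] := noeth_subq nX gT BT (fun i x => @proj1 _ _).
exists (m + m')%N, (fun k => match split k with inl k => e k - t | inr k => e' k + s end),
  (fun k => match split k with inl k => u k | inr k => f (x k) end); split=> [k|i y Uy].
  by case: split => l /=; [case: (hu l)|case: (hx l)].
have Vy : V (i + t) (g y).
  split; first exact/gZ/UZ.
  by exists y; rewrite ?addrK // subrr; exact: denom0.
have [c [hc Bc]] := sw _ _ Vy.
have Uc : U i (\sum_(k < m) c k *: u k).
  apply: (gsubmod_sum gU (e := fun k => e k - t)) => k; first by case: (hu k).
  by have := hc k; congr (ring_deg _ _); lia.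
have [z Zz Bz] : exists2 z, numer X (i - s) z & denom Y i (y - \sum_(k < m) c k *: u k - f z).
  apply: ex; first exact/UZ/UB.
  rewrite (linB lg) (lin_sum lg); apply: subsp_trans Bc _; first exact: denom_sub.
  rewrite -sumrB; apply: subsp_sum => [|k]; first exact: denom_sub.
  rewrite (linZ lg) -scalerBr; have [_ h] := hu k.
  by have := gsubmodZ (denomP W) (hc k) h; rewrite addrC subrK.
have Tz : T (i - s) z.
  split=> //; rewrite subrK.
  have := UB _ _ _ (UB _ _ _ Uy Uc) (BU _ _ Bz); by rewrite opprB addrC subrK.
have [d [hd Bd]] := sx _ _ Tz.
exists (fun k => match split k with inl k => c k | inr k => d k end); split=> [k|].
  case: split => l.
    by have := hc l; congr (ring_deg _ _); lia.
  by have := hd l; congr (ring_deg _ _); lia.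
rewrite sum_split_ord.
under eq_bigr do rewrite !split_lshift.
under [X in _ - (_ + X)]eq_bigr do rewrite !split_rshift.
rewrite opprD addrA; apply: subsp_trans Bz _; first exact: denom_sub.
have := fB _ _ Bd; rewrite subrK (linB lf) (lin_sum lf); congr (denom _ _ (_ - _)).
by apply: eq_bigr => l _; exact: linZ.
Qed.

Lemma noeth_inj Y W t g : @gmor _ _ Y W t g ->
  (forall i y, numer Y i y -> denom W (i + t) (g y) -> denom Y i y) -> noeth W -> noeth Y.
Proof.
move=> gg inj; apply: (@noeth_exact (quoq (numerP Y) (fun _ _ h => h)) Y W 0 t (fun=> 0) g) => //.
- split=> [a x y|i x _|i x _]; first by rewrite scaler0 addr0.
    exact: numer0.
  exact: denom0.
- move=> i y Zy By; exists 0; last by rewrite subr0; exact: inj.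
  exact: numer0.
- by apply: noeth_zero.
Qed.

Lemma noeth_surj X Y s f : @gmor _ _ X Y s f ->
  (forall i y, numer Y i y -> exists2 x, numer X (i - s) x & denom Y i (y - f x)) ->
  noeth X -> noeth Y.
Proof.
move=> gf sur nX.
apply: (@noeth_exact X Y (quoq (numerP Y) (fun _ _ h => h)) s 0 f (fun=> 0)) => //.
- split=> [a x y|i x _|i x _]; first by rewrite scaler0 addr0.
    exact: numer0.
  exact: numer0.
- by move=> i y Zy _; exact: sur.
- by apply: noeth_zero.
Qed.

(** The ideal of all p with p g in [U], for g of degree s. It is tested on homogeneous components
    because [U] contains homogeneous elements only. *)
Definition transporter (A : lmodType S) (U : int -> A -> Prop) s (g : A) (p : S) :=
  forall k, U (s + k%:Z) (pih k p *: g).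

Lemma hideal_transporter (A : lmodType S) (U : int -> A -> Prop) s (g : A) :
  gsubmod U -> hideal (transporter U s g).
Proof.
move=> gU; have [U0 UB UZ] := gU; split=> [k|a b ha hb k|p a ha k|k a ha j].
- by rewrite raddf0 scale0r; exact: U0.
- by rewrite raddfB scalerBl; exact: UB.
- rewrite [a](pihomog_partitionE (mf := mdeg) (leqnn (msize a))) mulr_sumr raddf_sum /= scaler_suml.
  apply: subsp_sum => [|d]; first exact: gsubmod_subspace.
  rewrite (pihomog_mull _ _ (pihomogP _ d a)); case: leqP => dk; last by rewrite scale0r; exact: U0.
  rewrite -scalerA -{1}(subnKC dk) PoszD addrA; apply: UZ; last exact: ha.
  exact: pihomogP.
- have [->|jk] := eqVneq k j; first by rewrite pihomog_id.
  by rewrite (pihomog_ne0 jk (pihomogP _ _ _)) scale0r; exact: U0.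
Qed.

Lemma transporterE (A : lmodType S) (U : int -> A -> Prop) s (g : A) i (p : S) :
  gsubmod U -> ring_deg i (p : S^o) -> transporter U s g p <-> U (s + i) (p *: g).
Proof.
move=> [U0 _ _]; case: i => d /= hp; last first.
  by rewrite hp; split=> [_|_ k]; rewrite ?raddf0 ?scale0r; exact: U0.
split=> [/(_ d)|h k]; first by rewrite pihomog_dE.
have [<-|dk] := eqVneq d k; first by rewrite pihomog_dE.
by rewrite (pihomog_ne0 dk hp) scale0r; exact: U0.
Qed.

Section IdealQuotient.
Variables (I : S -> Prop) (hI : hideal I).

Definition idZ (i : int) (p : S^o) := ring_deg i p /\ I p.

Lemma idZ_gsubmod : gsubmod idZ.
Proof.
split=> [i|i x y [x1 x2] [y1 y2]|i k p x hp [x1 x2]]; split.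
- exact: rdeg0.
- exact: hid0.
- exact: rdegB.
- exact: hidB.
- exact: ring_degZ.
- exact: hidM.
Qed.

Definition idq : gsq := Gsq ring_gsubmod idZ_gsubmod (fun i x => @proj1 _ _).

End IdealQuotient.

(** Hilbert's basis theorem: [U] becomes the homogeneous ideal [transporter U 0 1], and
    [hideal_gen_ind] builds finite generating systems. *)
Lemma noeth_ring : noeth (idq (@hideal0 K n)).
Proof.
split=> U gU BU UZ.
have hT := hideal_transporter 0 (1 : S^o) gU.
pose gens (J : S -> Prop) := exists m (e : 'I_m -> nat) (g : 'I_m -> S),
  (forall k, g k \is (e k).-homog /\ J (g k)) /\
  forall a, J a -> exists c : 'I_m -> S, a = \sum_(k < m) c k * g k.
have [||m [e [g [hg sg]]]] := @hideal_gen_ind _ _ gens _ _ _ hT.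
- exists 0%N, (fun=> 0%N), (fun=> 0); split=> [[]//|a ->].
  by exists (fun=> 0); rewrite big_ord0.
- move=> I a d hI ha [m [e [g [hg sg]]]].
  exists m.+1, (fun k => if unlift ord_max k is Some j then e j else d),
    (fun k => if unlift ord_max k is Some j then g j else a); split=> [k|b [q /sg[c hc]]].
    case: unliftP => [j _|_]; last by split=> //; exact: addid_mem.
    by have [h1 h2] := hg j; split=> //; exact: addid_sub.
  exists (fun k => if unlift ord_max k is Some j then c j else q).
  rewrite big_ord_recr /= unlift_none -[b](subrK (q * a)) hc; congr (_ + _).
  apply: eq_bigr => j _.
  have -> : widen_ord (leqnSn m) j = lift ord_max j by apply: val_inj; rewrite /= /bump leqNgt ltn_ord.
  by rewrite liftK.
exists m, (fun k => (e k)%:Z), g; split=> [k|i x Ux] /=.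
  have [h1] := hg k; move/(transporterE (i := e k) 0 _ gU h1).
  by rewrite add0r [_ *: _]mulr1.
have rx := UZ _ _ Ux.
have : transporter U 0 (1 : S^o) x.
  by apply/(transporterE _ _ gU rx); rewrite add0r [_ *: _]mulr1.
(* As x is homogeneous, each coefficient may be replaced by its component of the matching degree. *)
move=> /sg[c hc]; exists (fun k => pihz (i - (e k)%:Z) (c k)).
split=> [k|]; first exact: pihz_deg.
suff -> : \sum_(k < m) pihz (i - (e k)%:Z) (c k) *: (g k : S^o) = x by rewrite subrr; split=> //; exact: rdeg0.
transitivity (pihz i x); last exact: pihz_dE.
have raddz (r : seq 'I_m) (F : 'I_m -> S) : pihz i (\sum_(k <- r) F k) = \sum_(k <- r) pihz i (F k).
  by case: (i) => j /=; [exact: raddf_sum|rewrite big1].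
rewrite hc raddz; apply: eq_bigr => k _; have [h1 _] := hg k.
by rewrite (pihz_mull _ _ h1).
Qed.

Lemma noeth_id I (hI : hideal I) : noeth (idq hI).
Proof.
apply: (@noeth_quo (idq (@hideal0 K n)) _ (idZ_gsubmod hI)); last exact: noeth_ring.
by move=> i x [h1 ->]; split; [exact: rdeg0|exact: hid0].
Qed.

(* A module generated by [g] of degree [s] is a shift of [S / Ann g].         *)
Section Cyclic.
Variables (X : gsq) (s : int) (g : amb X).
Hypothesis Zg : numer X s g.
Hypothesis cyc : forall i x, numer X i x ->
  exists2 c : S, ring_deg (i - s) (c : S^o) & denom X i (x - c *: g).

Definition annid := transporter (denom X) s g.
Definition hideal_annid : hideal annid := hideal_transporter s g (denomP X).

Definition cycm (p : S^o) : amb X := (p : S) *: g.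

Lemma cycm_gmor : @gmor _ _ (idq hideal_annid) X s cycm.
Proof.
split=> [a x y|i x /= hx|i x /= [hx ax]]; rewrite /cycm.
- by rewrite scalerDl scalerA.
- by rewrite addrC; apply: gsubmodZ Zg => //; exact: numerP.
- by rewrite addrC; apply/(transporterE _ _ (denomP X) hx).
Qed.

Lemma noeth_cyc : noeth X.
Proof.
apply: (noeth_surj cycm_gmor _ (noeth_id _)) => i y /cyc[c hc Bc].
by exists c.
Qed.

Lemma hf_cyc i : hf (idq hideal_annid) i = hf X (i + s).
Proof.
apply: (fin_dim_iso cycm_gmor _ _ (noeth_fin_dim (noeth_id _))).2.
  move=> {}i x /= hx; rewrite /cycm addrC => h; split=> //.
  by apply/(transporterE _ _ (denomP X) hx).
by move=> {}i y /cyc[c]; rewrite addrK => hc Bc; exists c.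
Qed.

End Cyclic.

(** Induction on the number of generators: modulo the span of all but the last one, the module is
    cyclic. *)
Lemma fg_ind (P : gsq -> Prop) :
  (forall X, (forall i x, numer X i x -> denom X i x) -> P X) ->
  (forall X U gU BU UZ, fg X -> P (@subq _ _ X U gU BU) -> P (@quoq _ _ X U gU UZ) -> P X) ->
  (forall X s g, numer X s g -> (forall i x, numer X i x ->
      exists2 c : S, ring_deg (i - s) (c : S^o) & denom X i (x - c *: g)) -> P X) ->
  forall X, fg X -> P X.
Proof.
move=> P0 Pext Pcyc X [m [e [g [hg sg]]]].
elim: m X e g hg sg => [|m IH] X e g hg sg.
  by apply: P0 => i x /sg[c [_]]; rewrite big_ord0 subr0.
pose e' k := e (widen_ord (leqnSn m) k); pose g' k := g (widen_ord (leqnSn m) k).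
have hg' k : numer X (e' k) (g' k) by exact: hg.
have gU := span_gsubmod e' g' (denomP X).
have BU i x := @denom_span _ (denom X) _ e' g' i x.
have UZ i x := @span_numer X _ e' g' i x hg'.
apply: (Pext X _ gU BU UZ); first by exists m.+1, e, g.
  apply: (IH (subq gU BU) e' g') => [k|i x //]; exists (fun j => (j == k)%:R); split=> [j|].
    case: eqP => [->|_]; last exact: rdeg0.
    by rewrite subrr /=; exact: dhomog1.
  rewrite (bigD1 k) //= eqxx scale1r big1 ?addr0 ?subrr; first exact: denom0.
  by move=> j /negPf ->; rewrite scale0r.
apply: (Pcyc (quoq gU UZ) (e ord_max) (g ord_max)) => [|i x /sg[c [hc Bc]]]; first exact: hg.
exists (c ord_max) => //; exists (fun k => c (widen_ord (leqnSn m) k)); split=> [k|].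
  exact: hc.
by move: Bc; rewrite big_ord_recr /= opprD addrA addrAC.
Qed.

Lemma noeth_ext X U gU (BU : forall i x, denom X i x -> U i x)
    (UZ : forall i x, U i x -> numer X i x) :
  noeth (@subq _ _ X U gU BU) -> noeth (@quoq _ _ X U gU UZ) -> noeth X.
Proof.
apply: (@noeth_exact (subq gU BU) X (quoq gU UZ) 0 0 id id).
- by split=> [a x y|i x /UZ|i x]; rewrite ?addr0.
- by split=> [a x y|i x|i x /BU]; rewrite ?addr0.
- move=> i y Zy; rewrite addr0 => Uy; exists y; rewrite ?subr0 // subrr.
  exact: denom0.
Qed.

Lemma fg_noeth X : fg X -> noeth X.
Proof.
apply: fg_ind => [Y|Y U gU BU UZ|Y s g Zg cyc]; first exact: noeth_zero.
- by move=> _; exact: noeth_ext.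
- exact: (noeth_cyc Zg cyc).
Qed.

End FiniteGeneration.

(** * Hilbert series and Krull dimension *)

Section HilbertSerre.
Variables (K : fieldType) (n : nat).
Local Notation S := {mpoly K[n]}.
Local Notation gsq := (gsq K n).
Implicit Types X Y W : gsq.

(** Multiplication by [a] identifies S / (I : a), shifted by d, with the submodule (I + a) / I of S
    / I. *)
Lemma hf_id_split (I : S -> Prop) a d (hI : hideal I) (hC : hideal (colid I a)) (hA : hideal (addid I a)) i :
  a \is d.-homog -> hf (idq hI) i = hf (idq hC) (i - d%:Z) + hf (idq hA) i.
Proof.
move=> ha.
have BU j (x : S^o) : denom (idq hI) j x -> idZ (addid I a) j x.
  by case=> h1 h2; split=> //; exact: addid_sub.
have UZ j (x : S^o) : idZ (addid I a) j x -> numer (idq hI) j x by case.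
rewrite (@hf_subquo _ _ (idq hI) _ (idZ_gsubmod hA) BU UZ _ (noeth_fin_dim (noeth_id hI))).
congr (_ + _); apply/esym; rewrite -{2}(subrK d%:Z i).
pose f (p : S^o) : S^o := (p : S) * a.
have gf : @gmor _ _ (idq hC) (@subq _ _ (idq hI) _ (idZ_gsubmod hA) BU) d%:Z f.
  split=> [b x y|j x /= hx|j x [hx /= cx]]; rewrite /f /=.
  - by rewrite mulrDl -mulrA.
  - split; first exact: rdegM.
    by exists x; rewrite subrr; exact: hid0.
  - by split=> //; exact: rdegM.
apply: (fin_dim_iso gf _ _ (noeth_fin_dim (noeth_id hC))).2 => j x; first by move=> hx [].
move=> [hx [q hq]]; exists (pihz j q); first exact: pihz_deg.
split.
  by apply: rdegB => //; apply: rdegM => //; exact: pihz_deg.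
have -> : (x : S) - pihz j q * a = pihz (j + d%:Z) (x - q * a).
  by rewrite pihzB (pihz_dE hx) (pihz_mull _ _ ha) addrK.
by case: (j + d%:Z) => k /=; [exact: hidH|exact: hid0].
Qed.

Lemma eq_hf_idq (I J : S -> Prop) (hI : hideal I) (hJ : hideal J) : (forall p, I p <-> J p) ->
  hf (idq hI) =1 hf (idq hJ).
Proof.
move=> IJ i; rewrite /hf /=.
by have -> : idZ I i = idZ J i by apply/funext => x; apply/propext; rewrite /idZ IJ.
Qed.

Lemma hf_id_full (I : S -> Prop) (hI : hideal I) : I 1 -> hf (idq hI) =1 fun=> 0.
Proof.
move=> I1 i; apply/(hf0P _ (noeth_fin_dim (noeth_id hI))) => x hx; split=> //.
by rewrite -[x](@mulr1 S); exact: hidM.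
Qed.

Lemma vars_const (I : S -> Prop) : hideal I -> (forall l : 'I_n, I 'X_l) ->
  forall a : S, I (a - (a@_0%MM)%:MP).
Proof.
move=> hI vI a.
have monI (m : 'X_{1..n}) : m != 0%MM -> I 'X_[m].
  move=> m0; have [l ml] : exists l, m l != 0%N.
    apply/existsP; rewrite -negb_forall; apply: contra m0 => /forallP h.
    by apply/eqP/mnmP => l; rewrite mnm0E; apply/eqP.
  have -> : m = (m - U_(l) + U_(l))%MM.
    rewrite submK //; apply/mnm_lepP => j; rewrite mnm1E; case: eqP => //= <-.
    by rewrite lt0n.
  by rewrite mpolyXD; apply: hidM.
have H (r : seq 'X_{1..n}) (c : 'X_{1..n} -> K) :
    I (\sum_(m <- r | m != 0%MM) c m *: 'X_[m]).
  elim/big_rec: _ => [|m x m0 Ix]; first exact: hid0.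
  by apply: hidD => //; rewrite -mul_mpolyC; apply: hidM => //; exact: monI.
suff -> : a - (a@_0%MM)%:MP = \sum_(m <- msupp a | m != 0%MM) a@_m *: 'X_[m] by [].
rewrite {1}[a]mpolyE (bigID (fun m => m == 0%MM)) /=.
suff -> : \sum_(m <- msupp a | m == 0%MM) a@_m *: 'X_[m] = (a@_0%MM)%:MP.
  by rewrite addrAC subrr add0r.
rewrite -big_filter; case: (boolP (0%MM \in msupp a)) => h.
  by rewrite filter_pred1_uniq ?msupp_uniq // big_seq1 mpolyX0 alg_mpolyC.
rewrite (memN_msupp_eq0 h) mpolyC0 big1_seq // => m /andP[_].
by rewrite mem_filter => /andP[/eqP -> hm]; rewrite hm in h.
Qed.

Lemma vars_idealP (I : S -> Prop) : hideal I -> (forall l : 'I_n, I 'X_l) -> ~ I 1 ->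
  forall a : S, I a <-> a@_0%MM = 0.
Proof.
move=> hI vI I1 a; have h := vars_const hI vI a; split=> [Ia|a0]; last first.
  by rewrite a0 mpolyC0 subr0 in h.
apply: contra_not_eq I1 => a0.
have := hidB hI Ia h; rewrite opprB addrC subrK => /(hidM hI ((a@_0%MM)^-1)%:MP).
by rewrite -mpolyCM mulVf.
Qed.

Lemma hf_maximal (I : S -> Prop) (hI : hideal I) : (forall l : 'I_n, I 'X_l) -> ~ I 1 ->
  rat 0 (hf (idq hI)) 1.
Proof.
move=> vI I1; have IE := vars_idealP hI vI I1.
have fd := noeth_fin_dim (noeth_id hI).
have h0 : hf (idq hI) 0 = 1.
  apply: (@hf_eq _ _ _ _ 1); exists (fun=> 1 : S^o); split=> [_|x hx|c].
  - exact: dhomog1.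
  - exists (fun=> (x : S)@_0%MM); rewrite big_ord1; split.
      apply: rdegB => //; rewrite [_ *: _]mulr1 /=.
      by rewrite -[(_)%:MP]mulr1 mul_mpolyC; apply: dhomogZ; exact: dhomog1.
    by rewrite [_ *: _]mulr1; exact: vars_const.
  - rewrite big_ord1 [_ *: _]mulr1 => -[_ /IE]; rewrite mcoeffC eqxx mulr1 => c0 k.
    by rewrite [k]ord1.
have hN i : i != 0 -> hf (idq hI) i = 0.
  move=> i0; apply/hf0P => // x hx; split=> //; apply/IE.
  case: i i0 hx => k /= k0 hx; last by rewrite hx mcoeff0.
  by apply: (dhomog_nemf_coeff hx); rewrite mf0 eq_sym.
exists (fun i => if 0 <= i then 1 else 0).
  split; first by exists 0 => i i0; rewrite leNgt i0.
  by exists 0 => i ->.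
move=> i; rewrite /delta; have [->|i0] := eqVneq i 0; first by rewrite h0 subr0.
rewrite hN //; case: ifP; case: ifP; lia.
Qed.

Lemma dhomog_var (l : 'I_n) : ('X_l : S) \is 1.-homog.
Proof. by rewrite dhomogX; apply/eqP; exact: mdeg1. Qed.

Definition rational (h : int -> int) := exists d e, rat d h e.

(** Noetherian induction with a variable x outside I. If (I : x) is larger than I, both outer terms
    of the sequence for x are known. Otherwise x is regular on S / I, and [delta] of its Hilbert
    function is the Hilbert function of S / (I + x). *)
Lemma rational_id (I : S -> Prop) (hI : hideal I) : rational (hf (idq hI)).
Proof.
move: (hI); suff H : forall hI : hideal I, rational (hf (idq hI)) by [].
move: I hI; apply: hideal_ind => I hI IH {}hI.
have [I1|I1] := pselect (I 1).
  by exists 0%N, 0; apply: eq_rat (rat0 0) => i; rewrite hf_id_full.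
have [vI|/existsNP[l nl]] := pselect (forall l : 'I_n, I 'X_l).
  by exists 0%N, 1; exact: hf_maximal.
have hX := dhomog_var l.
have hC := hideal_col hI hX; have hA := hideal_add hI hX.
have [dA [eA rA]] : rational (hf (idq hA)).
  apply: IH => //; first by move=> p; exact: addid_sub.
  by move=> h; apply: nl; apply: h; exact: addid_mem.
have E i := hf_id_split hI hC hA i hX.
have [CI|nCI] := pselect (subid (colid I 'X_l) I); last first.
  have [|dC [eC rC]] := IH _ hC _ nCI hC; first by move=> p; exact: colid_sub.
  exists (maxn dA dC).+1, (0 + 0).
  apply: (@eq_rat _ (fun i => hf (idq hC) (i - 1) + hf (idq hA) i)) => [i|].
    by rewrite -E.
  apply: ratD.
    by apply: rat_shift; apply: rat_raiseS rC; rewrite ltnS leq_maxr.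
  by apply: rat_raiseS rA; rewrite ltnS leq_maxl.
exists dA.+1, eA; split; first exact/noeth_bounded/noeth_id.
apply: eq_rat rA => i; rewrite /delta E addrAC.
by rewrite (eq_hf_idq hC hI) ?subrr ?add0r // => p; split; [exact: CI|exact: colid_sub].
Qed.

Lemma rational_fg X : fg X -> rational (hf X).
Proof.
move: X; apply: fg_ind => [X ZB|X U gU BU UZ|X s g Zg cyc].
- exists 0%N, 0; apply: eq_rat (rat0 0) => i; apply/esym/hf0P; last exact: ZB.
  exact/noeth_fin_dim/noeth_zero.
- move=> /fg_fin_dim fd [d [e r]] [d' [e' r']]; exists (maxn d d').+1, (0 + 0).
  apply: (@eq_rat _ (fun i => hf (subq gU BU) i + hf (quoq gU UZ) i)) => [i|].
    by rewrite -hf_subquo.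
  by apply: ratD; [apply: rat_raiseS r|apply: rat_raiseS r']; rewrite ltnS ?leq_maxl ?leq_maxr.
- have [d [e r]] := rational_id (hideal_annid s g (X := X)).
  exists d, e; apply: eq_rat (rat_shift (- s) r) => i.
  by rewrite (hf_cyc Zg cyc) subrK.
Qed.

End HilbertSerre.

(** * Krull dimension as the pole order of the Hilbert series *)

Section KrullDimension.
Variables (K : fieldType) (n : nat).
Local Notation S := {mpoly K[n]}.
Local Notation pih := (pihomog mdeg).
Local Notation gsq := (gsq K n).
Local Notation gmod := (gmod K n).
Implicit Types X Y W : gsq.

Definition prime_ideal (P : S -> Prop) := [/\ ~ P 1, P 0,
  forall a b, P a -> P b -> P (a - b), forall p a, P a -> P (p * a)
  & forall a b, P (a * b) -> P a \/ P b].

Lemma pih_msize k (a : S) : (msize a <= k)%N -> pih k a = 0.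
Proof.
move=> ak; rewrite pihomogE big1_seq // => m /andP[/eqP mk mp].
by have := msize_mdeg_lt mp; rewrite mk ltnNge ak.
Qed.

(** If a b lies in P, so does the product of the top components of a and b. One of these then lies
    in P and can be removed; the induction is on the sum of the degree bounds. *)
Lemma prime_ideal_homog P : hideal P -> ~ P 1 ->
  (forall d e a b, a \is d.-homog -> b \is e.-homog -> P (a * b) -> P a \/ P b) ->
  prime_ideal P.
Proof.
move=> hP P1 Ph; split=> //; [exact: hid0|exact: hidB|exact: hidM|].
pose deg_lt (a : S) d := forall k, (d <= k)%N -> pih k a = 0.
have z (a : S) : deg_lt a 0%N -> P a.
  by move=> h; apply: hid_comp => // k; rewrite h //; exact: hid0.
have tr (a : S) d : deg_lt a d.+1 -> deg_lt (a - pih d a) d.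
  move=> h k; rewrite leq_eqVlt raddfB /= => /orP[/eqP <-|dk].
    by rewrite pihomog_id subrr.
  by rewrite h // (pihomog_ne0 _ (pihomogP _ d a)) ?subr0 // neq_ltn dk.
have top (a b : S) d e : deg_lt a d.+1 -> deg_lt b e.+1 ->
    pih (d + e) (a * b) = pih d a * pih e b.
  move=> ha hb; rewrite [a in LHS](pihomog_partitionE (mf := mdeg) (leqnn (msize a))).
  rewrite mulr_suml raddf_sum /=.
  have E k : pih (d + e) (pih k a * b) = if k == d then pih d a * pih e b else 0.
    rewrite mulrC (pihomog_mull _ _ (pihomogP _ k a)).
    case: eqP => [->|/eqP kd]; first by rewrite leq_addr addKn mulrC.
    have [lt|le] := ltnP k d; last by rewrite [pih k a]ha ?mulr0 ?if_same // ltn_neqAle eq_sym kd.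
    by rewrite hb ?mul0r ?if_same //; lia.
  under eq_bigr => k _ do rewrite E.
  have [dm|md] := ltnP d (msize a).
    rewrite (bigD1 (Ordinal dm)) //= eqxx big1 ?addr0 // => k.
    by rewrite -val_eqE => /negPf /= ->.
  rewrite pih_msize // mul0r big1 // => k _; by rewrite if_same.
have H s : forall a b d e, deg_lt a d -> deg_lt b e -> (d + e <= s)%N ->
    P (a * b) -> P a \/ P b.
  elim: s => [|s IH] a b [|d] [|e] ha hb //; try by [left; exact: z|right; exact: z].
  move=> des Pab.
  have : P (pih d a * pih e b) by rewrite -top //; exact: hidH.
  move=> /(Ph _ _ _ _ (pihomogP _ _ _) (pihomogP _ _ _))[Pa|Pb].
    case: (IH (a - pih d a) b d e.+1) => //; first exact: tr.
    - by rewrite mulrBl; apply: hidB => //; exact: hidMr.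
    - by move=> h; left; exact: hidBr Pa h.
    - by right.
  case: (IH a (b - pih e b) d.+1 e) => //; first exact: tr.
  - by move: des; rewrite addnS.
  - by rewrite mulrBr; apply: hidB => //; exact: hidM.
  - by left.
  - by move=> h; right; exact: hidBr Pb h.
move=> a b; apply: (H _ a b (msize a) (msize b)) => // k; exact: pih_msize.
Qed.

Definition chain l (P : nat -> S -> Prop) :=
  (forall i, prime_ideal (P i)) /\
  forall i, (i < l)%N -> subid (P i) (P i.+1) /\ ~ subid (P i.+1) (P i).

Lemma rat_split d (f g h : int -> int) e : h =1 (fun i => f i + g i) ->
  (forall i, 0 <= f i) -> (forall i, 0 <= g i) -> rational f -> rational g ->
  rat d h e -> exists e1 e2, [/\ rat d f e1, rat d g e2 & e = e1 + e2].
Proof.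
move=> hE f0 g0 [r [a rf]] [s [b rg]] rh.
have [|a' rf'] := rat_le f0 _ rh rf; first by move=> i; rewrite hE lerDl.
have [|b' rg'] := rat_le g0 _ rh rg; first by move=> i; rewrite hE lerDr.
exists a', b'; split=> //.
exact: rat_uniq rh (eq_rat (fun i => esym (hE i)) (ratD rf' rg')).
Qed.

Lemma rat_pos_split d (f g h : int -> int) e : h =1 (fun i => f i + g i) ->
  (forall i, 0 <= f i) -> (forall i, 0 <= g i) -> rational f -> rational g ->
  rat d h e -> 0 < e ->
  (exists2 e', rat d f e' & 0 < e') \/ (exists2 e', rat d g e' & 0 < e').
Proof.
move=> hE f0 g0 rf rg rh e0; have [a [b [ra rb eE]]] := rat_split hE f0 g0 rf rg rh.
have [ap|an] := ltP 0 a; first by left; exists a.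
by right; exists b => //; lia.
Qed.

Lemma rat_zero_uniq d (h : int -> int) e : h =1 (fun=> 0) -> rat d h e -> e = 0.
Proof. by move=> h0 rh; apply: rat_uniq rh _; apply: eq_rat (rat0 d) => i; rewrite h0. Qed.

(** Noetherian induction. If a b is in I without a or b being in I, then S / (I : a) or S / (I + a)
    inherits a positive value in order d. If I is prime and d > 0, some variable x is outside I,
    since the residue field has order 0. As x is regular, S / (I + x) has order d - 1, and I is put
    in front of the chain found there. *)
Lemma chain_exists (I : S -> Prop) (hI : hideal I) d e : rat d (hf (idq hI)) e -> 0 < e ->
  exists2 P, chain d P & subid I (P 0%N).
Proof.
move: hI d e.
suff H : forall (hI : hideal I) d e, rat d (hf (idq hI)) e -> 0 < e ->
  exists2 P, chain d P & subid I (P 0%N) by [].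
move=> hI0; move: I hI0 (hI0); apply: hideal_ind => I _ IH hI d e rI e0.
have nI1 : ~ I 1.
  by move=> I1; have := rat_zero_uniq (hf_id_full hI I1) rI => e1; rewrite e1 in e0.
have [Ph|nPh] := pselect (forall d e a b, a \is d.-homog -> b \is e.-homog ->
    I (a * b) -> I a \/ I b); last first.
  have [da [db [a [b [ha hb Iab [na nb]]]]]] : exists da db a b,
      [/\ a \is da.-homog, b \is db.-homog, I (a * b) & ~ I a /\ ~ I b].
    apply: contrapT => nex; apply: nPh => da db a b ha hb Iab; apply: contrapT => nab.
    apply: nex; exists da, db, a, b; split=> //.
    by split=> h; apply: nab; [left|right].
  have hC := hideal_col hI ha; have hA := hideal_add hI ha.
  have E i : hf (idq hI) i = hf (idq hC) (i - da%:Z) + hf (idq hA) i by exact: hf_id_split.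
  have [rC eC] := rational_id hC; have rA := rational_id hA.
  case: (rat_pos_split E (fun=> hf_ge0 _ _) (fun=> hf_ge0 _ _) _ rA rI e0).
  - by case: eC => e1 h; exists rC, e1; exact: rat_shift.
  - move=> [e' rC' ep]; have [|||P cP sP] := IH _ hC _ _ hC d e' _ ep.
    + by move=> p; exact: colid_sub.
    + by move=> h; apply: nb; apply: h; rewrite /colid mulrC.
    + by apply: eq_rat (rat_shift da%:Z rC') => i; rewrite addrK.
    by exists P => // p Ip; apply: sP; exact: colid_sub.
  - move=> [e' rA' ep]; have [||P cP sP] := IH _ hA _ _ hA d e' rA' ep.
    + by move=> p; exact: addid_sub.
    + by move=> h; apply: na; apply: h; exact: addid_mem.
    by exists P => // p Ip; apply: sP; exact: addid_sub.
have pI := prime_ideal_homog hI nI1 Ph.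
case: d rI => [|d] rI; first by exists (fun=> I) => //; split.
have [vI|/existsNP[l nl]] := pselect (forall l : 'I_n, I 'X_l).
  have := rat_uniq rI (rat_raiseS (ltn0Sn d) (hf_maximal hI vI nI1)).
  by move=> e1; rewrite e1 in e0.
have hX := dhomog_var K l.
have hC := hideal_col hI hX; have hA := hideal_add hI hX.
have [bI rdI] := rI.
have rA : rat d (hf (idq hA)) e.
  apply: eq_rat rdI => i; rewrite /delta (hf_id_split hI hC hA i hX) addrAC.
  rewrite (eq_hf_idq hC hI) ?subrr ?add0r // => p; split; last exact: colid_sub.
  by have [_ _ _ _ h] := pI; case/h.
have [||P [pP sP] AP] := IH _ hA _ _ hA d e rA e0.
- by move=> p; exact: addid_sub.
- by move=> h; apply: nl; apply: h; exact: addid_mem.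
exists (fun k => if k is k'.+1 then P k' else I) => //; split; first by case.
case=> [_|i]; last by rewrite ltnS; exact: sP.
split=> [p Ip|h]; first by apply: AP; exact: addid_sub.
by apply: nl; apply: h; apply: AP; exact: addid_mem.
Qed.

Definition gann X (p : S) := forall i x, numer X i x ->
  forall k : nat, denom X (i + k%:Z) (pih k p *: x).

(** Along a filtration with cyclic quotients the values in order d are nonnegative and add up to e,
    so one of them is positive. *)
Lemma fg_cyclic_factor X : fg X -> forall d e, rat d (hf X) e -> 0 < e ->
  exists2 I : S -> Prop, subid (gann X) I & exists hI : hideal I,
    exists2 e', rat d (hf (idq hI)) e' & 0 < e'.
Proof.
move: X; apply: fg_ind => [X ZB|X U gU BU UZ fX IH1 IH2|X s g Zg cyc] d e rX e0.
- have h0 : hf X =1 fun=> 0.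
    by move=> i; apply/hf0P; [exact/noeth_fin_dim/noeth_zero|exact: ZB].
  by have := rat_zero_uniq h0 rX => e1; rewrite e1 in e0.
- have nX := fg_noeth fX.
  have E i : hf X i = hf (subq gU BU) i + hf (quoq gU UZ) i.
    exact/hf_subquo/noeth_fin_dim.
  have r1 : rational (hf (subq gU BU)) by apply/rational_fg/noeth_fg/noeth_sub.
  have r2 : rational (hf (quoq gU UZ)) by apply/rational_fg/noeth_fg/noeth_quo.
  case: (rat_pos_split E (fun=> hf_ge0 _ _) (fun=> hf_ge0 _ _) r1 r2 rX e0) => -[e' r' ep].
  + have [I sI hI] := IH1 _ _ r' ep; exists I => // p hp; apply: sI => i x /= Ux k.
    by apply: hp; exact: (UZ _ _ Ux).
  + have [I sI hI] := IH2 _ _ r' ep; exists I => // p hp; apply: sI => i x /= Ux k.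
    by apply: (BU); exact: hp.
- exists (annid s g); first by move=> p hp k; exact: hp.
  exists (hideal_annid s g); exists e => //.
  by apply: eq_rat (rat_shift s rX) => i; rewrite (hf_cyc Zg cyc).
Qed.

(** A lower bound r for the dimension of the polynomials of degree at most t modulo Q ([msize]
    exceeds the degree by one). The filtration by degree is used because the primes of a chain need
    not be homogeneous. *)
Definition indep (Q : S -> Prop) t r := exists u : 'I_r -> S^o,
  (forall k, (msize (u k : S) <= t.+1)%N) /\ @free_mod K n S^o Q r u.

Lemma indep_le Q t t' r : (t <= t')%N -> indep Q t r -> indep Q t' r.
Proof. by move=> tt [u [hu fu]]; exists u; split=> // k; apply: leq_trans (hu k) _. Qed.

Lemma indep1 P t : prime_ideal P -> indep P t 1.
Proof.
move=> [P1 _ _ PM _]; exists (fun=> 1); split=> [_|c]; first by rewrite msize1.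
rewrite big_ord1 [_ *: _]mulr1 => Pc k; rewrite [k]ord1.
apply: contra_not_eq P1 => c0; have := PM ((c 0)^-1)%:MP _ Pc.
by rewrite -mpolyCM mulVf.
Qed.

(* The new family consists of the products by [f] of the family independent   *)
(* modulo [P] and of the family independent modulo [Q].                       *)
Lemma indep_step (P Q : S -> Prop) (f : S) t t' E r r' : prime_ideal P -> prime_ideal Q ->
  subid P Q -> Q f -> ~ P f -> (msize f <= E.+1)%N -> (t' + E <= t)%N ->
  indep P t' r' -> indep Q t r -> indep P t (r' + r).
Proof.
move=> pP pQ PQ Qf nPf fE tE [u [hu fu]] [v [hv fv]].
have [_ Q0 QB QM _] := pQ.
exists (fun k => match split k with inl k => (u k : S) * f | inr k => v k end); split.
  move=> k; case: split => l //.
  have [->|fn] := eqVneq f 0; first by rewrite mulr0 msize0.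
  have [->|un] := eqVneq (u l : S) 0; first by rewrite mul0r msize0.
  rewrite msizeM // -subn1; apply: leq_trans (_ : ((t'.+1 + E.+1) - 1 <= _)%N); last by lia.
  by apply: leq_sub2r; apply: leq_add.
move=> c; rewrite sum_split_ord.
under eq_bigr => k _ do rewrite split_lshift.
under [X in _ + X]eq_bigr => k _ do rewrite split_rshift.
set A := \sum_(k < r') _; set B := \sum_(k < r) _ => PAB.
have AE : A = (\sum_(k < r') (c (lshift r k))%:MP * (u k : S)) * f.
  by rewrite mulr_suml; apply: eq_bigr => k _; rewrite [_ *: _]mulrA.
have QA : Q A by rewrite AE; exact: QM.
have c1 : forall k, c (rshift r' k) = 0.
  apply: (fv (fun k => c (rshift r' k))).
  by have := QB _ _ (PQ _ PAB) QA; rewrite addrC addKr.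
have c0 : forall k, c (lshift r k) = 0.
  apply: (fu (fun k => c (lshift r k))).
  have [_ _ _ _ /(_ (\sum_(k < r') (c (lshift r k))%:MP * (u k : S)) f)] := pP.
  case=> //; rewrite -AE; move: PAB; rewrite /B [X in A + X]big1 ?addr0 // => k _.
  by rewrite c1 mpolyC0 scale0r.
move=> k; case: (splitP k) => [j kj|j kj].
  by rewrite -(c0 j); congr c; apply: val_inj.
by rewrite -(c1 j); congr c; apply: val_inj.
Qed.

(** Pascal's rule: [indep_step] joins the family modulo [P 0] for s to the family modulo [P 1] for s
    + 1. So the count grows at least like s^l. *)
Lemma chain_indep l P : chain l P -> exists E, forall s, indep (P 0%N) (E * s) 'C(s + l, l).
Proof.
elim: l P => [|l IH] P [pP sP].
  by exists 0%N => s; rewrite bin0; exact: indep1.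
have [E1 h1] : exists E, forall s, indep (P 1%N) (E * s) 'C(s + l, l).
  by apply: (IH (fun k => P k.+1)); split=> // i il; exact: sP.
have [PQ nQP] := sP 0%N isT.
have [f Qf nPf] : exists2 f, P 1%N f & ~ P 0%N f.
  by apply: contrapT => nex; apply: nQP => f Qf; apply: contrapT => nPf; apply: nex; exists f.
exists (maxn E1 (msize f)); elim=> [|s IHs].
  by rewrite add0n binn; exact: indep1.
rewrite addSn binS; apply: (indep_step (E := msize f) (pP 0%N) (pP 1%N) PQ Qf nPf _ _ IHs).
- exact: leqnSn.
- by rewrite mulnS addnC leq_add2r leq_maxr.
- rewrite addnS -addSn; apply: indep_le (h1 s.+1).
  by rewrite leq_mul2r leq_maxl orbT.
Qed.

End KrullDimension.

Section KrullDimensionOfModules.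
Variables (K : fieldType) (n : nat).
Local Notation S := {mpoly K[n]}.
Local Notation pih := (pihomog mdeg).
Local Notation gsq := (gsq K n).
Local Notation gmod := (gmod K n).

Lemma gmod_gsubmod (N : gmod) : gsubmod (fun i (x : N) => gdeg i x).
Proof. by split=> [i|i x y|i k p x]; [exact: gdeg0|exact: gdegB|exact: gdegZ]. Qed.

Lemma zero_gsubmod (A : lmodType S) : gsubmod (fun (_ : int) (x : A) => x = 0).
Proof. by split=> // [i x y -> ->|i k p x _ ->]; rewrite ?subr0 ?scaler0. Qed.

Fact zero_gdeg (N : gmod) i (x : N) : x = 0 -> gdeg i x.
Proof. by move=> ->; exact: gdeg0. Qed.

Definition gq (N : gmod) : gsq := Gsq (gmod_gsubmod N) (zero_gsubmod N) (@zero_gdeg N).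

Lemma ann_gann (N : gmod) (a : S) : (forall x : N, a *: x = 0) -> gann (gq N) a.
Proof.
move=> ha i x /= hx k; have [ak|ka] := leqP (msize a) k.
  by rewrite pih_msize // scale0r.
have := @gindep K n N [seq i + Posz j | j <- iota 0 (msize a)]
  (fun j => pihz (j - i) a *: x) _ _ _ (i + k%:Z).
rewrite [_ - i]addrC addKr /=; apply.
- by rewrite map_inj_uniq ?iota_uniq // => j j' /addrI[].
- by move=> j; have := gsubmodZ (gmod_gsubmod N) (pihz_deg (j - i) a) hx; rewrite addrC subrK.
- rewrite big_map -[RHS](ha x).
  rewrite [a in RHS](pihomog_partitionE (mf := mdeg) (leqnn (msize a))) scaler_suml.
  rewrite -(big_mkord xpredT (fun j => pih j a *: x)) /index_iota subn0.
  by apply: eq_bigr => j _; rewrite [_ - i]addrC addKr.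
- by apply: map_f; rewrite mem_iota.
Qed.

Lemma ann_gens (N : gmod) m (e : 'I_m -> int) (g : 'I_m -> N) :
  (forall i x, gdeg i x -> span_deg (denom (gq N)) e g i x) ->
  forall a : S, (forall k, a *: g k = 0) -> forall x : N, a *: x = 0.
Proof.
move=> sg a ag x; have [q [d [y [hy ->]]]] := gdec x.
rewrite scaler_sumr big1 // => k _; have [c [_ /subr0_eq ->]] := sg _ _ (hy k).
by rewrite scaler_sumr big1 // => l _; rewrite scalerA mulrC -scalerA ag scaler0.
Qed.

(** Sending p to all p g_k embeds S / Ann N into a power of N. If r exceeded the total dimension
    available to the components, the [u l] would satisfy a linear relation modulo Ann N, hence
    modulo P. *)
Lemma indep_bound (N : gmod) m (e : 'I_m -> int) (g : 'I_m -> N) P t r :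
  fin_dim (gq N) -> (forall k, gdeg (e k) (g k)) ->
  (forall i x, gdeg i x -> span_deg (denom (gq N)) e g i x) ->
  (forall a : S, (forall x : N, a *: x = 0) -> P a) -> indep P t r ->
  (r <= \sum_(k < m) \sum_(j < t.+1) absz (hf (gq N) (e k + j%:Z)%R))%N.
Proof.
move=> fd hg sg aP [u [hu fu]]; rewrite leqNgt; apply/negP => lt.
pose h (p : 'I_m * 'I_t.+1) := absz (hf (gq N) (e p.1 + p.2%:Z)).
pose B p := cid (hf_hasdim (e p.1 + p.2%:Z) fd) : {b : 'I_(h p) -> N | _}.
have Zx l (p : 'I_m * 'I_t.+1) : gdeg (e p.1 + p.2%:Z) (pih p.2 (u l) *: g p.1).
  by apply: gdegZ => //; exact: pihomogP.
have sp p l : exists c : 'I_(h p) -> K,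
    pih p.2 (u l) *: g p.1 = \sum_(q < h p) (c q)%:MP *: sval (B p) q.
  have [_ sB _] := svalP (B p); have [c /subr0_eq hc] := sB _ (Zx l p).
  by exists c.
pose C p l := sval (cid (sp p l)).
pose T := {p : 'I_m * 'I_t.+1 & 'I_(h p)}.
have cT : (#|{: T}| < r)%N.
  rewrite card_tagged sumnE big_map big_enum /=.
  under eq_bigr do rewrite card_ord.
  by rewrite -(pair_bigA _ (fun k j => h (k, j))).
pose M : 'M[K]_(r, #|{: T}|) := \matrix_(l, q) C (tag (enum_val q)) l (tagged (enum_val q)).
have : kermx M != 0.
  rewrite -mxrank_eq0 mxrank_ker subn_eq0 -ltnNge.
  by apply: leq_ltn_trans (rank_leq_col M) cT.
move=> /rowV0Pn[v /sub_kermxP vM v0]; case/negP: v0; apply/eqP/rowP => l; rewrite mxE.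
apply: (fu (fun k => v 0 k)) l; apply: aP; apply: (ann_gens sg) => k.
have E l : (u l : S) = \sum_(j < t.+1) pih j (u l) by apply: pihomog_partitionE.
under eq_bigr => l _ do rewrite [u l]E scaler_sumr.
rewrite exchange_big /= scaler_suml big1 // => j _.
under eq_bigr do rewrite -[_ *: _]/(_ * _).
rewrite scaler_suml.
have D l := svalP (cid (sp (k, j) l)).
under eq_bigr => l _ do rewrite -scalerA (D l) /= scaler_sumr.
rewrite exchange_big big1 //= => q _.
under eq_bigr => l _ do rewrite scalerA -mpolyCM.
rewrite -scaler_suml -raddf_sum /=.
have /rowP/(_ (enum_rank (Tagged (fun p => 'I_(h p)) q : T))) := vM; rewrite !mxE => vq.
rewrite (eq_bigr (fun l => v 0 l * M l (enum_rank (Tagged (fun p => 'I_(h p)) q : T)))).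
  by rewrite vq raddf0 scale0r.
by move=> l _; rewrite mxE enum_rankK.
Qed.

End KrullDimensionOfModules.

Section KrullDimensionValue.
Variables (K : fieldType) (n : nat).
Local Notation S := {mpoly K[n]}.
Local Notation gmod := (gmod K n).

Section PrimeOf.
Variables (P : S -> Prop) (hP : prime_ideal P).

Definition prime_of : {pred S} := fun a => `[< P a >].

Fact prime_of_closed : idealr_closed prime_of.
Proof.
have [P1 P0 PB PM _] := hP; split=> [||a x y /asboolP Px /asboolP Py].
- exact/asboolP.
- by apply/negP => /asboolP.
- by apply/asboolP; rewrite -[y]opprK -[- y]sub0r; apply: (PB); [exact: PM|exact: (PB)].
Qed.

Fact prime_of_prime : prime_idealr_closed prime_of.
Proof.
have [_ _ _ _ h] := hP; move=> a b /asboolP/h[Pa|Pb]; apply/orP.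
  by left; apply/asboolP.
by right; apply/asboolP.
Qed.

HB.instance Definition _ := isIdealr.Build S prime_of prime_of_closed.
HB.instance Definition _ := isPrimeIdealrClosed.Build S prime_of prime_of_prime.

Definition prime_of_idealr : prime_idealr S := prime_of.

Lemma prime_ofP a : a \in prime_of_idealr <-> P a.
Proof. by split=> [/asboolP|h] //; apply/asboolP. Qed.

End PrimeOf.

Lemma prime_idealr_prime (P : prime_idealr S) : prime_ideal (fun a => a \in P).
Proof.
split=> [||a b|p a|a b].
- by rewrite idealr1.
- exact: rpred0.
- exact: rpredB.
- exact: idealMr.
- by rewrite prime_idealrM => /orP.
Qed.

Lemma prime_chainP (N : lmodType S) l : (exists P, @prime_chain K n N l P) <->
  exists2 P, chain l P & forall a : S, (forall x : N, a *: x = 0) -> P 0%N a.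
Proof.
split=> [[P [aP sP]]|[P [pP sP] aP]].
  by exists (fun i a => a \in P i) => //; split=> // i; exact: prime_idealr_prime.
exists (fun i => prime_of_idealr (pP i)); split=> [a /aP /(prime_ofP (pP 0%N)) //|i il].
have [h1 h2] := sP i il; split=> [a /(prime_ofP (pP i)) h|h].
  by apply/(prime_ofP (pP i.+1)); exact: h1.
by apply: h2 => a /(prime_ofP (pP i.+1)) /h /(prime_ofP (pP i)).
Qed.

Lemma ffact_ge_exp s m : (s ^ m <= (s + m) ^_ m)%N.
Proof.
elim: m => [|m IH]; first by rewrite ffactn0.
by rewrite addnS ffactSS expnS leq_mul // -addnS leq_addr.
Qed.

(** A chain of length d + 1 yields 'C(s + d + 1, d + 1) independent polynomials of degree at most E
    s, while [indep_bound] and [rat_growth] permit only a multiple of s^d. *)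
Lemma chain_le (N : gmod) d e : fg (gq N) -> rat d (hf (gq N)) e ->
  forall l P, chain l P -> (forall a : S, (forall x : N, a *: x = 0) -> P 0%N a) -> (l <= d)%N.
Proof.
move=> fN rN l P [pP sP] aP; rewrite leqNgt; apply/negP => dl.
have fd := fg_fin_dim fN; have [m [eg [g [hg sg]]]] := fN.
have [|E hE] := @chain_indep _ _ d.+1 P.
  by split=> // i id; apply: sP; exact: leq_trans id dl.
have [H dH rH] := rat_cumul rN.
have [m0 [C Hm HC]] := rat_growth rH.
have H0 i : 0 <= H i.
  apply: (@delta_le (fun=> 0)); first by exists 0.
    exact: rat_bounded_left rH.
  by move=> {}i; rewrite dH /delta subrr hf_ge0.
have sumH a t : (\sum_(j < t.+1) absz (hf (gq N) (a + j%:Z)%R))%N%:Z <= H (a + t%:Z).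
  elim: t => [|t IH].
    by rewrite big_ord1 addr0 gez0_abs ?hf_ge0 // -dH /delta lerBlDr lerDl.
  rewrite big_ord_recr [nat_of_ord ord_max]/= PoszD gez0_abs ?hf_ge0 // -dH /delta.
  have -> : a + t.+1%:Z - 1 = a + t%:Z by lia.
  move: IH; set b := (\sum_(j < t.+1) _)%N; lia.
pose c := (\sum_(k < m) absz (eg k - m0)%R)%N.
have sumC k t : (\sum_(j < t.+1) absz (hf (gq N) (eg k + j%:Z)%R) <= C * (t + c).+1 ^ d)%N.
  rewrite -lez_nat; apply: le_trans (sumH _ _) _.
  have [lt|le] := ltP (eg k + t%:Z) m0; first by rewrite Hm.
  have [+ _] := HC (absz (eg k + t%:Z - m0)%R).
  have -> : m0 + (absz (eg k + t%:Z - m0)%R)%:Z = eg k + t%:Z by lia.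
  move=> h; apply: le_trans h _; rewrite lez_nat leq_mul2l; apply/orP; right.
  have : (absz (eg k + t%:Z - m0)%R <= t + c)%N.
    by rewrite /c (bigD1 k) //=; lia.
  by case: (d) => // d' h; rewrite leq_exp2r.
(* With s = A + 1, the two estimates multiplied by (d + 1)! combine to (A + 1)^(d + 1) <= A (A +
   1)^d. *)
have [A AE] : exists A, A = (m * (C * (E + c).+1 ^ d) * d.+1`!)%N by eexists.
have := indep_bound fd hg sg aP (hE A.+1).
move/leq_trans/(_ (leq_sum _ (fun k _ => sumC k _))).
rewrite sum_nat_const card_ord => h.
have h2 : (A.+1 ^ d.+1 <= A * A.+1 ^ d)%N.
  apply: leq_trans (ffact_ge_exp _ _) _; rewrite -bin_ffact.
  rewrite {2}AE [X in (_ <= X)%N]mulnAC leq_mul2r; apply/orP; right.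
  apply: leq_trans h _; rewrite -!mulnA !leq_mul2l; apply/orP; right; apply/orP; right.
  rewrite -expnMn; case: (d) => // d'; rewrite leq_exp2r //; nia.
by move: h2; rewrite expnS leq_mul2r expn_eq0 /= ltnn.
Qed.

Lemma kdim_rat (N : gmod) d e : fg (gq N) -> rat d (hf (gq N)) e -> 0 < e ->
  kdim N = d%:Z%:E.
Proof.
move=> fN rN e0.
have [P cP aP] : exists2 P, chain d P & forall a : S, (forall x : N, a *: x = 0) -> P 0%N a.
  have [I sI [hI [e' rI ep]]] := fg_cyclic_factor fN rN e0.
  have [P cP IP] := chain_exists rI ep; exists P => // a ha.
  by apply/IP/sI/ann_gann.
have ub : forall x : \bar int, [set l%:Z%:E | l in [set l : nat | exists P, @prime_chain K n N l P]]%classic x ->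
    (x <= d%:Z%:E)%O.
  move=> _ [l /prime_chainP[Q cQ aQ] <-].
  by rewrite lee_fin lez_nat; exact: (chain_le fN rN cQ aQ).
have mem : [set l%:Z%:E | l in [set l : nat | exists P, @prime_chain K n N l P]]%classic d%:Z%:E.
  by exists d => //; apply/prime_chainP; exists P.
rewrite /kdim /supremum ifF; last by apply/eqP => h; rewrite h in mem.
have sup : supremums [set l%:Z%:E | l in [set l : nat | exists P, @prime_chain K n N l P]]%classic d%:Z%:E.
  by split=> // y; apply.
exact: is_subset1_supremums (xgetPex _ (ex_intro _ _ sup)) sup.
Qed.

Lemma kdim_zero (N : gmod) : fg (gq N) -> hf (gq N) =1 (fun=> 0) -> kdim N = -oo%E.
Proof.
move=> fN h0.
have ann1 (x : N) : 1%:MP *: x = 0.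
  have [q [d [y [hy ->]]]] := gdec x; rewrite scaler_sumr big1 // => k _.
  have /(hf0P _ (fg_fin_dim fN)) h := h0 (d k).
  by rewrite (h _ (hy k)) scaler0.
rewrite /kdim; suff -> : [set l%:Z%:E | l in [set l : nat | exists P, @prime_chain K n N l P]]%classic = set0.
  by rewrite supremum0.
apply/seteqP; split=> // y [l /prime_chainP[Q [pQ _] aQ] _].
by have [+ _ _ _ _] := pQ 0%N; apply; have := aQ _ ann1; rewrite mpolyC1.
Qed.

Lemma kdim_cases (N : gmod) : fg (gq N) ->
  (kdim N = -oo%E /\ hf (gq N) =1 fun=> 0) \/
  exists d e, [/\ kdim N = d%:Z%:E, rat d (hf (gq N)) e & 0 < e].
Proof.
move=> fN; have [r [e0 r0]] := rational_fg fN.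
have [[d [e [rd ep]]]|h0] := rat_minimal (fun=> hf_ge0 _ _) r0; last first.
  by left; split=> //; exact: kdim_zero.
by right; exists d, e; split=> //; exact: kdim_rat rd ep.
Qed.

End KrullDimensionValue.

Section GradedSubmodule.
Variables (K : fieldType) (n : nat).
Local Notation S := {mpoly K[n]}.
Local Notation gmod := (gmod K n).
Variables (M : gmod) (P : M -> Prop).
Hypotheses (P0 : P 0) (PB : forall a x y, P x -> P y -> P (a *: x + y))
  (Pdec : forall x, P x -> exists (m : nat) (e : 'I_m -> int) (y : 'I_m -> M),
    (forall k, gdeg (e k) (y k) /\ P (y k)) /\ x = \sum_(k < m) y k).

Definition sgpred : {pred M} := fun x => `[< P x >].

Fact sgpred_closed : GRing.submod_closed sgpred.
Proof.
split=> [|a x y /asboolP Px /asboolP Py]; first exact/asboolP.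
by apply/asboolP; exact: PB.
Qed.

HB.instance Definition _ := GRing.isSubmodClosed.Build S M sgpred sgpred_closed.

Record subgm := SubGM { subgm_val : M; _ : subgm_val \in sgpred }.

HB.instance Definition _ := [isSub for subgm_val].
HB.instance Definition _ := [Choice of subgm by <:].
HB.instance Definition _ := [SubChoice_isSubLmodule of subgm by <:].

Definition subgm_deg i (u : subgm) := gdeg i (val u).

Fact subgm_dec (u : subgm) : exists (m : nat) (e : 'I_m -> int) (y : 'I_m -> subgm),
  (forall k, subgm_deg (e k) (y k)) /\ u = \sum_(k < m) y k.
Proof.
case: u => x Px; have [m [e [y [hy xE]]]] := Pdec (asboolW Px).
have hP k : y k \in sgpred by apply/asboolP; case: (hy k).
exists m, e, (fun k => SubGM (hP k)); split=> [k|]; first by case: (hy k).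
by apply: val_inj; rewrite raddf_sum.
Qed.

Fact subgm_indep (s : seq int) (y : int -> subgm) : uniq s ->
  (forall i, subgm_deg i (y i)) -> \sum_(i <- s) y i = 0 ->
  forall i, i \in s -> y i = 0.
Proof.
move=> us hy s0 i si; apply: val_inj.
by apply: (@gindep K n M s (fun i => val (y i)) us hy) si; rewrite -raddf_sum s0.
Qed.

(** [gr_injective] quantifies over objects of type [gmod], so the domain of a partial map has to be
    packaged as one. *)
Definition sub_gmod : gmod :=
  @Gmod K n subgm subgm_deg (fun i => gdeg0 M i) (fun i x y => @gdegB K n M i (val x) (val y))
    (fun i k p x => @gdegZ K n M i k p (val x)) subgm_dec subgm_indep.

End GradedSubmodule.

(** * Cohomology of subcomplexes *)

Section InjectiveExtension.
Variables (K : fieldType) (n : nat).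
Local Notation S := {mpoly K[n]}.
Local Notation gmod := (gmod K n).

Lemma sum_by_degree (V : zmodType) (J : finType) (e : J -> int) (F : J -> V) s :
  uniq s -> (forall k, e k \in s) ->
  \sum_k F k = \sum_(i <- s) \sum_(k | e k == i) F k.
Proof.
move=> us es; rewrite (exchange_big_dep xpredT) //=; apply: eq_bigr => k _.
rewrite (eq_bigl (pred1 (e k))); last by move=> i; rewrite /= eq_sym.
by rewrite -big_filter filter_pred1_uniq ?big_seq1.
Qed.

Lemma gdeg_component (M : gmod) i (x : M) (J : finType) (e : J -> int) (y : J -> M) :
  gdeg i x -> (forall k, gdeg (e k) (y k)) -> x = \sum_k y k ->
  x = \sum_(k | e k == i) y k.
Proof.
move=> hx hy xE; pose s := undup (i :: [seq e k | k <- enum J]).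
have us : uniq s by exact: undup_uniq.
have es k : e k \in s by rewrite mem_undup inE map_f ?orbT // mem_enum.
have si : i \in s by rewrite mem_undup inE eqxx.
pose w j := (\sum_(k | e k == j) y k) - (if j == i then x else 0).
have dw j : gdeg j (w j).
  apply: gdegB; first by apply: gdeg_sum => k /eqP <-.
  by case: eqP => [->//|_]; exact: gdeg0.
have s0 : \sum_(j <- s) w j = 0.
  rewrite sumrB -sum_by_degree // -xE -big_mkcond -big_filter filter_pred1_uniq //.
  by rewrite big_seq1 subrr.
by have := gindep us dw s0 si; rewrite /w eqxx => /subr0_eq.
Qed.

(* Extension of [alpha z |-> beta z] from [V + alpha Z], with kernel          *)
(* containing [V], to the whole module.                                       *)
Lemma injective_extension (E M : gmod) (T : lmodType S) (Z : int -> T -> Prop)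
    (V : int -> M -> Prop) (al : T -> M) (be : T -> E) (a b : int) :
  gr_injective E -> gsubmod Z -> gsubmod V -> (forall i x, V i x -> gdeg i x) ->
  linear al -> linear be ->
  (forall i z, Z i z -> gdeg (i + a) (al z)) -> (forall i z, Z i z -> gdeg (i + b) (be z)) ->
  (forall i z, Z i z -> V (i + a) (al z) -> be z = 0) ->
  exists g : M -> E, [/\ linear g, forall i x, gdeg i x -> gdeg (i + (b - a)) (g x),
    forall i x, V i x -> g x = 0 & forall i z, Z i z -> g (al z) = be z].
Proof.
move=> hE gZ gV Vg lal lbe dal dbe ker.
have [Z0 ZB ZZ] := gZ; have [V0 VB VZ] := gV.
(* [R i] is the degree i part of the graph of the partial map, and [RR] consists of the sums of its
   elements. The graph is single-valued by [ker] and by the independence of degrees. *)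
pose R i x y := gdeg i x /\ exists z, [/\ Z (i - a) z, V i (x - al z) & y = be z].
have R0 i : R i 0 0.
  by split; [exact: gdeg0|exists 0; rewrite (lin0 lal) (lin0 lbe) subr0].
have RB i x x' y y' : R i x y -> R i x' y' -> R i (x - x') (y - y').
  move=> [h [z [h1 h2 ->]]] [h' [z' [h1' h2' ->]]]; split; first exact: gdegB.
  exists (z - z'); split; [exact: ZB| |by rewrite (linB lbe)].
  by have := VB _ _ _ h2 h2'; congr (V _ _); rewrite (linB lal) !opprD !opprK addrACA.
have RN i x y : R i x y -> R i (- x) (- y).
  by move=> h; rewrite -sub0r -[- y]sub0r; exact: RB.
have RD i x x' y y' : R i x y -> R i x' y' -> R i (x + x') (y + y').
  by move=> h /RN h'; rewrite -[x']opprK -[y']opprK; exact: RB.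
have RZ i k p x y : p \is k.-homog -> R i x y -> R (i + k%:Z) (p *: x) (p *: y).
  move=> hp [h [z [h1 h2 ->]]]; split; first exact: gdegZ.
  exists (p *: z); split; last by rewrite (linZ lbe).
    by rewrite addrAC; exact: ZZ.
  by rewrite (linZ lal) -scalerBr; exact: VZ.
have RF i y : R i 0 y -> y = 0.
  move=> [_ [z [h1 h2 ->]]]; apply: ker h1 _; rewrite subrK.
  by have := VB _ _ _ (V0 i) h2; rewrite sub0r opprB subr0.
have Rdeg i x y : R i x y -> gdeg (i + (b - a)) y.
  by move=> [_ [z [h1 _ ->]]]; have := dbe _ _ h1; congr (gdeg _ _); lia.
have Rsum i (J : Type) (r : seq J) (Q : pred J) (F : J -> M) (G : J -> E) :
    (forall k, Q k -> R i (F k) (G k)) ->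
    R i (\sum_(k <- r | Q k) F k) (\sum_(k <- r | Q k) G k).
  by move=> h; elim/big_rec2: _ => // k x y Qk; apply: RD; exact: h.
pose RR x y := exists (m : nat) (e : 'I_m -> int) (xs : 'I_m -> M) (ys : 'I_m -> E),
  [/\ forall k, R (e k) (xs k) (ys k), x = \sum_(k < m) xs k & y = \sum_(k < m) ys k].
have RR1 i x y : R i x y -> RR x y.
  by exists 1%N, (fun=> i), (fun=> x), (fun=> y); split=> //; rewrite big_ord1.
have RR0 : RR 0 0 by exact: RR1 (R0 0).
have RRD x x' y y' : RR x y -> RR x' y' -> RR (x + x') (y + y').
  move=> [m [e [xs [ys [h -> ->]]]]] [m' [e' [xs' [ys' [h' -> ->]]]]].
  exists (m + m')%N, (fun k => match split k with inl k => e k | inr k => e' k end),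
    (fun k => match split k with inl k => xs k | inr k => xs' k end),
    (fun k => match split k with inl k => ys k | inr k => ys' k end); split.
  - by move=> k; case: split.
  - rewrite sum_split_ord; congr (_ + _); apply: eq_bigr => k _.
      by rewrite split_lshift.
    by rewrite split_rshift.
  - rewrite sum_split_ord; congr (_ + _); apply: eq_bigr => k _.
      by rewrite split_lshift.
    by rewrite split_rshift.
have RRZ p x y : RR x y -> RR (p *: x) (p *: y).
  move=> [m [e [xs [ys [h -> ->]]]]].
  rewrite (pihomog_partitionE (mf := mdeg) (leqnn (msize p))) !scaler_suml.
  elim/big_rec2: _ => // d x' y' _; apply: RRD; rewrite !scaler_sumr.
  exists m, (fun k => e k + d%:Z), (fun k => pihomog mdeg d p *: xs k),
    (fun k => pihomog mdeg d p *: ys k); split=> // k.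
  by apply: RZ => //; exact: pihomogP.
have RRF y : RR 0 y -> y = 0.
  move=> [m [e [xs [ys [h /esym x0 ->]]]]].
  pose s := undup [seq e k | k <- enum 'I_m].
  have es k : e k \in s by rewrite mem_undup; apply: map_f; rewrite mem_enum.
  have hR i : R i (\sum_(k < m | e k == i) xs k) (\sum_(k < m | e k == i) ys k).
    by apply: Rsum => k /eqP <-.
  rewrite (sum_by_degree _ (undup_uniq _) es) in x0.
  rewrite (sum_by_degree _ (undup_uniq _) es) big_seq big1 // => i si; apply: (RF i).
  have <- := @gindep K n M s (fun i => \sum_(k < m | e k == i) xs k) (undup_uniq _) _ x0 i si.
    exact: hR.
  by move=> j; case: (hR j).
have RRN x y : RR x y -> RR (- x) (- y) by rewrite -!scaleN1r; exact: RRZ.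
have RRf x y y' : RR x y -> RR x y' -> y = y'.
  by move=> h /RRN/(RRD _ _ _ _ h); rewrite subrr => /RRF/subr0_eq.
(* The partial map raises degrees by b - a; the shift makes it degree-preserving, as [gr_injective]
   demands. *)
pose M' := gshift (- (b - a)) M.
pose P (x : M') := exists y, RR x y.
have PC (p : S) x y : P x -> P y -> P (p *: x + y).
  by move=> [x' hx] [y' hy]; exists (p *: x' + y'); apply: RRD => //; exact: RRZ.
have Pdec x : P x -> exists (m : nat) (e : 'I_m -> int) (y : 'I_m -> M'),
    (forall k, gdeg (e k) (y k) /\ P (y k)) /\ x = \sum_(k < m) y k.
  move=> [y [m [e [xs [ys [h -> _]]]]]].
  exists m, (fun k => e k + (b - a)), xs; split=> // k; split.
    by rewrite /= /shift_deg addrK; case: (h k).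
  by exists (ys k); exact: RR1 (h k).
pose A := sub_gmod (ex_intro _ _ RR0 : P 0) PC Pdec.
have /choice[f hf] (u : A) : exists y, RR (val u) y by case: u => x Px; exact: (asboolW Px).
have gf : is_gmorphism f.
  split=> [p u v|i u hu].
    by apply: RRf (hf _) _; apply: RRD => //; exact: RRZ.
  have [m [e [xs [ys [h xE yE]]]]] := hf u.
  pose x' := \sum_(k < m | e k == i - (b - a)) xs k.
  pose y' := \sum_(k < m | e k == i - (b - a)) ys k.
  have hR : R (i - (b - a)) x' y' by apply: Rsum => k /eqP <-.
  suff -> : f u = y' by have := Rdeg _ _ _ hR; rewrite subrK.
  apply: RRf (hf u) _; suff -> : (val u : M) = x' by exact: RR1 hR.
  apply: (gdeg_component _ _ xE) => [|k]; first exact: hu.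
  by case: (h k).
have gu : is_gmorphism (fun u : A => val u : M') by split.
have [g [[lg dg] gE]] := hE A M' _ f gu val_inj gf.
have gR x y : RR x y -> g x = y.
  move=> h; have Px : x \in sgpred P by apply/asboolP; exists y.
  have /= -> := gE (@SubGM K n M' P x Px : A).
  by apply: RRf (hf _) _.
exists g; split=> //.
- move=> i x hx; have := dg (i + (b - a)) x; apply.
  by rewrite /= /shift_deg addrK.
- move=> i x Vx; apply: gR; apply: (RR1 i); split; first exact: Vg.
  by exists 0; rewrite (lin0 lal) (lin0 lbe) subr0.
- move=> i z Zz; apply: gR; apply: (RR1 (i + a)); split; first exact: dal.
  by exists z; rewrite addrK subrr.
Qed.

End InjectiveExtension.

(** * Dimension bounds in long exact sequences *)

Section DimensionBounds.

(** Dimension at most c, where a negative c means that the module vanishes. *)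
Definition dimle (h : int -> int) (c : int) : Prop :=
  if c is Posz k then exists e, rat k h e else h =1 fun=> 0.

Definition nonneg (h : int -> int) := forall i, 0 <= h i.

Lemma dimle_le g h c : nonneg g -> rational g -> (forall i, g i <= h i) ->
  dimle h c -> dimle g c.
Proof.
move=> g0 [r [a rg]] gh; case: c => k /=; first by move=> [e rh]; exact: rat_le rh rg.
by move=> h0 i; apply/eqP; rewrite eq_le g0 andbT -(h0 i).
Qed.

Lemma dimle_lt k h c : dimle h c -> c < k%:Z -> rat k h 0.
Proof.
case: c => c /=; first by move=> [e rh] ck; exact: rat_raiseS rh.
by move=> h0 _; apply: eq_rat (rat0 k) => i; rewrite h0.
Qed.

Lemma dimle_mono h c c' : dimle h c -> c <= c' -> dimle h c'.
Proof.
move=> hc; rewrite le_eqVlt => /orP[/eqP <- //|cc'].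
case: c' cc' => k cc' /=; first by exists 0; exact: dimle_lt hc cc'.
by case: c hc cc' => // c; lia.
Qed.

Lemma dimle_add g h c : dimle g c -> dimle h c -> dimle (fun i => g i + h i) c.
Proof.
case: c => k /=; first by move=> [e rg] [e' rh]; exists (e + e'); exact: ratD.
by move=> g0 h0 i; rewrite g0 h0.
Qed.

Lemma dimle_zero h c : h =1 (fun=> 0) -> dimle h c.
Proof.
case: c => k //= h0; exists 0; apply: eq_rat (rat0 k) => i; rewrite h0 //.
Qed.

Lemma rat_pos_uniq d d' h e e' : rat d h e -> 0 < e -> rat d' h e' -> 0 < e' -> d = d'.
Proof.
move=> r e0 r' e0'; have [dd|dd|//] := ltngtP d d'.
  by rewrite (rat_uniq r' (rat_raiseS dd r)) in e0'.
by rewrite (rat_uniq r (rat_raiseS dd r')) in e0.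
Qed.

Lemma rat_pos_dimle d h e c : rat d h e -> 0 < e -> dimle h c -> d%:Z <= c.
Proof.
move=> r e0 hc; rewrite leNgt; apply/negP => /(dimle_lt hc) r'.
by rewrite (rat_uniq r r') in e0.
Qed.

Lemma rat0_zero h : nonneg h -> rat 0 h 0 -> h =1 fun=> 0.
Proof.
move=> h0 r; have [[d [e [rd ep]]]|//] := rat_minimal h0 r.
case: d rd => [|d] rd; first by rewrite (rat_uniq rd r) in ep.
by rewrite (rat_uniq rd (rat_raiseS (ltn0Sn d) r)) in ep.
Qed.

(* The ranks [f], [g], [d] of the maps of a long exact sequence               *)
(* ... -> A q -> B q -> C q -> A (q + 1) -> ...                               *)
Definition les_ranks (a b c f g d : int -> int -> int) :=
  [/\ forall q, [/\ nonneg (f q), nonneg (g q) & nonneg (d q)],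
      forall q, [/\ rational (f q), rational (g q) & rational (d q)],
      forall q i, b q i = f q i + g q i,
      forall q i, c q i = g q i + d q i
    & forall q i, a (q + 1) i = d q i + f (q + 1) i].

Definition les a b c := exists f g d, les_ranks a b c f g d.

(* The numerical properties of the modules [Ext^q(N, omega)], for [N] of      *)
(* dimension at most [d] whose coefficient of order [d] is [e].               *)
Definition dual_dims (h : int -> int -> int) (d : nat) (e : int) :=
  [/\ forall q, dimle (h q) (- q), forall q, d%:Z < - q -> h q =1 fun=> 0
    & rat d (h (- d%:Z)) e].

(** At q = -d the incoming connecting map starts in C^(-d - 1) = 0. The outgoing one ends in A^(1 -
    d), of dimension at most d - 1, so its rank has value 0 in order d. *)
Lemma dual_dims_ext a b c d e1 e2 : les a b c -> dual_dims a d e1 -> dual_dims c d e2 ->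
  dual_dims b d (e1 + e2).
Proof.
move=> [f [g [dl [nn ra bE cE aE]]]] [a1 a2 a3] [c1 c2 c3].
have aE' q i : a q i = dl (q - 1) i + f q i by have := aE (q - 1) i; rewrite subrK.
have fa q i : f q i <= a q i.
  by have [_ _ /(_ i)] := nn (q - 1); rewrite aE'; lia.
have gc q i : g q i <= c q i by have [_ _ /(_ i)] := nn q; rewrite cE; lia.
have dc q i : dl q i <= c q i by have [_ /(_ i) h _] := nn q; rewrite cE lerDr.
have da q i : dl q i <= a (q + 1) i by have [/(_ i) h _ _] := nn (q + 1); rewrite aE lerDl.
split=> [q|q dq|].
- have [f0 g0 _] := nn q; have [rf rg _] := ra q.
  have -> : b q = fun i => f q i + g q i by apply/funext => i; rewrite bE.
  by apply: dimle_add; [apply: dimle_le (a1 q)|apply: dimle_le (c1 q)].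
- move=> i; rewrite bE; have [f0 g0 _] := nn q.
  have := fa q i; have := gc q i; have := f0 i; have := g0 i.
  by rewrite a2 // c2 //; lia.
- have z1 i : dl (- d%:Z - 1) i = 0.
    have [_ _ /(_ i)] := nn (- d%:Z - 1); have := dc (- d%:Z - 1) i.
    by rewrite c2; lia.
  have [_ _ d0] := nn (- d%:Z); have [_ _ rd] := ra (- d%:Z).
  have r1 : rat d (dl (- d%:Z)) 0.
    by apply: (@dimle_lt d _ (d%:Z - 1)); [apply: dimle_le (da _) _ => //|lia];
       have := a1 (- d%:Z + 1); congr (dimle _ _); lia.
  have := ratB (ratD a3 c3) r1; rewrite subr0; apply: eq_rat => i.
  by rewrite bE cE aE' z1; lia.
Qed.

(** Here a, b, c stand for the Ext of S / (I + x), of S / I, and again of S / I shifted by 1. The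
    long exact sequence expresses the differences of [b q] by the ranks [dl q] and [f q], so that
    summing a bound for a^(q + 1) bounds b^q. At q = -d - 1 the rank [f] vanishes, and [dl] agrees
    with a^(-d) in order d. *)
Lemma dual_dims_regular a b c d e : les a b c -> (forall q i, c q i = b q (i + 1)) ->
  (forall q, nonneg (b q)) -> (forall q, rational (b q)) ->
  dual_dims a d e -> dual_dims b d.+1 e.
Proof.
move=> [f [g [dl [nn ra bE cE aE]]]] cb b0 rb [a1 a2 a3].
have aE' q i : a q i = dl (q - 1) i + f q i by have := aE (q - 1) i; rewrite subrK.
have fa q i : f q i <= a q i.
  by have [_ _ /(_ i)] := nn (q - 1); rewrite aE'; lia.
have da q i : dl q i <= a (q + 1) i by have [/(_ i) h _ _] := nn (q + 1); rewrite aE lerDl.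
have db q i : delta (b q) (i + 1) = dl q i - f q i.
  by rewrite /delta addrK -cb cE bE; lia.
have bl q : bounded_left (b q) by have [r [x /rat_bounded_left]] := rb q.
(* For c' <= 0 the differences of [b q] are at most 0, and a nonnegative function that starts at 0
   must then be zero: a numerical form of Nakayama's lemma. *)
have dimb q c' : dimle (dl q) (c' - 1) -> dimle (b q) c'.
  move=> hd; have [_ _ d0] := nn q; have [_ _ rd] := ra q.
  case: c' hd => [[|k]|k] hd.
  - exists 0; apply: eq_rat (rat0 0) => i; apply/eqP; rewrite eq_sym eq_le b0 andbT.
    apply: (@delta_le _ (fun=> 0)) => // [|j]; first by exists 0.
    have := db q (j - 1); rewrite subrK => ->; have [/(_ (j - 1)) f0 _ _] := nn q.
    have -> : dl q (j - 1) = 0 by exact: hd.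
    by rewrite /delta; lia.
  - have [e' rd'] : exists e', rat k (dl q) e'.
      by move: hd; have -> : k.+1%:Z - 1 = k%:Z by lia.
    have [h dh rh] := rat_cumul (rat_shift (-1) rd').
    have [r [x rb']] := rb q.
    apply: (rat_le (b0 q) _ rh rb'); apply: delta_le => //; first exact: rat_bounded_left rh.
    move=> i; rewrite dh; have := db q (i - 1); rewrite subrK => ->.
    by have [/(_ (i - 1)) f0 _ _] := nn q; lia.
  - move=> i; apply/eqP; rewrite eq_le b0 andbT.
    apply: (@delta_le _ (fun=> 0)) => // [|j]; first by exists 0.
    have := db q (j - 1); rewrite subrK => ->; have [/(_ (j - 1)) f0 _ _] := nn q.
    have -> : dl q (j - 1) = 0.
      by move: hd; have -> : Negz k - 1 = Negz k.+1 by lia.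
    by rewrite /delta; lia.
have dimd q c' : dimle (a (q + 1)) c' -> dimle (dl q) c'.
  by have [_ _ d0] := nn q; have [_ _ rd] := ra q; apply: dimle_le => //; exact: da.
split=> [q|q dq|].
- apply/dimb/dimd; have := a1 (q + 1); congr (dimle _ _); lia.
- apply: (@dimb q (-1)); apply/dimd/dimle_zero/a2; lia.
- have fz i : f (- d.+1%:Z) i = 0.
    by have [/(_ i) f0 _ _] := nn (- d.+1%:Z); have := fa (- d.+1%:Z) i; rewrite a2; lia.
  split; first exact: bl.
  have E : - d.+1%:Z + 1 = - d%:Z by lia.
  suff r : rat d (dl (- d.+1%:Z)) e.
    apply: eq_rat (rat_shift (-1) r) => i.
    by have := db (- d.+1%:Z) (i - 1); rewrite subrK fz => ->; lia.
  have rf : rat d (f (- d%:Z)) 0.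
    have rdl : rat d (dl (- d%:Z)) 0.
      apply: (@dimle_lt d _ (d%:Z - 1)); last by lia.
      by apply: dimd; have := a1 (- d%:Z + 1); congr (dimle _ _); lia.
    have [x rbd] : dimle (b (- d%:Z)) d%:Z.
      by apply: dimb; apply: dimd; have := a1 (- d%:Z + 1); congr (dimle _ _); lia.
    have [_ rdb] := rat_raise rbd.
    have := ratB rdl (rat_shift 1 rdb); rewrite subr0; apply: eq_rat => i.
    by rewrite db; lia.
  have := ratB a3 rf; rewrite subr0; apply: eq_rat => i.
  by have := aE (- d.+1%:Z) i; rewrite E => ->; rewrite addrK.
Qed.

End DimensionBounds.

(** * Cohomology of quotients of graded subcomplexes *)

Section SubcomplexCohomology.
Variables (K : fieldType) (n : nat).
Local Notation gsq := (gsq K n).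

Lemma gmor0 (X Y : gsq) (f : amb X -> amb Y) : linear f ->
  (forall i x, numer X i x -> numer Y i (f x)) ->
  (forall i x, denom X i x -> denom Y i (f x)) -> gmor 0 f.
Proof. by move=> lf Zf Bf; split=> // i x; rewrite addr0; [exact: Zf|exact: Bf]. Qed.

Lemma exact_at0 (X Y W : gsq) (f : amb X -> amb Y) (g : amb Y -> amb W) :
  (forall i x, numer X i x -> denom W i (g (f x))) ->
  (forall i y, numer Y i y -> denom W i (g y) ->
    exists2 x, numer X i x & denom Y i (y - f x)) -> exact_at 0 0 f g.
Proof.
move=> gf ex; split=> [i x|i y]; first by rewrite !addr0; exact: gf.
by rewrite !addr0; exact: ex.
Qed.

Lemma noeth_exact_at (X Y W : gsq) s t f g : @gmor _ _ X Y s f -> @gmor _ _ Y W t g ->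
  exact_at s t f g -> noeth X -> noeth W -> noeth Y.
Proof. by move=> gf gg [_ ex]; exact: noeth_exact gf gg ex. Qed.

Variable C : gcomplex K n.

Lemma cdiffL i j : linear (@cdiff K n C i j). Proof. by case: (cdiff_gmorphism C i j). Qed.
Lemma cdiff0 i j : @cdiff K n C i j 0 = 0. Proof. exact: (lin0 (@cdiffL i j)). Qed.
Lemma cdiffB i j x y : @cdiff K n C i j (x - y) = cdiff j x - cdiff j y.
Proof. exact: (linB (@cdiffL i j)). Qed.
Lemma cdiffN i j x : @cdiff K n C i j (- x) = - cdiff j x.
Proof. by rewrite -sub0r cdiffB cdiff0 sub0r. Qed.
Lemma cdiffZ i j p x : @cdiff K n C i j (p *: x) = p *: cdiff j x.
Proof. exact: (linZ (@cdiffL i j)). Qed.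

Record subcx := SubCx {
  subcx_deg :> forall q, int -> C q -> Prop;
  subcx_gsubmod : forall q, gsubmod (@subcx_deg q);
  subcx_diff : forall q r i x, subcx_deg i x -> subcx_deg (q := r) i (cdiff r (x : C q))
}.
Arguments subcx_deg : clear implicits.

Definition subcx_le (Y X : subcx) := forall q i x, Y q i x -> X q i x.

Implicit Types X Y Z : subcx.

Lemma scx0 X q i : X q i 0. Proof. by case: (subcx_gsubmod X q). Qed.
Lemma scxB X q i x y : X q i x -> X q i y -> X q i (x - y).
Proof. by case: (subcx_gsubmod X q) => _ + _; apply. Qed.
Lemma scxN X q i x : X q i x -> X q i (- x).
Proof. by move=> hx; rewrite -sub0r; apply: scxB => //; exact: scx0. Qed.
Lemma scxD X q i x y : X q i x -> X q i y -> X q i (x + y).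
Proof. by move=> hx /scxN hy; rewrite -[y]opprK; exact: scxB. Qed.

Section RelativeCohomology.
Variables (X Y : subcx) (YX : subcx_le Y X) (q : int).

Definition rcocycle i z := X q i z /\ forall r, Y r i (cdiff r z).
Definition rcobound i z := exists2 v, X (q - 1) i v & Y q i (z - cdiff q v).

Lemma rcocycle_gsubmod : gsubmod rcocycle.
Proof.
have [X0 XB XZ] := subcx_gsubmod X q.
split=> [i|i x y [x1 x2] [y1 y2]|i k p x hp [x1 x2]]; split.
- exact: X0.
- by move=> r; rewrite cdiff0; exact: scx0.
- exact: XB.
- by move=> r; rewrite cdiffB; exact: scxB.
- exact: XZ.
- by move=> r; rewrite cdiffZ; have [_ _ YZ] := subcx_gsubmod Y r; exact: YZ.
Qed.

Lemma rcobound_gsubmod : gsubmod rcobound.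
Proof.
have [X0 XB XZ] := subcx_gsubmod X (q - 1); have [Y0 YB YZ] := subcx_gsubmod Y q.
split=> [i|i x y [u u1 u2] [v v1 v2]|i k p x hp [u u1 u2]].
- by exists 0; [exact: X0|rewrite cdiff0 subr0; exact: Y0].
- exists (u - v); first exact: XB.
  have := YB _ _ _ u2 v2; congr (Y q i _).
  by rewrite cdiffB !opprD !opprK addrACA.
- exists (p *: u); first exact: XZ.
  by rewrite cdiffZ -scalerBr; exact: YZ.
Qed.

Lemma rcobound_cocycle i z : rcobound i z -> rcocycle i z.
Proof.
move=> [v Xv Yv]; split=> [|r].
  rewrite -(subrK (cdiff q v) z); apply: scxD; first exact: YX.
  exact: subcx_diff.
by have := subcx_diff r Yv; rewrite cdiffB cdiffK subr0.
Qed.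

(** This is H^q(X / Y), described inside [C] without forming the quotient complex. *)
Definition rcoh : gsq := Gsq rcocycle_gsubmod rcobound_gsubmod rcobound_cocycle.

(** The degree r is arbitrary because [cdiff q] vanishes on it unless r = q - 1; this saves
    transports between propositionally equal degrees. *)
Lemma rcobound_intro i z r (v : C r) : X r i v -> Y q i (z - cdiff q v) -> rcobound i z.
Proof.
have [e|ne] := eqVneq r (q - 1); first by subst r; exists v.
rewrite [cdiff q v]cdiff_shape ?subr0; last by apply: contraNneq ne => ->; rewrite addrK.
by move=> _ Yz; exists 0; [exact: scx0|rewrite cdiff0 subr0].
Qed.

Lemma rcobound_elim i z r : r + 1 = q -> rcobound i z ->
  exists2 v : C r, X r i v & Y q i (z - cdiff q v).
Proof. by move=> rq; have -> : r = q - 1 by rewrite -rq addrK. Qed.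

End RelativeCohomology.

Section LongExactSequence.
Variables (X Y Z : subcx).
Hypotheses (YX : subcx_le Y X) (ZY : subcx_le Z Y) (ZX : subcx_le Z X).

Lemma les_mor1 q : @gmor _ _ (rcoh ZY q) (rcoh ZX q) 0 id.
Proof.
apply: gmor0 => // i x; first by move=> [x1 x2]; split=> //; exact: YX.
by move=> [v v1 v2]; exists v => //; exact: YX.
Qed.

Lemma les_mor2 q : @gmor _ _ (rcoh ZX q) (rcoh YX q) 0 id.
Proof.
apply: gmor0 => // i x; first by move=> [x1 x2]; split=> // r; exact: ZY.
by move=> [v v1 v2]; exists v => //; exact: ZY.
Qed.

Lemma les_mor3 q : @gmor _ _ (rcoh YX q) (rcoh ZY (q + 1)) 0 (@cdiff K n C q (q + 1)).
Proof.
apply: gmor0; first exact: cdiffL.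
  move=> i x [x1 x2]; split; first exact: x2.
  by move=> r; rewrite cdiffK; exact: scx0.
move=> i x [v v1 v2]; apply: (@rcobound_intro _ _ _ _ _ q (x - cdiff q v)) => //.
by rewrite cdiffB cdiffK subr0 subrr; exact: scx0.
Qed.

Lemma les_exact1 q : exact_at 0 0 (id : amb (rcoh ZY q) -> amb (rcoh ZX q))
  (id : amb (rcoh ZX q) -> amb (rcoh YX q)).
Proof.
apply: exact_at0 => i x [x1 x2].
  by exists 0; [exact: scx0|rewrite cdiff0 subr0].
move=> [v v1 v2]; exists (x - cdiff q v).
  split=> // r; by rewrite cdiffB cdiffK subr0.
by exists v => //; rewrite subKr subrr; exact: scx0.
Qed.

Lemma les_exact2 q : exact_at 0 0 (id : amb (rcoh ZX q) -> amb (rcoh YX q))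
  (@cdiff K n C q (q + 1) : amb (rcoh YX q) -> amb (rcoh ZY (q + 1))).
Proof.
apply: exact_at0 => i x [x1 x2].
  by exists 0; [exact: scx0|rewrite cdiff0 subr0].
move=> /(rcobound_elim (erefl (q + 1)))[v v1 v2]; exists (x - v).
  split; first by apply: scxB => //; exact: YX.
  move=> r; have [->|ne] := eqVneq r (q + 1); first by rewrite cdiffB.
  by rewrite cdiff_shape //; exact: scx0.
by exists 0; [exact: scx0|rewrite cdiff0 subr0 subKr].
Qed.

Lemma les_exact3 q : exact_at 0 0
  (@cdiff K n C q (q + 1) : amb (rcoh YX q) -> amb (rcoh ZY (q + 1)))
  (id : amb (rcoh ZY (q + 1)) -> amb (rcoh ZX (q + 1))).
Proof.
apply: exact_at0 => i x [x1 x2].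
  by apply: (@rcobound_intro _ _ _ _ _ q x) => //; rewrite subrr; exact: scx0.
move=> /(rcobound_elim (erefl (q + 1)))[v v1 v2]; exists v.
  split=> // r; have [->|ne] := eqVneq r (q + 1); last first.
    by rewrite cdiff_shape //; exact: scx0.
  by rewrite -[cdiff _ v](subKr x); apply: scxB => //; exact: ZY.
by exists 0; [exact: scx0|rewrite cdiff0 subr0].
Qed.

Lemma noeth_les q : noeth (rcoh ZY q) -> noeth (rcoh YX q) -> noeth (rcoh ZX q).
Proof. exact: noeth_exact_at (les_mor1 q) (les_mor2 q) (les_exact1 q). Qed.

Lemma noeth_les_next q : noeth (rcoh YX q) -> noeth (rcoh ZX (q + 1)) ->
  noeth (rcoh ZY (q + 1)).
Proof. exact: noeth_exact_at (les_mor3 q) (les_mor1 (q + 1)) (les_exact3 q). Qed.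

Lemma rational_rk (A B : gsq) s f (gf : @gmor _ _ A B s f) : noeth A -> rational (rk gf).
Proof. by move=> nA; apply/rational_fg/noeth_fg/noeth_quo => //; exact: denom_kerZ. Qed.

Lemma les_rcoh : (forall q, noeth (rcoh ZY q)) -> (forall q, noeth (rcoh YX q)) ->
  les (fun q => hf (rcoh ZY q)) (fun q => hf (rcoh ZX q)) (fun q => hf (rcoh YX q)).
Proof.
move=> n1 n3; have n2 q : noeth (rcoh ZX q) by exact: noeth_les.
have fd (A : gsq) : noeth A -> fin_dim A by exact: noeth_fin_dim.
exists (fun q => rk (les_mor1 q)), (fun q => rk (les_mor2 q)), (fun q => rk (les_mor3 q)).
split=> [q|q|q i|q i|q i].
- by split=> i; exact: rk_ge0.
- by split; exact: rational_rk.
- have := hf_exact (les_mor1 q) (les_mor2 q) (les_exact1 q) (fd _ (n1 q)) (fd _ (n2 q)) i.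
  by rewrite addr0.
- have := hf_exact (les_mor2 q) (les_mor3 q) (les_exact2 q) (fd _ (n2 q)) (fd _ (n3 q)) i.
  by rewrite addr0.
- have := hf_exact (les_mor3 q) (les_mor1 (q + 1)) (les_exact3 q) (fd _ (n3 q)) (fd _ (n1 _)) i.
  by rewrite addr0.
Qed.

End LongExactSequence.

Definition zero_subcx : subcx.
Proof.
refine (@SubCx (fun q _ x => x = 0) (fun q => zero_gsubmod _) _).
by move=> q r i x ->; exact: cdiff0.
Defined.

Definition full_subcx : subcx.
Proof.
refine (@SubCx (fun q i x => gdeg i x) (fun q => gmod_gsubmod _) _).
by move=> q r i x hx; exact: cdiff_deg.
Defined.

Lemma zero_subcx_le X : subcx_le zero_subcx X.
Proof. by move=> q i x ->; exact: scx0. Qed.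

End SubcomplexCohomology.

(** * Duals of cyclic modules *)

Section DualsOfCyclicModules.
Variables (K : fieldType) (n : nat).
Local Notation S := {mpoly K[n]}.
Local Notation gsq := (gsq K n).
Variable C : gcomplex K n.

(** Hom(S / I, C q), as the elements of [C q] killed by I. *)
Definition ann_deg (I : S -> Prop) q i (w : C q) := gdeg i w /\ forall p, I p -> p *: w = 0.

Lemma ann_gsubmod (I : S -> Prop) q : gsubmod (ann_deg I (q := q)).
Proof.
split=> [i|i x y [x1 x2] [y1 y2]|i k p x hp [x1 x2]]; split.
- exact: gdeg0.
- by move=> p _; rewrite scaler0.
- exact: gdegB.
- by move=> p Ip; rewrite scalerBr x2 // y2 // subr0.
- exact: gdegZ.
- by move=> a Ia; rewrite scalerA mulrC -scalerA x2 // scaler0.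
Qed.

Definition ann_subcx (I : S -> Prop) : subcx C.
Proof.
refine (@SubCx _ _ C (fun q i w => ann_deg I i w) (ann_gsubmod I) _).
move=> q r i x [x1 x2]; split; first exact: cdiff_deg.
by move=> p Ip; rewrite -cdiffZ x2 // cdiff0.
Defined.

(* For [C] an injective resolution of [A] this is [Ext^q(S / I, A)].          *)
Definition extq (I : S -> Prop) q : gsq := rcoh (@zero_subcx_le _ _ C (ann_subcx I)) q.

Lemma ann_addid I a q i (w : C q) : hideal I ->
  ann_deg (addid I a) i w <-> ann_deg I i w /\ a *: w = 0.
Proof.
move=> hI; split=> [[hw aw]|[[hw Iw] aw]].
  by split; [split=> // p Ip; apply: aw; exact: addid_sub|exact/aw/addid_mem].
split=> // p [b Ib]; rewrite -(subrK (b * a) p) scalerDl Iw // add0r.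
by rewrite -scalerA aw scaler0.
Qed.

Lemma ann_addid_le I a : subcx_le (ann_subcx (addid I a)) (ann_subcx I).
Proof. by move=> q i x [hx ax]; split=> // p Ip; apply: ax; exact: addid_sub. Qed.

(** Multiplication by [a] turns this into Ext^q(S / (I : a)) up to a shift, see [hf_ext_rel]. *)
Definition ext_rel I a q : gsq := rcoh (@ann_addid_le I a) q.

Hypothesis inj : forall q, gr_injective (C q).

Section Colon.
Variables (I : S -> Prop) (a : S) (d : nat).
Hypotheses (hI : hideal I) (ha : a \is d.-homog).

(** Since w is killed by (I : a), sending p a to p w and I to 0 is well defined on I + a. By
    injectivity it extends to S, and v is the image of 1. *)
Lemma ann_colid_lift q i (w : C q) : ann_deg (colid I a) i w ->
  exists2 v : C q, ann_deg I (i - d%:Z) v & a *: v = w.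
Proof.
move=> [hw aw].
have [||||||g [lg dg gV gE]] := @injective_extension K n (C q) (ring_gmod K n) S^o
    (fun i p => ring_deg i p) (idZ I) (fun p => ((p : S) * a : S^o))
    (fun p => (p : S) *: w) d%:Z i (@inj q) (@ring_gsubmod K n) (idZ_gsubmod hI).
- by move=> j x [].
- by move=> b x y /=; rewrite mulrDl -mulrA.
- by move=> b x y /=; rewrite scalerDl scalerA.
- by move=> j p hp /=; apply: rdegM.
- by move=> j p hp; rewrite addrC; apply: (gsubmodZ (gmod_gsubmod (C q)) hp hw).
- by move=> j p hp [_ Ipa]; exact: aw.
have gM (p : S) : p *: g (1 : S) = g p.
  by rewrite -(linZ lg); congr (g _); exact: mulr1.
exists (g (1 : S)); last by rewrite gM -[a]mul1r (gE 0) ?scale1r //; exact: dhomog1.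
split.
  by have := dg 0 (1 : S); rewrite add0r; apply; exact: dhomog1.
move=> p Ip; rewrite gM (pihomog_partitionE (mf := mdeg) (leqnn (msize p))) (lin_sum lg) big1 //.
move=> k _; apply: (gV k); split; last exact: hidH.
exact: pihomogP.
Qed.

Definition colon_map q (w : C q) : C q := a *: w.

Lemma colon_gmor q : @gmor _ _ (ext_rel I a q) (extq (colid I a) q) d%:Z (@colon_map q).
Proof.
have colZ r i (w : C r) : ann_deg I i w -> ann_deg (colid I a) (i + d%:Z) (a *: w).
  move=> [hw Iw]; split; first exact: gdegZ.
  by move=> p /Iw; rewrite -scalerA.
split=> [b x y|i x [x1 x2]|i x [v v1 v2]]; rewrite /colon_map.
- by rewrite scalerDr !scalerA mulrC.
- split; first exact: colZ.
  by move=> r; rewrite cdiffZ; have /(ann_addid _ _ _ hI)[] := x2 r.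
- exists (a *: v); first exact: colZ.
  by rewrite cdiffZ -scalerBr; have /(ann_addid _ _ _ hI)[] := v2.
Qed.

Lemma colon_inj q i x : numer (ext_rel I a q) i x ->
  denom (extq (colid I a) q) (i + d%:Z) (colon_map x) -> denom (ext_rel I a q) i x.
Proof.
move=> [x1 x2] [u /ann_colid_lift[v]]; rewrite addrK => v1 <- /= h; exists v => //.
apply/(ann_addid _ _ _ hI); split.
  by apply: (scxB (X := ann_subcx I)) => //; exact: (subcx_diff (s := ann_subcx I)).
by rewrite scalerBr -cdiffZ.
Qed.

Lemma colon_surj q i y : numer (extq (colid I a) q) (i + d%:Z) y ->
  exists2 x, numer (ext_rel I a q) i x & denom (extq (colid I a) q) (i + d%:Z) (y - colon_map x).
Proof.
move=> [/ann_colid_lift[v]]; rewrite addrK => v1 vy y2; exists v; last first.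
  by rewrite /colon_map vy subrr; exact: denom0.
split=> // r; apply/(ann_addid _ _ _ hI); split.
  exact: (subcx_diff (s := ann_subcx I)).
by rewrite -cdiffZ vy; exact: y2.
Qed.

Lemma noeth_ext_rel q : noeth (extq (colid I a) q) -> noeth (ext_rel I a q).
Proof. by apply: noeth_inj (colon_gmor q) _; exact: colon_inj. Qed.

Lemma hf_ext_rel q : noeth (extq (colid I a) q) ->
  forall i, hf (ext_rel I a q) i = hf (extq (colid I a) q) (i + d%:Z).
Proof.
move=> nE; have fd := noeth_fin_dim (noeth_ext_rel nE).
exact: (fin_dim_iso (colon_gmor q) (@colon_inj q) (@colon_surj q) fd).2.
Qed.

End Colon.

Section Noetherian.
Hypotheses (bC : bounded_below C) (nC : forall q, noeth (extq (fun p => p = 0) q)).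

(** Induction on q, starting below the first nonzero degree, and then on generators of I: Ext^(q +
    1)(S / (I + a)) sits between Ext^q(S / (I : a)) and Ext^(q + 1)(S / I). *)
Lemma noeth_extq I q : hideal I -> noeth (extq I q).
Proof.
have [m hm] := bC; move=> hI.
have [qm|mq] := ltP q m.
  by apply: noeth_zero => i x _; rewrite (hm _ qm x); exact: denom0.
move: q mq I hI.
suff H : forall q, m - 1 <= q -> forall I, hideal I -> noeth (extq I q).
  by move=> q mq; apply: H; lia.
apply: int_ge_ind => [I hI|q _ IH I hI].
  apply: noeth_zero => i x _; rewrite (hm (m - 1) _ x); first exact: denom0.
  lia.
move: I hI; apply: hideal_gen_ind => [|I a d hI ha nI]; first exact: nC.
apply: (@noeth_les_next _ _ C _ _ _ (@ann_addid_le I a) (@zero_subcx_le _ _ C _) (@zero_subcx_le _ _ C _)); last exact: nI.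
by apply: (noeth_ext_rel hI ha); apply: IH; exact: hideal_col ha.
Qed.

Lemma les_extq I a d : hideal I -> a \is d.-homog ->
  les (fun q => hf (extq (addid I a) q)) (fun q => hf (extq I q))
      (fun q i => hf (extq (colid I a) q) (i + d%:Z)).
Proof.
move=> hI ha; have hC := hideal_col hI ha; have hA := hideal_add hI ha.
have -> : (fun q i => hf (extq (colid I a) q) (i + d%:Z)) = (fun q => hf (ext_rel I a q)).
  apply/funext => q; apply/funext => i; apply/esym/hf_ext_rel => //.
  exact: noeth_extq.
apply: les_rcoh => q; first exact: noeth_extq.
by apply: (noeth_ext_rel hI ha); exact: noeth_extq.
Qed.

End Noetherian.

(* [Ext^q(S / I, A)] vanishes for [q != q0], and is a shift of [S / I] for    *)
(* [q = q0].                                                                  *)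
Definition concentrated (I : S -> Prop) (q0 : int) :=
  (forall q, q != q0 -> forall i x, numer (extq I q) i x -> denom (extq I q) i x) /\
  exists s (w : C q0), [/\ numer (extq I q0) s w,
    forall i x, numer (extq I q0) i x -> exists2 c : S, ring_deg (i - s) (c : S^o) &
      denom (extq I q0) i (x - c *: w)
    & forall j p, ring_deg j (p : S^o) -> denom (extq I q0) (s + j) (p *: w) -> I p].

(** As (I : x) = I, the long exact sequence is that of multiplication by x on Ext(S / I). This is
    injective on the only nonzero group, a shifted S / I, and its cokernel, a shifted S / (I + x),
    moves to degree q0 + 1. *)
Lemma concentrated_step I x d q0 : hideal I -> x \is d.-homog -> (forall p, I (p * x) -> I p) ->
  concentrated I q0 -> concentrated (addid I x) (q0 + 1).
Proof.
move=> hI hx reg [zI [s [w [Zw cyc inj_w]]]].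
have colI : colid I x = I by apply: hideal_ext => p; [exact: reg|exact: colid_sub].
have lift q i (u : C q) : ann_deg I i u -> exists2 v : C q, ann_deg I (i - d%:Z) v & x *: v = u.
  by rewrite -{1}colI; exact: ann_colid_lift.
have [[aw Iw] dw] := Zw.
have annIw c : I c -> c *: w = 0 by exact: Iw.
(* exactness of H^q(X / Y) -> Ext^(q+1)(S / (I + x)) -> Ext^(q+1)(S / I)      *)
have ex3 q i y : numer (extq (addid I x) (q + 1)) i y -> denom (extq I (q + 1)) i y ->
    exists2 v, numer (ext_rel I x q) i v & y = cdiff (q + 1) v.
  move=> [y1 y2] /(rcobound_elim (erefl (q + 1)))[v v1 /subr0_eq yE].
  exists v => //; split=> // r; have [->|ne] := eqVneq r (q + 1); last first.
    by rewrite cdiff_shape //; exact: scx0.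
  by rewrite -yE.
have zR q : q != q0 -> forall i v, numer (ext_rel I x q) i v -> denom (ext_rel I x q) i v.
  move=> ne i v Zv; apply: (colon_inj hI hx Zv); rewrite colI; apply: zI => //.
  by have [_ h _] := colon_gmor hI hx q; have := h _ _ Zv; rewrite colI.
have zd q i v : denom (ext_rel I x q) i v -> denom (extq (addid I x) (q + 1)) i (cdiff (q + 1) v).
  by have [_ _ h] := les_mor3 (@ann_addid_le I x) (@zero_subcx_le _ _ C (ann_subcx (addid I x))) q;
    move=> /h; rewrite addr0.
split.
  move=> q qne i y Zy; have [q' qE] : exists q', q = q' + 1 by exists (q - 1); rewrite subrK.
  subst q; have q'ne : q' != q0 by apply: contra_neq qne => ->.
  have [|v Zv ->] := ex3 _ _ _ Zy; last by apply/zd/zR.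
  have [e|ne] := eqVneq (q' + 1) q0; last first.
    apply: zI => //; case: Zy => y1 y2; split=> //; exact: (ann_addid_le y1).
  subst q0; have [y1 y2] := Zy; have [y3 xy] := (ann_addid _ _ _ hI).1 y1.
  have [c hc [u u1 /subr0_eq u2]] : exists2 c : S, ring_deg (i - s) (c : S^o) &
      denom (extq I (q' + 1)) i (y - c *: w) by apply: cyc; split.
  (* From x y = 0 it follows that c x w is a coboundary, so c x lies in I; then c lies in I by
     regularity. *)
  have Ic : I c.
    apply: reg; apply: (inj_w (i - s + d%:Z)); first by apply: rdegM.
    exists (- (x *: u)).
      apply: (scxN (X := ann_subcx I)); have [_ _ h] := subcx_gsubmod (ann_subcx I) (q' + 1 - 1).
      by have := h _ _ _ _ hx u1; congr (ann_deg _ _ _); lia.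
    rewrite /= cdiffN opprK cdiffZ mulrC -scalerA -scalerDr.
    by rewrite -u2 [_ + (_ - _)]addrC subrK.
  by exists u => //=; rewrite -u2 annIw // subr0 subrr.
(* Write w = x v. The connecting map sends the class of v to that of [cdiff (q0 + 1) v], the new
   generator, in degree s - d. *)
have [v [v1 vI] xv] := lift _ _ _ (conj aw Iw).
have Zv : numer (ext_rel I x q0) (s - d%:Z) v.
  split=> // r; apply/(ann_addid _ _ _ hI); split.
    by apply: (subcx_diff (s := ann_subcx I)).
  by rewrite -cdiffZ xv; exact: dw.
exists (s - d%:Z), (cdiff (q0 + 1) v); split.
- by have [_ h _] := les_mor3 (@ann_addid_le I x) (@zero_subcx_le _ _ C (ann_subcx (addid I x))) q0;
    have := h _ _ Zv; rewrite addr0.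
- move=> i y Zy; have [|u Zu yE] := ex3 _ _ _ Zy.
    apply: zI; first by rewrite -subr_eq0 addrC addKr oner_eq0.
    by case: Zy => y1 y2; split=> //; exact: (ann_addid_le y1).
  have Zxu : numer (extq I q0) (i + d%:Z) (x *: u).
    by have [_ h _] := colon_gmor hI hx q0; have := h _ _ Zu; rewrite colI.
  have [c hc [t t1 /subr0_eq t2]] := cyc _ _ Zxu.
  have [t' t1' xt] := lift _ _ _ t1.
  exists c; first by move: hc; congr (ring_deg _ _); lia.
  rewrite yE -cdiffZ -cdiffB; have [[u1 _] _] := Zu.
  have -> : cdiff (q0 + 1) (u - c *: v) = cdiff (q0 + 1) (u - c *: v - cdiff q0 t').
    by rewrite [in RHS]cdiffB cdiffK subr0.
  apply: zd; exists 0; first exact: scx0.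
  rewrite cdiff0 subr0; apply/(ann_addid _ _ _ hI); split; last first.
    by rewrite !scalerBr [x *: (c *: v)]scalerA [x * c]mulrC -scalerA xv -cdiffZ xt -t2 subrr.
  have [Zu1 _] := Zu.
  apply: (scxB (X := ann_subcx I)); first apply: (scxB (X := ann_subcx I)) => //.
    have := gsubmodZ (ann_gsubmod I q0) hc (conj v1 vI : ann_deg I _ v).
    by congr (ann_deg _ _ _); lia.
  apply: (subcx_diff (s := ann_subcx I)).
  by move: t1'; congr (ann_deg _ _ _); lia.
- move=> j p hp /(rcobound_elim (erefl (q0 + 1)))[y y1 /subr0_eq yE].
  have [y2 xy] := (ann_addid _ _ _ hI).1 y1.
  have annv : ann_deg I (s - d%:Z + j) (p *: v).
    by have := gsubmodZ (ann_gsubmod I q0) hp (conj v1 vI : ann_deg I _ v).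
  have Zpv : numer (extq I q0) (s - d%:Z + j) (p *: v - y).
    split; first exact: (scxB (X := ann_subcx I)).
    move=> r /=; have [->|ne] := eqVneq r (q0 + 1); last by rewrite cdiff_shape.
    by rewrite cdiffB cdiffZ yE subrr.
  have [c hc [t t1 /subr0_eq t2]] := cyc _ _ Zpv.
  exists c; apply: (inj_w j); first apply: rdegB => //.
    by have := rdegM hc (hx : ring_deg d%:Z (x : S^o)); congr (ring_deg _ _); lia.
  exists (x *: t).
    have [_ _ h] := subcx_gsubmod (ann_subcx I) (q0 - 1).
    by have := h _ _ _ _ hx t1; congr (ann_deg _ _ _); lia.
  rewrite cdiffZ -t2 !scalerBr xy subr0 [x *: (p *: v)]scalerA [x * p]mulrC -[(p * x) *: v]scalerA xv.
  by rewrite scalerBl [x *: (c *: w)]scalerA [x * c]mulrC subrr.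
Qed.

End DualsOfCyclicModules.

(** * Numerical duality for S / I *)

Section DimensionOfDuals.
Variables (K : fieldType) (n : nat).
Local Notation S := {mpoly K[n]}.
Local Notation gsq := (gsq K n).

(* The ideal [(x_1, ..., x_k)].                                               *)
Definition varid k (p : S) :=
  forall m : 'X_{1..n}, (forall l : 'I_n, (l < k)%N -> m l = 0%N) -> p@_m = 0.

Lemma varid0 : varid 0 = (fun p => p = 0).
Proof.
apply: hideal_ext => p; last by move=> -> m _; rewrite mcoeff0.
by move=> h; apply/mpolyP => m; rewrite mcoeff0 h.
Qed.

Lemma varidS (l : 'I_n) : varid l.+1 = addid (varid l) 'X_l.
Proof.
apply: hideal_ext => p.
  move=> hp; exists (\sum_(m <- msupp p | m l != 0%N) p@_m *: 'X_[m - U_(l)]) => m hm.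
  have -> : p - (\sum_(m <- msupp p | m l != 0%N) p@_m *: 'X_[m - U_(l)]) * 'X_l =
      \sum_(m <- msupp p | m l == 0%N) p@_m *: 'X_[m].
    rewrite {1}[p]mpolyE (bigID (fun m : 'X_{1..n} => m l == 0%N)) /= mulr_suml.
    rewrite -[RHS]addr0 -addrA; congr (_ + _); apply/eqP; rewrite subr_eq0; apply/eqP.
    apply: eq_bigr => m' ml; rewrite -scalerAl -mpolyXD submK //.
    by apply/mnm_lepP => j; rewrite mnm1E; case: eqP => //= <-; rewrite lt0n.
  rewrite raddf_sum big1 // => m' /eqP ml /=; rewrite mcoeffZ mcoeffX.
  case: eqP => [e|_]; last by rewrite mulr0.
  rewrite mulr1 e hp // => j; rewrite ltnS leq_eqVlt => /orP[/eqP/val_inj ->|]; last exact: hm.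
  by rewrite -e.
move=> [q hq] m hm; have := hq m (fun j jl => hm j (ltnW jl)); rewrite mcoeffB.
suff -> : (q * 'X_l)@_m = 0 by rewrite subr0.
rewrite [q]mpolyE mulr_suml raddf_sum big1 // => m' _ /=.
rewrite -scalerAl -mpolyXD mcoeffZ mcoeffX; case: eqP => [e|_]; last by rewrite mulr0.
by have := hm l (leqnn _); rewrite -e mnmDE mnm1E eqxx addn1.
Qed.

Lemma hideal_varid k : (k <= n)%N -> hideal (varid k).
Proof.
elim: k => [_|k IH kn]; first by rewrite varid0; exact: hideal0.
by rewrite (varidS (Ordinal kn)); apply: hideal_add (dhomog_var K _); apply/IH/ltnW.
Qed.

Lemma varid_regular (l : 'I_n) p : varid l (p * 'X_l) -> varid l p.
Proof.
move=> h m hm; rewrite -(mcoeffMX _ U_(l)); apply: h => j jl.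
rewrite mnmDE hm // mnm1E; case: eqP => // e; by rewrite e ltnn in jl.
Qed.

Lemma varid_full p : varid n p <-> p@_0%MM = 0.
Proof.
split=> [h|h m hm]; first by apply: h => l _; rewrite mnm0E.
by have -> : m = 0%MM by apply/mnmP => l; rewrite mnm0E hm.
Qed.

Lemma dual_dims_raise h d d' e : (d < d')%N -> dual_dims h d e -> dual_dims h d' 0.
Proof.
move=> dd [h1 h2 h3]; split=> // [q dq|]; first by apply: h2; lia.
by apply: eq_rat (rat0 d') => i; rewrite h2 //; lia.
Qed.

Lemma dimle_shift s h c : dimle h c -> dimle (fun i => h (i + s)) c.
Proof.
case: c => k /=; first by move=> [e rh]; exists e; exact: rat_shift.
by move=> h0 i; exact: h0.
Qed.

Lemma dual_dims_shift s h d e : dual_dims h d e -> dual_dims (fun q i => h q (i + s)) d e.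
Proof.
move=> [h1 h2 h3]; split=> [q|q dq i|]; first exact: dimle_shift.
  exact: h2.
exact: rat_shift.
Qed.

Lemma dual_dims0 h d : (forall q, h q =1 fun=> 0) -> dual_dims h d 0.
Proof.
move=> h0; split=> [q|q _|]; [exact: dimle_zero|exact: h0|].
by apply: eq_rat (rat0 d) => i; rewrite h0.
Qed.

Variable C : gcomplex K n.
Hypotheses (inj : forall q, gr_injective (C q)) (bC : bounded_below C).
Hypothesis conc : concentrated C (fun p => p = 0) (- n%:Z).
Arguments inj : clear implicits.

Lemma noeth_concentrated I q0 : concentrated C I q0 -> forall q, noeth (extq C I q).
Proof.
move=> [z [s [w [Zw cyc _]]]] q; have [->|ne] := eqVneq q q0.
  exact: (noeth_cyc Zw cyc).
by apply: noeth_zero => i x; exact: z.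
Qed.

Let nE I q : hideal I -> noeth (extq C I q).
Proof. exact: (noeth_extq inj bC (noeth_concentrated conc)). Qed.

(** The variables form a regular sequence, and each of them raises the degree by one. *)
Lemma concentrated_varid k : (k <= n)%N -> concentrated C (varid k) (k%:Z - n%:Z).
Proof.
elim: k => [_|k IH kn]; first by rewrite varid0 sub0r.
have -> : k.+1%:Z - n%:Z = k%:Z - n%:Z + 1 by lia.
rewrite (varidS (Ordinal kn)); apply: (concentrated_step inj) (dhomog_var K _) _ _.
- exact/hideal_varid/ltnW.
- exact: (@varid_regular (Ordinal kn)).
- exact/IH/ltnW.
Qed.

Lemma dual_dims_maximal : (~ varid n 1) -> dual_dims (fun q => hf (extq C (varid n) q)) 0 1.
Proof.
move=> n1; have := concentrated_varid (leqnn n); rewrite subrr => -[z [s [w [Zw cyc iw]]]].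
have hI := hideal_varid (leqnn n).
have z' q : q != 0 -> hf (extq C (varid n) q) =1 fun=> 0.
  by move=> q0 i; apply/hf0P; [exact/noeth_fin_dim/nE|exact: z].
have vI (l : 'I_n) : varid n 'X_l.
  by apply/varid_full; rewrite mcoeffX mnm1_eq0.
have annE : annid s w (X := extq C (varid n) 0) = varid n.
  apply: hideal_ext => p hp.
    by apply: (hid_comp hI) => k; apply: (iw k) (hp k); exact: pihomogP.
  move=> k; have [[_ aw] _] := Zw; rewrite aw; first exact: denom0.
  exact: (hidH hI).
have r : rat 0 (hf (extq C (varid n) 0)) 1.
  apply: eq_rat (rat_shift (- s) (hf_maximal hI vI n1)) => i.
  rewrite -(eq_hf_idq (hideal_annid s w (X := extq C (varid n) 0)) hI); last by rewrite annE.
  by rewrite (hf_cyc Zw cyc) subrK.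
split=> [q|q q0|//]; last by apply: z'; lia.
have [->|q0] := eqVneq q 0; first by exists 1.
exact/dimle_zero/z'.
Qed.

(** The Noetherian induction of [rational_id], run for the Hilbert series of S / I and the long
    exact Ext sequence at once. *)
Lemma dual_dims_extq I (hI : hideal I) d e : rat d (hf (idq hI)) e ->
  dual_dims (fun q => hf (extq C I q)) d e.
Proof.
move: (hI) d e.
suff H : forall (hI : hideal I) d e, rat d (hf (idq hI)) e ->
  dual_dims (fun q => hf (extq C I q)) d e by [].
move: I hI; apply: hideal_ind => I hI0 IH hI d e rI.
have [I1|I1] := pselect (I 1).
  rewrite (rat_zero_uniq (hf_id_full hI I1) rI); apply: dual_dims0 => q i.
  apply/hf0P => [|x [[_ ax] _]]; first exact/noeth_fin_dim/nE.
  by rewrite -[x]scale1r ax //; exact: denom0.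
have [vI|/existsNP[l nl]] := pselect (forall l : 'I_n, I 'X_l).
  have IE : I = varid n.
    have h := vars_idealP hI vI I1.
    by apply: hideal_ext => p; [move/h/varid_full|move/varid_full/h].
  have n1 : ~ varid n 1 by rewrite -IE.
  have dm := dual_dims_maximal n1; rewrite -IE in dm.
  have r1 := hf_maximal hI vI I1.
  case: d rI => [|d] rI; first by rewrite (rat_uniq rI r1).
  by rewrite (rat_uniq rI (rat_raiseS (ltn0Sn d) r1)); exact: dual_dims_raise dm.
have hX := dhomog_var K l.
have hC := hideal_col hI hX; have hA := hideal_add hI hX.
have E i := hf_id_split hI hC hA i hX.
have ls := les_extq inj bC (noeth_concentrated conc) hI hX.
have IHA d' e' : rat d' (hf (idq hA)) e' -> dual_dims (fun q => hf (extq C (addid I 'X_l) q)) d' e'.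
  apply: IH => // [p|h]; first exact: addid_sub.
  by apply: nl; apply: h; exact: addid_mem.
have [CI|nCI] := pselect (subid (colid I 'X_l) I); last first.
  have rC : rational (fun i => hf (idq hC) (i - 1)).
    by have [r [e' h]] := rational_id hC; exists r, e'; exact: rat_shift.
  have [e1 [e2 [r1 r2 ->]]] := rat_split E (fun=> hf_ge0 _ _) (fun=> hf_ge0 _ _) rC
    (rational_id hA) rI.
  rewrite addrC; apply: (dual_dims_ext ls); first exact: (IHA _ _ r2).
  apply: (@dual_dims_shift 1 (fun q => hf (extq C (colid I 'X_l) q))); apply: (IH _ hC _ nCI hC) => [p|]; first exact: colid_sub.
  by apply: eq_rat (rat_shift 1 r1) => i; rewrite addrK.
have colI : colid I 'X_l = I by apply: hideal_ext => p; [exact: CI|exact: colid_sub].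
have EA : delta (hf (idq hI)) =1 hf (idq hA).
  by move=> i; rewrite /delta {1}E (eq_hf_idq hC hI) ?colI // addrAC subrr add0r.
(* A regular variable excludes d = 0: otherwise S / (I + x) would have value 0 in order 0 and so
   vanish, and then S / I would vanish too. *)
case: d rI => [|d] rI.
  case: I1; have r1 : rat 0 (hf (idq hA)) 0 by have [_ r] := rat_raise rI; exact: (@eq_rat 0 _ _ _ EA r).
  have z := rat0_zero (fun=> hf_ge0 _ _) r1.
  have h0 : hf (idq hI) 0 = 0.
    apply: (@delta_inj _ (fun=> 0)); [exact: rat_bounded_left rI|by exists 0|].
    by move=> i; rewrite EA z /delta subrr.
  by have [] := (hf0P 0 (noeth_fin_dim (noeth_id hI))).1 h0 (1 : S) (dhomog1 _ _).
have [bI rdI] := rI; have rA := @eq_rat d _ _ _ EA rdI.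
apply: (dual_dims_regular ls _ _ _ (IHA _ _ rA)) => [q i|q i|q].
- by rewrite colI.
- exact: hf_ge0.
- exact/rational_fg/noeth_fg/nE.
Qed.

End DimensionOfDuals.

(** * Duals of complexes *)

Section HomComplexes.
Variables (K : fieldType) (n : nat).
Local Notation S := {mpoly K[n]}.
Local Notation gsq := (gsq K n).
Local Notation gcomplex := (gcomplex K n).

Section Cast.
Variable C : gcomplex.

(** A total transport, zero between different degrees, as suits families of maps indexed by all
    pairs of degrees. *)
Definition ccast (a b : int) (x : C a) : C b :=
  match a =P b with ReflectT e => eq_rect a (fun i => C i : Type) x b e | ReflectF _ => 0 end.

Lemma ccast_id a (x : C a) : ccast a x = x.
Proof. by rewrite /ccast; case: eqP => // e; rewrite (eq_irrelevance e erefl). Qed.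

Lemma ccast_ne a b (x : C a) : a != b -> ccast b x = 0.
Proof. by rewrite /ccast; case: eqP. Qed.

Lemma ccast_linear a b : linear (@ccast a b).
Proof.
move=> p x y; have [e|ne] := eqVneq a b; first by subst b; rewrite !ccast_id.
by rewrite !ccast_ne // scaler0 addr0.
Qed.

Lemma ccast_deg a b i (x : C a) : gdeg i x -> gdeg i (ccast b x).
Proof.
have [e|ne] := eqVneq a b; first by subst b; rewrite ccast_id.
by rewrite ccast_ne // => _; exact: gdeg0.
Qed.

Lemma ccast_cdiff a b q (x : C q) : ccast b (cdiff a x) = if a == b then cdiff b x else 0.
Proof. by case: eqVneq => [e|ne]; [subst b; rewrite ccast_id|rewrite ccast_ne]. Qed.

End Cast.

Variables M N : gcomplex.
Local Notation D := (hom_complex M N).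

Lemma hom_extend_zero p q k j (phi : M p -> N q) : q = p + k -> linear phi ->
  (forall i x, gdeg i x -> gdeg (i + j) (phi x)) ->
  exists f : D k, [/\ gdeg j f, forall x, f p q x = phi x &
    forall p' q' x, p' != p -> f p' q' x = 0].
Proof.
move=> qE lphi dphi.
pose F p' q' (x : M p') : N q' := ccast q' (phi (ccast p x)).
have hF : hom_homog k j F.
  split=> [p' q' a x y|p' q' x ne|p' q' a x hx]; rewrite /F.
  - by rewrite ccast_linear lphi ccast_linear.
  - have [e|pne] := eqVneq p' p.
      by subst p'; rewrite ccast_ne // qE eq_sym.
    by rewrite (ccast_ne _ pne) (lin0 lphi) (lin0 (@ccast_linear N _ _)).
  - by apply/ccast_deg/dphi/ccast_deg.
have hF' : is_hom k F.
  by exists 1%N, (fun=> j), (fun=> F); split=> // p' q' x; rewrite big_ord1.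
exists (Defs.Hom hF'); split=> // [x|p' q' x pne] /=; rewrite /F; first by rewrite !ccast_id.
by rewrite (ccast_ne _ pne) (lin0 lphi) (lin0 (@ccast_linear N _ _)).
Qed.

Definition kills k (V : subcx M) j (f : D k) :=
  gdeg j f /\ forall p q i x, V p i x -> f p q x = 0.

Lemma kills_gsubmod k V : gsubmod (fun j (f : D k) => kills V j f).
Proof.
split=> [j|j f g [f1 f2] [g1 g2]|j l a f ha [f1 f2]]; split.
- exact: gdeg0.
- by [].
- exact: gdegB.
- by move=> p q i x Vx /=; rewrite (f2 _ _ _ _ Vx) (g2 _ _ _ _ Vx) subr0.
- exact: gdegZ.
- by move=> p q i x Vx /=; rewrite (f2 _ _ _ _ Vx) scaler0.
Qed.

Lemma hom_cdiffE k r (f : D k) p q (x : M p) : r = k + 1 -> (cdiff r f : D r) p q x =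
  cdiff q (f p (q - 1) x) - (-1) ^+ absz k *: f (p + 1) q (cdiff (p + 1) x).
Proof. by move=> rk; rewrite /= rk eqxx. Qed.

(** The subcomplex Hom(M / V, N) of Hom(M, N). *)
Definition kill_subcx (V : subcx M) : subcx D.
Proof.
refine (@SubCx _ _ D (fun k j f => kills V j f) (fun k => kills_gsubmod k V) _).
move=> k r j f [f1 f2]; split; first exact: cdiff_deg.
move=> p q i x Vx; have [->|ne] := eqVneq r (k + 1); last by rewrite /= (negPf ne).
rewrite hom_cdiffE // (f2 _ _ _ _ Vx) cdiff0 (f2 _ _ i) ?scaler0 ?subr0 //.
exact: subcx_diff.
Defined.

Lemma kill_le (V W : subcx M) : subcx_le V W -> subcx_le (kill_subcx W) (kill_subcx V).
Proof. by move=> VW k j f [f1 f2]; split=> // p q i x /VW; exact: f2. Qed.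

(* [H^k] of [Hom(W / V, N)] when the [N q] are injective.                     *)
Definition homq V W (VW : subcx_le V W) k : gsq := rcoh (kill_le VW) k.

Hypothesis inj : forall q, gr_injective (N q).
Arguments inj : clear implicits.

Lemma sign_scale_eq0 k q (y : N q) : (-1) ^+ absz k *: y = 0 -> y = 0.
Proof.
by rewrite -signr_odd; case: odd; rewrite ?expr0 ?expr1 ?scale1r // scaleN1r => /eqP;
  rewrite oppr_eq0 => /eqP.
Qed.

Section CyclicStep.
Variables (V W : subcx M) (VW : subcx_le V W) (p t : int) (w : M p).
Hypotheses (Vdeg : forall q i x, V q i x -> gdeg i x) (Ww : W p t w) (wdeg : gdeg t w)
  (Wcyc : forall i x, W p i x -> exists2 c : S, ring_deg (i - t) (c : S^o) & V p i (x - c *: w))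
  (WV : forall q i x, q != p -> W q i x -> V q i x) (dw : forall r, V r t (cdiff r w)).

Local Notation I := (transporter (V p) t w).

Lemma transporter_kills k j (f : D k) q a : kills V j f -> I a -> a *: f p q w = 0.
Proof.
move=> [_ f2] Ia; have lf : linear (f p q) by exact: hom_linear.
rewrite -(linZ lf) (pihomog_partitionE (mf := mdeg) (leqnn (msize a))) scaler_suml (lin_sum lf).
by rewrite big1 // => l _; exact: f2 (Ia l).
Qed.

(** W / V is S / I in the single degree p, generated by w in degree t. Evaluation at w therefore
    identifies Hom(W / V, N) with the part of N killed by I; maps with prescribed value at w exist
    because N is injective. *)
Definition hom_ev k (f : D k) : N (p + k) := f p (p + k) w.

Lemma hom_ev_diff k r (g : D k) j q : r = k + 1 -> kills V j g ->
  (cdiff r g : D r) p q w = cdiff q (g p (q - 1) w).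
Proof. by move=> rk [_ g2]; rewrite hom_cdiffE // (g2 _ _ _ _ (dw _)) scaler0 subr0. Qed.

Lemma kills_deg k j (f : D k) q : kills V j f -> gdeg (j + t) (f p q w).
Proof. by case=> -[_ _ f3] _; rewrite addrC; exact: f3. Qed.

Lemma hom_ev_gmor k : @gmor _ _ (homq VW k) (extq N I (p + k)) t (@hom_ev k).
Proof.
have ev r j (f : D r) q : kills V j f -> ann_deg I (j + t) (f p q w).
  by move=> kf; split; [exact: kills_deg|move=> a; exact: transporter_kills kf].
split=> [a f g //|j f [f1 f2]|j f [g g1 [_ g2]]]; rewrite /hom_ev.
- split=> [|r]; first exact: ev.
  have [->|ne] := eqVneq r (p + k + 1); last by rewrite cdiff_shape.
  have [_ /(_ p (p + k + 1) t w Ww)] := f2 (k + 1).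
  by rewrite (hom_ev_diff _ _ f1) // addrK.
- have := g2 p (p + k) t w Ww.
  have -> : (f - cdiff k g : D k) p (p + k) w = f p (p + k) w - (cdiff k g : D k) p (p + k) w by [].
  rewrite (hom_ev_diff _ _ g1) ?subrK // => h; exists (g p (p + k - 1) w) => //.
  exact: ev.
Qed.

Lemma ev_extension q j (u : N q) : ann_deg I j u -> exists g : M p -> N q,
  [/\ linear g, forall i x, gdeg i x -> gdeg (i + (j - t)) (g x),
    forall i x, V p i x -> g x = 0 & g w = u].
Proof.
move=> [hu au].
have [||||||g [lg dg gV gE]] := @injective_extension K n (N q) (M p) S^o
    (fun i c => ring_deg i c) (V p) (fun c => (c : S) *: w) (fun c => (c : S) *: u) t j
    (inj q) (@ring_gsubmod K n) (subcx_gsubmod V p).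
- exact: Vdeg.
- by move=> b x y; rewrite scalerDl scalerA.
- by move=> b x y; rewrite scalerDl scalerA.
- by move=> i c hc; rewrite addrC; exact: (gsubmodZ (gmod_gsubmod (M p)) hc).
- by move=> i c hc; rewrite addrC; exact: (gsubmodZ (gmod_gsubmod (N q)) hc).
- move=> i c hc h; apply: au; apply/(transporterE _ _ (subcx_gsubmod V p) hc).
  by rewrite addrC.
exists g; split=> //; have := gE 0 (1 : S); rewrite !scale1r; apply; exact: dhomog1.
Qed.

Lemma hom_ev_lift k q j (u : N q) : q = p + k -> ann_deg I j u ->
  exists2 f : D k, kills V (j - t) f & f p q w = u.
Proof.
move=> qE /ev_extension[g [lg dg gV gw]].
have [f [fd fE fz]] := hom_extend_zero qE lg dg.
exists f; last by rewrite fE.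
split=> // p' q' i x Vx; have [e|ne] := eqVneq p' p; last exact: fz.
subst p'; have [->|qne] := eqVneq q' q; last by apply: hom_shape; rewrite -qE.
by rewrite fE; exact: gV Vx.
Qed.

Lemma kills_W k j (f : D k) : kills V j f -> f p (p + k) w = 0 -> kills W j f.
Proof.
move=> [f1 f2] fw; split=> // q q' i x Wx.
have [e|ne] := eqVneq q p; last exact: f2 (WV ne Wx).
subst q; have [->|qne] := eqVneq q' (p + k); last exact: hom_shape.
have [c _ /(f2 _ (p + k))] := Wcyc Wx.
have lf : linear (f p (p + k)) by exact: hom_linear.
by rewrite (linB lf) (linZ lf) fw scaler0 subr0.
Qed.

Lemma hom_ev_inj k j f : numer (homq VW k) j f -> denom (extq N I (p + k)) (j + t) (hom_ev f) ->
  denom (homq VW k) j f.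
Proof.
move=> [f1 f2] [u u1 /subr0_eq u2].
have [g g1 gu] := hom_ev_lift (k := k - 1) (esym (addrA _ _ _)) u1.
rewrite addrK in g1; exists g => //; apply: kills_W.
  apply: (scxB (X := kill_subcx V)) => //; exact: (subcx_diff (s := kill_subcx V)).
have -> : (f - cdiff k g : D k) p (p + k) w = f p (p + k) w - (cdiff k g : D k) p (p + k) w by [].
by rewrite (hom_ev_diff _ _ g1) ?subrK // gu -u2 subrr.
Qed.

Lemma hom_ev_surj k j u : numer (extq N I (p + k)) (j + t) u ->
  exists2 f, numer (homq VW k) j f & denom (extq N I (p + k)) (j + t) (u - hom_ev f).
Proof.
move=> [u1 u2]; have [f] := hom_ev_lift (erefl (p + k)) u1; rewrite addrK => f1 fu.
exists f; last by rewrite /hom_ev fu subrr; exact: denom0.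
split=> // r; have [rk|ne] := eqVneq r (k + 1); last first.
  by rewrite cdiff_shape //; exact: scx0.
subst r; apply: kills_W; first exact: (subcx_diff (s := kill_subcx V)).
rewrite (hom_ev_diff _ _ f1) //.
have -> : cdiff (p + (k + 1)) (f p (p + (k + 1) - 1) w) = cdiff (p + (k + 1)) (f p (p + k) w).
  by have -> : p + (k + 1) - 1 = p + k by rewrite addrA addrK.
rewrite fu; exact: u2.
Qed.

Lemma noeth_homq_cyclic k : noeth (extq N I (p + k)) -> noeth (homq VW k).
Proof. by apply: noeth_inj (hom_ev_gmor k) _; exact: hom_ev_inj. Qed.

Lemma hf_homq_cyclic k : noeth (extq N I (p + k)) ->
  forall i, hf (homq VW k) i = hf (extq N I (p + k)) (i + t).
Proof.
move=> nE; have fd := noeth_fin_dim (noeth_homq_cyclic nE).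
exact: (fin_dim_iso (hom_ev_gmor k) (@hom_ev_inj k) (@hom_ev_surj k) fd).2.
Qed.

End CyclicStep.

(* If [W / V] is a complex with two terms [W p / V p] and                     *)
(* [W (p + 1) / V (p + 1)] that is acyclic, then so is its dual.              *)
Lemma homq_acyclic V W (VW : subcx_le V W) p :
  (forall q i x, W q i x -> gdeg i x) ->
  (forall q i x, q != p -> q != p + 1 -> W q i x -> V q i x) ->
  (forall i x, W (p + 1) i x -> exists2 z, W p i z & V (p + 1) i (x - cdiff (p + 1) z)) ->
  (forall i z, W p i z -> V (p + 1) i (cdiff (p + 1) z) -> V p i z) ->
  forall k j f, numer (homq VW k) j f -> denom (homq VW k) j f.
Proof.
move=> Wdeg WV W1 W0 k j f [f1 f2].
have fd q q' i x : gdeg i x -> gdeg (i + j) (f q q' x).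
  by case: f1 => -[_ _ h] _; exact: h.
(* [g] sends the differential of z to f z up to sign, which makes f minus the differential of g'
   vanish on [W p]. On [W (p + 1)] it then vanishes by the cocycle condition. *)
have [||||||g [lg dg gV gE]] := @injective_extension K n (N (p + k)) (M (p + 1)) (M p)
    (W p) (V (p + 1)) (@cdiff K n M p (p + 1)) (fun z => (-1) ^+ absz k *: f p (p + k) z) 0 j
    (inj (p + k)) (subcx_gsubmod W p) (subcx_gsubmod V (p + 1)).
- by move=> i x /VW /Wdeg.
- exact: cdiffL.
- by move=> a x y; rewrite (@hom_linear _ _ _ _ _ f) scalerDr !scalerA mulrC.
- by move=> i z /Wdeg; rewrite addr0; exact: cdiff_deg.
- move=> i z /Wdeg /(fd _ (p + k)) h; rewrite -signr_odd.
  by case: odd; rewrite ?expr0 ?expr1 ?scale1r // scaleN1r; exact: gdegN.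
- move=> i z; rewrite addr0 => Wz /(W0 _ _ Wz) Vz.
  by case: f1 => _ /(_ _ _ _ _ Vz) ->; rewrite scaler0.
have qE : p + k = p + 1 + (k - 1) by lia.
have [g' [g'd g'E g'z]] := hom_extend_zero qE lg dg; rewrite subr0 in g'd.
have kE : k = k - 1 + 1 by rewrite subrK.
have kg' : kills V j g'.
  split=> // q q' i x Vx; have [e|ne] := eqVneq q (p + 1); last exact: g'z.
  subst q; have [->|qne] := eqVneq q' (p + k); last by apply: hom_shape; rewrite -qE.
  by rewrite g'E; exact: gV Vx.
exists g' => //.
pose h : D k := f - cdiff k g'.
have kh : kills V j h.
  by apply: (scxB (X := kill_subcx V)) => //; exact: (subcx_diff (s := kill_subcx V)).
have hE q q' (x : M q) : h q q' x = f q q' x - (cdiff k g' : D k) q q' x by [].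
have hp i z q' : W p i z -> h p q' z = 0.
  move=> Wz; have [->|qne] := eqVneq q' (p + k); last exact: hom_shape.
  rewrite hE hom_cdiffE // (g'z p); last by rewrite -subr_eq0 opprD addrA subrr sub0r oppr_eq0 oner_eq0.
  rewrite cdiff0 sub0r opprK g'E (gE _ _ Wz) scalerA.
  by have := sign_succ K n (k - 1); rewrite subrK => ->; rewrite mulrN -expr2 sqrr_sign scaleN1r subrr.
split; first by case: kh.
move=> q q' i x Wx; have [e|ne] := eqVneq q p; first by subst q; exact: hp Wx.
have [e|ne1] := eqVneq q (p + 1); last by case: kh => _; apply; exact: (WV _ _ _ ne ne1 Wx).
subst q; have [z Wz Vxz] := W1 _ _ Wx.
have lh : linear (h (p + 1) q') by exact: hom_linear.
case: kh => _ /(_ _ q' _ _ Vxz); rewrite (linB lh) => /subr0_eq ->.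
have [_ /(_ p q' i z Wz)] := f2 (k + 1).
have -> : (cdiff (k + 1) f : D (k + 1)) = cdiff (k + 1) h.
  by rewrite /h cdiffB cdiffK subr0.
rewrite hom_cdiffE // (hp _ _ _ Wz) cdiff0 sub0r => /eqP; rewrite oppr_eq0 => /eqP.
exact: sign_scale_eq0.
Qed.

End HomComplexes.

(** * Multiplicities and cohomology modules *)

Section Multiplicity.

(** Each factor 1 - t is absorbed by [delta]. In order 0 the polynomial collects the finitely many
    values of [h], whose sum telescopes to the final value of g. *)
Lemma rat_poly d (h : int -> int) e m : (forall i, i < m -> h i = 0) -> rat d h e ->
  exists2 q : {poly int}, (forall k : nat,
    \sum_(l < k.+1) ((1 - 'X) ^+ d)`_l * h (m + k%:Z - l%:Z) = q`_k) & e = q.[1].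
Proof.
elim: d h => [|d IH] h hm.
  move=> [g [bg [N hN]] gh].
  have gm i : i < m -> g i = 0.
    have [m' hm'] := bg => im; have [|mi] := ltP i m'; first exact: hm'.
    move: i mi im; apply: int_ge_ind => [|i mi IHi] im.
      by have := gh m'; rewrite /delta [g (_ - 1)]hm' ?hm //; lia.
    by have := gh (i + 1); rewrite /delta addrK hm // IHi; lia.
  pose B := absz (N - m)%R.
  exists (\poly_(k < B.+1) h (m + k%:Z)) => [k|].
    rewrite big_ord_recl expr0 coef1 mul1r subr0 big1 ?addr0 => [|l _]; last by rewrite coef1 mul0r.
    rewrite coef_poly; case: ltnP => // Bk.
    by rewrite -gh /delta !hN ?subrr //; lia.
  rewrite horner_poly; under eq_bigr do rewrite expr1n mulr1.
  rewrite -(hN (m + B%:Z)); last by lia.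
  elim: B => [|B IHB].
    by rewrite big_ord1 addr0 -gh /delta [g (m - 1)]gm ?subr0 //; lia.
  rewrite big_ord_recr /= -IHB -gh /delta.
  have -> : m + B.+1%:Z - 1 = m + B%:Z by lia.
  by rewrite addrC subrK.
move=> [_ /IH[|q qE ->]].
  by move=> i im; rewrite /delta !hm ?subrr //; lia.
exists q => // k; rewrite -qE /delta.
under [RHS]eq_bigr do rewrite mulrBr.
rewrite sumrB [X in _ = _ - X]big_ord_recr /= [h (_ - _ - 1)]hm; last by lia.
rewrite mulr0 addr0 exprSr mulrBr mulr1.
under eq_bigr => l _ do rewrite coefB mulrBl coefMX.
rewrite sumrB; congr (_ - _); rewrite big_ord_recl /= mul0r add0r.
by apply: eq_bigr => l _; congr (_ * h _); rewrite /bump /=; lia.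
Qed.

Variables (K : fieldType) (n : nat).
Local Notation gmod := (gmod K n).

Lemma piece_dim_hf (N : gmod) i : fin_dim (gq N) -> piece_dim N i (absz (hf (gq N) i)).
Proof.
move=> fd; have [b [hb sb fb]] := hf_hasdim i fd; exists b; split=> // x /sb[c /subr0_eq xE].
exists (\row_k c k); split.
  by rewrite xE; apply: eq_bigr => k _; rewrite mxE.
move=> c' xE'; apply/rowP => k; rewrite mxE; apply/eqP; rewrite -subr_eq0; apply/eqP.
apply: (fb (fun k => c k - c' 0 k)) => /=.
under eq_bigr do rewrite mpolyCB scalerBl.
by rewrite sumrB -xE -xE' subrr.
Qed.

Lemma has_multiplicity_rat (N : gmod) d e : fg (gq N) -> rat d (hf (gq N)) e -> 0 < e ->
  has_multiplicity N e.
Proof.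
move=> fN rN e0; have [m hm] := rat_bounded_left rN.
have [q qE eE] := rat_poly hm rN.
exists d, (fun i => absz (hf (gq N) i)), m, q; split=> //.
- exact: kdim_rat rN e0.
- by move=> i; apply: piece_dim_hf; exact: fg_fin_dim.
- by move=> i /hm ->.
Qed.

End Multiplicity.

Section CohomologyModules.
Local Open Scope quotient_scope.
Variables (K : fieldType) (n : nat).
Local Notation S := {mpoly K[n]}.
Local Notation gsq := (gsq K n).
Local Notation gmod := (gmod K n).
Local Notation pih := (pihomog mdeg).

Lemma homogeneous_generators (N : gmod) m (g : 'I_m -> N) :
  exists M (e : 'I_M -> int) (h : 'I_M -> N), (forall l, gdeg (e l) (h l)) /\
    forall k, exists c : 'I_M -> S, g k = \sum_(l < M) c l *: h l.
Proof.
elim: m g => [|m IH] g.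
  by exists 0%N, (fun=> 0), (fun=> 0); split; case.
have [M [e [h [hh gh]]]] := IH (fun k => g (widen_ord (leqnSn m) k)).
have [M' [e' [h' [hh' gE]]]] := gdec (g ord_max).
exists (M + M')%N, (fun k => match split k with inl k => e k | inr k => e' k end),
  (fun k => match split k with inl k => h k | inr k => h' k end); split=> [l|k].
  by case: split.
have [kE|] := eqVneq k ord_max.
  exists (fun l => match split l with inl _ => 0 | inr _ => 1 end).
  rewrite sum_split_ord big1 => [|l _]; last by rewrite !split_lshift scale0r.
  by rewrite add0r kE gE; apply: eq_bigr => l _; rewrite !split_rshift scale1r.
rewrite -val_eqE /= => kne.
have km : (k < m)%N by have := ltn_ord k; lia.
have [c cE] := gh (Ordinal km).
exists (fun l => match split l with inl l => c l | inr _ => 0 end).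
rewrite sum_split_ord [X in _ + X]big1 => [|l _]; last by rewrite !split_rshift scale0r.
rewrite addr0; have -> : k = widen_ord (leqnSn m) (Ordinal km) by exact: val_inj.
by rewrite cE; apply: eq_bigr => l _; rewrite !split_lshift.
Qed.

Lemma sum_pihz (A : lmodType S) (a : S) (x : A) i s B : (msize a <= B)%N ->
  \sum_(k < B | s + k%:Z == i) pih k a *: x = pihz (i - s) a *: x.
Proof.
move=> aB; have [[d dE]|nB] := pselect (exists d : 'I_B, i - s = d%:Z).
  rewrite (bigD1 d) /=; last by rewrite -dE addrC subrK.
  rewrite big1 ?addr0 ?dE // => d' /andP[/eqP h1 /eqP h2].
  by case: h2; apply: val_inj => /=; lia.
rewrite big1 => [|d /eqP h1]; last by case: nB; exists d; lia.
case E : (i - s) => [j|j] /=; last by rewrite scale0r.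
rewrite pih_msize ?scale0r // leqNgt; apply/negP => jb; apply: nB.
by exists (Ordinal (leq_trans jb aB)).
Qed.

(** Generators are replaced by their homogeneous components, and the coefficients of a homogeneous x
    by their components of the matching degree. *)
Lemma fin_gen_fg (N : gmod) : fin_gen N -> fg (gq N).
Proof.
move=> [m [g gE]]; have [M [e [h [hh gh]]]] := homogeneous_generators g.
exists M, e, h; split=> // i x hx.
have [b xE] : exists b : 'I_M -> S, x = \sum_(l < M) b l *: h l.
  have [c ->] := gE x; have /choice[C hC] := gh.
  exists (fun l => \sum_(k < m) c k * C k l).
  under [RHS]eq_bigr do rewrite scaler_suml.
  rewrite exchange_big; apply: eq_bigr => k _ /=.
  by rewrite {1}hC scaler_sumr; apply: eq_bigr => l _; rewrite scalerA.
pose B := (\sum_(l < M) msize (b l))%N.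
have Bl l : (msize (b l) <= B)%N by rewrite /B (bigD1 l) //= leq_addr.
exists (fun l => pihz (i - e l) (b l)); split=> [l|]; first exact: pihz_deg.
pose y (t : 'I_M * 'I_B) := pih t.2 (b t.1) *: h t.1.
have xE' : x = \sum_t y t.
  rewrite -(pair_bigA _ (fun l d => y (l, d))) xE /=; apply: eq_bigr => l _.
  by rewrite {1}(pihomog_partitionE (mf := mdeg) (Bl l)) scaler_suml.
have hy (t : 'I_M * 'I_B) : gdeg (e t.1 + t.2%:Z) (y t) by apply: gdegZ => //; exact: pihomogP.
apply/eqP; rewrite subr_eq0; apply/eqP; rewrite [LHS](gdeg_component hx hy xE').
rewrite -(pair_big_dep xpredT (fun l (d : 'I_B) => e l + d%:Z == i) (fun l d => y (l, d))) /=.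
by apply: eq_bigr => l _; rewrite -(sum_pihz _ _ _ (Bl l)).
Qed.

Variable C : gcomplex K n.

Definition hco q : gsq := rcoh (@zero_subcx_le _ _ C (full_subcx C)) q.

Variable q : int.

Lemma homogeneous_coboundary i z (x : C (q - 1)) : gdeg i z -> z = cdiff q x ->
  exists2 v : C (q - 1), gdeg i v & z = cdiff q v.
Proof.
move=> hz zE; have [m [e [y [hy xE]]]] := gdec x.
exists (\sum_(k < m | e k == i) y k); first by apply: gdeg_sum => k /eqP <-.
rewrite (lin_sum (@cdiffL _ _ C _ _)); apply: (gdeg_component hz).
  by move=> k; exact: cdiff_deg.
by rewrite zE xE (lin_sum (@cdiffL _ _ C _ _)).
Qed.

Definition cocZ i (z : cocycle C q) := gdeg i (val z).
Definition cobZ i (z : cocycle C q) := exists2 v : C (q - 1), gdeg i v & val z = cdiff q v.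

Lemma cocZ_gsubmod : gsubmod cocZ.
Proof.
split=> [i|i x y|i k p x hp]; rewrite /cocZ; [exact: gdeg0|exact: gdegB|exact: gdegZ].
Qed.

Lemma cobZ_gsubmod : gsubmod cobZ.
Proof.
split=> [i|i x y [u hu xE] [v hv yE]|i k p x hp [u hu xE]].
- by exists 0; [exact: gdeg0|rewrite cdiff0].
- by exists (u - v); [exact: gdegB|rewrite cdiffB -xE -yE].
- by exists (p *: u); [exact: gdegZ|rewrite cdiffZ -xE].
Qed.

Lemma cobZ_cocZ i z : cobZ i z -> cocZ i z.
Proof. by move=> [v hv zE]; rewrite /cocZ zE; exact: cdiff_deg. Qed.

(** Mediates between [hco], a subquotient of [C q], and [cohomology], a quotient of the type of
    cocycles: it maps isomorphically to both. *)
Definition cocq : gsq := Gsq cocZ_gsubmod cobZ_gsubmod cobZ_cocZ.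

Definition coc_val (z : amb cocq) : C q := val (z : cocycle C q).

Lemma coc_val_gmor : @gmor _ _ cocq (hco q) 0 coc_val.
Proof.
apply: gmor0 => // i z; rewrite /coc_val.
  move=> hz; split=> // r; have [->|ne] := eqVneq r (q + 1); last by rewrite cdiff_shape.
  by case: z {hz} => z /= /eqP.
by move=> [v hv zE]; exists v; rewrite //= zE subrr.
Qed.

Lemma coc_val_inj i z : numer cocq i z -> denom (hco q) (i + 0) (coc_val z) -> denom cocq i z.
Proof. by rewrite addr0 => hz [v hv /subr0_eq zE]; exists v. Qed.

Lemma coc_val_surj i z : numer (hco q) (i + 0) z ->
  exists2 x, numer cocq i x & denom (hco q) (i + 0) (z - coc_val x).
Proof.
rewrite addr0 => -[hz dz].
have cz : z \in @cocycles K n C q by rewrite inE; apply/eqP; exact: dz.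
by exists (Cocycle cz) => //; rewrite subrr; exact: denom0.
Qed.

Definition coc_pi (z : amb cocq) : cohomology C q := \pi_(coh_car C q) (z : cocycle C q).

Lemma coc_pi_gmor : @gmor _ _ cocq (gq (cohomology C q)) 0 coc_pi.
Proof.
apply: gmor0 => [a x y|i z hz|i z [v hv zE]] /=; rewrite /coc_pi.
- by rewrite raddfD /=; congr (_ + _); rewrite -[LHS]coh_scaleE.
- by exists z.
- apply/eqP; rewrite -(raddf0 \pi_(coh_car C q)) coh_piE subr0; apply/asboolP.
  by exists v.
Qed.

Lemma coc_pi_inj i z : numer cocq i z -> denom (gq (cohomology C q)) (i + 0) (coc_pi z) ->
  denom cocq i z.
Proof.
move=> hz /= /eqP; rewrite /coc_pi -(raddf0 \pi_(coh_car C q)) coh_piE subr0 => /asboolP[x zE].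
have [v hv vE] := homogeneous_coboundary hz zE; by exists v.
Qed.

Lemma coc_pi_surj i u : numer (gq (cohomology C q)) (i + 0) u ->
  exists2 x, numer cocq i x & denom (gq (cohomology C q)) (i + 0) (u - coc_pi x).
Proof. by rewrite addr0 => -[z hz ->]; exists z => //=; rewrite subrr. Qed.

Lemma noeth_cohomology : noeth (hco q) <-> noeth (gq (cohomology C q)).
Proof.
split=> nh.
  have nc : noeth cocq by apply: (noeth_inj coc_val_gmor) nh => i y; exact: coc_val_inj.
  apply: (noeth_surj coc_pi_gmor _ nc) => i y hy.
  have := @coc_pi_surj i y; rewrite !addr0 => /(_ hy)[x hx Bx].
  by exists x; rewrite ?subr0.
have nc : noeth cocq by apply: (noeth_inj coc_pi_gmor) nh => i y; exact: coc_pi_inj.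
apply: (noeth_surj coc_val_gmor _ nc) => i y hy.
have := @coc_val_surj i y; rewrite !addr0 => /(_ hy)[x hx Bx].
by exists x; rewrite ?subr0.
Qed.

Lemma hf_cohomology : noeth (hco q) -> hf (gq (cohomology C q)) =1 hf (hco q).
Proof.
move=> nh i; have nc : noeth cocq by apply: (noeth_inj coc_val_gmor) nh => j y; exact: coc_val_inj.
have h1 := (fin_dim_iso coc_val_gmor coc_val_inj coc_val_surj (noeth_fin_dim nc)).2 i.
have h2 := (fin_dim_iso coc_pi_gmor coc_pi_inj coc_pi_surj (noeth_fin_dim nc)).2 i.
by rewrite addr0 in h1; rewrite addr0 in h2; rewrite -h1 -h2.
Qed.

End CohomologyModules.

(** * Truncations and the dual of a complex *)

Section Filtration.
Variables (K : fieldType) (n : nat).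
Local Notation S := {mpoly K[n]}.
Local Notation gsq := (gsq K n).
Variables M N : gcomplex K n.
Local Notation D := (hom_complex M N).

Section Truncation.
Variables (p : int) (U : int -> M p -> Prop).
Hypotheses (gU : gsubmod U) (BU : forall i x, denom (hco M p) i x -> U i x)
  (UZ : forall i x, U i x -> numer (hco M p) i x).

Definition trunc_deg q i (x : M q) := [/\ gdeg i x, p < q -> x = 0 & U i (ccast p x)].

Lemma trunc_gsubmod q : gsubmod (trunc_deg (q := q)).
Proof.
have [U0 UB UM] := gU; have lc := @ccast_linear _ _ M q p.
split=> [i|i x y [x1 x2 x3] [y1 y2 y3]|i k a x ha [x1 x2 x3]]; split.
- exact: gdeg0.
- by [].
- by rewrite (lin0 lc); exact: U0.
- exact: gdegB.
- by move=> pq; rewrite x2 // y2 // subr0.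
- by rewrite (linB lc); exact: UB.
- exact: gdegZ.
- by move=> pq; rewrite x2 // scaler0.
- by rewrite (linZ lc); exact: UM.
Qed.

Lemma trunc_numer i x : U i x -> gdeg i x /\ forall r, cdiff r x = 0.
Proof. by move=> /UZ. Qed.

(* The truncation [... -> M (p - 1) -> U -> 0].                               *)
Definition trunc : subcx M.
Proof.
refine (@SubCx _ _ M trunc_deg trunc_gsubmod _).
move=> q r i x [x1 x2 x3]; have [U0 _ _] := gU.
have z0 : trunc_deg i (0 : M r).
  by split=> //; [exact: gdeg0|rewrite (lin0 (@ccast_linear _ _ M r p)); exact: U0].
have [rq|ne] := eqVneq r (q + 1); last by rewrite cdiff_shape.
have [pq|qp] := ltP p q; first by rewrite x2 // cdiff0.
have [e|ne] := eqVneq q p.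
  subst q; rewrite ccast_id in x3.
  by have [_ ->] := trunc_numer x3.
split; first exact: cdiff_deg.
  by lia.
rewrite ccast_cdiff; case: eqP => [e|_]; last exact: U0.
apply: BU; apply: (@rcobound_intro _ _ _ _ _ p i _ q x); first exact: x1.
by rewrite subrr.
Defined.

Lemma trunc_lt q i x : q < p -> gdeg i x -> trunc q i x.
Proof.
move=> qp hx; split=> //; first by lia.
by rewrite ccast_ne; [case: gU|lia].
Qed.

Lemma trunc_eq i x : trunc p i x <-> U i x.
Proof.
split=> [[_ _]|Ux]; first by rewrite ccast_id.
by split; rewrite ?ltxx ?ccast_id //; case: (trunc_numer Ux).
Qed.

Lemma trunc_gt q i x : p < q -> trunc q i x -> x = 0.
Proof. by move=> pq [_ + _]; apply. Qed.

Lemma trunc_gdeg q i x : trunc q i x -> gdeg i x.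
Proof. by case. Qed.

End Truncation.

Lemma trunc_le p U U' gU BU UZ gU' BU' UZ' : (forall i x, U i x -> U' i x) ->
  subcx_le (@trunc p U gU BU UZ) (@trunc p U' gU' BU' UZ').
Proof. by move=> UU q i x [x1 x2 x3]; split=> //; exact: UU. Qed.

(** The step from one truncation to the next is split in two: Btrunc (p + 1) / Ztrunc p is acyclic,
    and Ztrunc (p + 1) / Btrunc (p + 1) is H^(p + 1)(M) in a single degree. *)
Definition Ztrunc p := trunc (numerP (hco M p)) (@denom_numer _ _ (hco M p)) (fun _ _ h => h).
Definition Btrunc p := trunc (denomP (hco M p)) (fun _ _ h => h) (@denom_numer _ _ (hco M p)).

Lemma ZBtrunc_le p : subcx_le (Ztrunc p) (Btrunc (p + 1)).
Proof.
move=> q i x hx; have [qp|pq] := leP q p.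
  by apply: trunc_lt; [lia|exact: trunc_gdeg hx].
by rewrite (trunc_gt pq hx); exact: scx0.
Qed.

Lemma BZtrunc_le p : subcx_le (Btrunc p) (Ztrunc p).
Proof. by apply: trunc_le => i x; exact: denom_numer. Qed.

Lemma ZZtrunc_le p : subcx_le (Ztrunc p) (Ztrunc (p + 1)).
Proof. by move=> q i x /ZBtrunc_le /BZtrunc_le. Qed.

Hypotheses (inj : forall q, gr_injective (N q)) (bN : bounded_below N).
Hypothesis conc : concentrated N (fun p => p = 0) (- n%:Z).
Arguments inj : clear implicits.

Let nE I q : hideal I -> noeth (extq N I q).
Proof. exact: (noeth_extq inj bN (noeth_concentrated conc)). Qed.

Lemma ZBtrunc_acyclic p k i f : numer (homq N (@ZBtrunc_le p) k) i f ->
  denom (homq N (@ZBtrunc_le p) k) i f.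
Proof.
apply: (homq_acyclic inj (p := p)).
- by move=> q j x; exact: trunc_gdeg.
- move=> q j x qp qp1 hx; have [lt|le] := ltP q p.
    by apply: trunc_lt => //; exact: trunc_gdeg hx.
  by rewrite (@trunc_gt _ _ _ _ _ _ _ _ _ hx); [exact: scx0|lia].
- move=> j x /trunc_eq/(rcobound_elim (erefl (p + 1)))[v v1 /subr0_eq ->].
  exists v; first by apply: trunc_lt; [lia|exact: v1].
  by rewrite subrr; exact: scx0.
- move=> j z hz dz; apply/trunc_eq; split; first exact: trunc_gdeg hz.
  move=> r; have [->|ne] := eqVneq r (p + 1); last by rewrite cdiff_shape.
  by apply: (trunc_gt _ dz); lia.
Qed.

Lemma les_shift a b c s : les a b c -> les (fun q => a (q + s)) (fun q => b (q + s))
  (fun q => c (q + s)).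
Proof.
move=> [f [g [d [nn ra bE cE aE]]]].
exists (fun q => f (q + s)), (fun q => g (q + s)), (fun q => d (q + s)); split=> // q i.
by have -> : q + 1 + s = q + s + 1 by lia.
Qed.

Lemma homq_trivial (V W : subcx M) (VW : subcx_le V W) : subcx_le W V ->
  forall k i f, numer (homq N VW k) i f -> denom (homq N VW k) i f.
Proof.
move=> WV k i f [f1 _]; exists 0; first exact: scx0.
by rewrite cdiff0 subr0; exact: kill_le f1.
Qed.

(* Induction along a filtration of [Z / U] with cyclic quotients, where [Z]   *)
(* denotes the cocycles.                                                      *)
Lemma homq_cocycles p m : forall U gU BU UZ (e : 'I_m -> int) (g : 'I_m -> M p),
  (forall l, numer (hco M p) (e l) (g l)) ->
  (forall i x, numer (hco M p) i x -> span_deg U e g i x) ->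
  forall VW : subcx_le (@trunc p U gU BU UZ) (Ztrunc p),
  (forall k, noeth (homq N VW k)) /\
  forall d e', rat d (hf (@quoq _ _ (hco M p) U gU UZ)) e' ->
    dual_dims (fun q => hf (homq N VW (q - p))) d e'.
Proof.
elim: m => [|m IH] U gU BU UZ e g hg sg VW.
  have ZU i x : numer (hco M p) i x -> U i x by move=> /sg[c [_]]; rewrite big_ord0 subr0.
  have z := @homq_trivial _ _ VW (trunc_le _ _ _ ZU).
  split=> [k|d e' r]; first by apply: noeth_zero => i f; exact: z.
  have -> : e' = 0.
    apply: rat_zero_uniq r => i; apply/hf0P => [|x /= /ZU //].
    by apply/noeth_fin_dim/noeth_zero => j x /= /ZU.
  apply: dual_dims0 => q i; apply/hf0P => [|f]; last exact: z.
  by apply/noeth_fin_dim/noeth_zero => j f; exact: z.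
pose s := e ord_max; pose w := g ord_max.
pose U' := span_deg U (fun _ : 'I_1 => s) (fun _ : 'I_1 => w).
have U'E i x : U' i x -> exists2 c : S, ring_deg (i - s) (c : S^o) & U i (x - c *: w).
  by move=> [c [hc]]; rewrite big_ord1 => Ux; exists (c ord0).
have U'I i x (c : S) : ring_deg (i - s) (c : S^o) -> U i (x - c *: w) -> U' i x.
  by move=> hc Ux; exists (fun=> c); rewrite big_ord1.
have gU' : gsubmod U' by exact: span_gsubmod.
have UU' i x : U i x -> U' i x by exact: denom_span.
have U'Z i x : U' i x -> numer (hco M p) i x.
  move=> /U'E[c hc /UZ hx]; rewrite -(subrK (c *: w) x).
  apply: (subspD (numer_sub (hco M p) i)) => //.
  have := gsubmodZ (numerP (hco M p)) hc (hg ord_max); congr (numer (hco M p) _ _).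
  by rewrite -/s addrC subrK.
have BU' i x : denom (hco M p) i x -> U' i x by move=> /BU /UU'.
have UU'le : subcx_le (trunc gU BU UZ) (trunc gU' BU' U'Z) by exact: trunc_le.
have U'Zle : subcx_le (trunc gU' BU' U'Z) (Ztrunc p) by exact: trunc_le.
have [|nY dY] := IH U' gU' BU' U'Z (fun l => e (widen_ord (leqnSn m) l))
    (fun l => g (widen_ord (leqnSn m) l)) (fun l => hg _) _ U'Zle.
  move=> i x /sg[c [hc]]; rewrite big_ord_recr opprD addrA => Ux.
  by exists (fun l => c (widen_ord (leqnSn m) l)); split=> [l|]; [exact: hc|exact: (U'I _ _ _ (hc ord_max) Ux)].
have VpE i x : trunc gU BU UZ p i x <-> U i x by exact: trunc_eq.
have Vp : trunc gU BU UZ p = U.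
  by apply/funext => i; apply/funext => x; apply/propext; exact: VpE.
have [hw dw] := hg ord_max.
have Uw : U' s w by apply: (U'I _ _ 1); rewrite ?subrr ?scale1r ?subrr; [exact: dhomog1|have [] := gU].
pose I := transporter (trunc gU BU UZ p) s w.
have hI : hideal I by exact: hideal_transporter (subcx_gsubmod _ _).
have [cy1 cy2] : (forall k, noeth (homq N UU'le k)) /\
    forall k i, hf (homq N UU'le k) i = hf (extq N I (p + k)) (i + s).
  have Wcyc i x : trunc gU' BU' U'Z p i x ->
      exists2 c : S, ring_deg (i - s) (c : S^o) & trunc gU BU UZ p i (x - c *: w).
    by move=> /trunc_eq/U'E[c hc Uc]; exists c => //; apply/VpE.
  have WV q i x : q != p -> trunc gU' BU' U'Z q i x -> trunc gU BU UZ q i x.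
    by move=> ne [x1 x2 _]; split=> //; rewrite ccast_ne //; have [] := gU.
  have dw' r : trunc gU BU UZ r s (cdiff r w) by rewrite dw; exact: scx0.
  have Vd q i x : trunc gU BU UZ q i x -> gdeg i x by exact: trunc_gdeg.
  have Ww : trunc gU' BU' U'Z p s w by apply/trunc_eq.
  split=> [k|k i]; first exact: (noeth_homq_cyclic inj UU'le Vd Ww hw Wcyc WV dw' (nE _ hI)).
  exact: (hf_homq_cyclic inj UU'le Vd Ww hw Wcyc WV dw' (nE _ hI)).
have nX k : noeth (homq N VW k).
  exact: noeth_les (nY k) (cy1 k).
split=> // d e' r.
have ls := les_shift (- p) (les_rcoh (kill_le VW) nY cy1).
pose Q := @quoq _ _ (@subq _ _ (hco M p) U' gU' BU') U gU UU'.
have cycQ i x : numer Q i x -> exists2 c : S, ring_deg (i - s) (c : S^o) & denom Q i (x - c *: w).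
  exact: U'E.
have IE : annid s w (X := Q) = I by rewrite /I Vp.
have fX : fg (@quoq _ _ (hco M p) U gU UZ) by exists m.+1, e, g.
have nXZ := fg_noeth fX.
have E i : hf (@quoq _ _ (hco M p) U gU UZ) i = hf Q i + hf (@quoq _ _ (hco M p) U' gU' U'Z) i.
  exact: (@hf_subquo _ _ (@quoq _ _ (hco M p) U gU UZ) U' gU' UU' U'Z i (noeth_fin_dim nXZ)).
have nQ : noeth Q by exact: (@noeth_cyc _ _ Q s w Uw cycQ).
have nZU' : noeth (@quoq _ _ (hco M p) U' gU' U'Z).
  exact: (@noeth_quo _ _ (@quoq _ _ (hco M p) U gU UZ) U' gU' UU' U'Z nXZ).
have [e1 [e2 [r1 r2 ->]]] := rat_split E (fun=> hf_ge0 _ _) (fun=> hf_ge0 _ _)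
  (rational_fg (noeth_fg nQ)) (rational_fg (noeth_fg nZU')) r.
rewrite addrC; apply: (dual_dims_ext ls (dY _ _ r2)).
have rI : rat d (hf (idq hI)) e1.
  apply: eq_rat (rat_shift s r1) => i; rewrite -(@hf_cyc _ _ Q s w Uw cycQ).
  by apply: eq_hf_idq; rewrite IE.
have := dual_dims_shift s (dual_dims_extq inj bN conc rI).
congr (dual_dims _ _ _); apply/funext => q; apply/funext => i.
by rewrite cy2; have -> : p + (q - p) = q by lia.
Qed.

Lemma homq_step p : fg (hco M (p + 1)) -> (forall k, noeth (homq N (@ZZtrunc_le p) k)) /\
  forall d e, rat d (hf (hco M (p + 1))) e ->
    dual_dims (fun q => hf (homq N (@ZZtrunc_le p) (q - (p + 1)))) d e.
Proof.
move=> [m [e [g [hg sg]]]].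
have [nA dA] := homq_cocycles hg sg (@BZtrunc_le (p + 1)).
have nC k : noeth (homq N (@ZBtrunc_le p) k).
  by apply: noeth_zero => i f; exact: ZBtrunc_acyclic.
split=> [k|d e' r].
  exact: noeth_les (nA k) (nC k).
have ls := les_shift (- (p + 1)) (les_rcoh (kill_le (@ZZtrunc_le p)) nA nC).
rewrite -[e']addr0; apply: (dual_dims_ext ls (dA _ _ r)).
apply: dual_dims0 => q i; apply/hf0P => [|f]; last exact: ZBtrunc_acyclic.
exact/noeth_fin_dim/nC.
Qed.

Lemma zero_trunc_le p : subcx_le (zero_subcx M) (Ztrunc p).
Proof. exact: zero_subcx_le. Qed.

Lemma tower_les : (forall p, fg (hco M p)) -> bounded_complex M ->
  (forall p k, noeth (homq N (@zero_trunc_le p) k)) /\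
  forall p, les (fun k => hf (homq N (@ZZtrunc_le p) k))
    (fun k => hf (homq N (@zero_trunc_le (p + 1)) k)) (fun k => hf (homq N (@zero_trunc_le p) k)).
Proof.
move=> fM [a [b hab]].
have nY p k : noeth (homq N (@zero_trunc_le p) k).
  have low p' k' : p' < a -> noeth (homq N (@zero_trunc_le p') k').
    move=> pa; apply: noeth_zero; apply: homq_trivial => q i x hx /=.
    have [qp|pq] := leP q p'; last exact: trunc_gt hx.
    by apply: hab; left; lia.
  have [pa|ap] := ltP p a; first exact: low.
  suff H : forall p, a - 1 <= p -> forall k, noeth (homq N (@zero_trunc_le p) k) by apply: H; lia.
  apply: int_ge_ind => [k'|p' _ IH k']; first by apply: low; lia.
  exact: noeth_les ((homq_step (fM (p' + 1))).1 k') (IH k').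
split=> // p.
exact: (les_rcoh (kill_le (@zero_trunc_le (p + 1))) (homq_step (fM (p + 1))).1 (nY p)).
Qed.

Lemma homq_low p k i : (forall q, q <= p -> forall x : M q, x = 0) ->
  (forall k, noeth (homq N (@zero_trunc_le p) k)) -> hf (homq N (@zero_trunc_le p) k) i = 0.
Proof.
move=> z nY; apply/hf0P; first exact: noeth_fin_dim.
apply: homq_trivial => q j x hx /=.
by have [qp|pq] := leP q p; [exact: z|exact: trunc_gt hx].
Qed.

(** If M vanishes from degree p on, the truncation is all of M, and a map that kills it is zero. *)
Lemma hco_hom_complex p k : (forall q, p <= q -> forall x : M q, x = 0) ->
  (forall k, noeth (homq N (@zero_trunc_le p) k)) ->
  noeth (hco D k) /\ hf (hco D k) =1 hf (homq N (@zero_trunc_le p) k).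
Proof.
move=> z nY.
have killT r j (f : D r) : kill_subcx N (Ztrunc p) r j f -> f = 0.
  move=> [_ f2]; apply: hom_eqP => a b x; have [m [e [y [hy ->]]]] := gdec x.
  have lf : linear (f a b) by exact: hom_linear.
  rewrite (lin_sum lf) big1 // => l _.
  have [ap|pa] := ltP a p; first by apply: f2 (trunc_lt _ _ _ ap (hy l)).
  by rewrite (z _ pa (y l)) (lin0 lf).
have kill0 r j (f : D r) : gdeg j f -> kill_subcx N (zero_subcx M) r j f.
  by move=> hf'; split=> // a b i x ->; rewrite (lin0 (@hom_linear _ _ _ _ _ f a b)).
have gf : @gmor _ _ (hco D k) (homq N (@zero_trunc_le p) k) 0 id.
  apply: gmor0 => // i f.
    by move=> [f1 f2]; split=> [|r]; [exact: kill0|rewrite f2; exact: scx0].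
  by move=> [g g1 g2]; exists g; [exact: kill0|rewrite g2; exact: scx0].
have gi i f : numer (hco D k) i f -> denom (homq N (@zero_trunc_le p) k) (i + 0) f ->
    denom (hco D k) i f.
  by rewrite addr0 => _ [g [g1 _] /killT g2]; exists g.
have gs i f : numer (homq N (@zero_trunc_le p) k) (i + 0) f ->
    exists2 h, numer (hco D k) i h & denom (homq N (@zero_trunc_le p) k) (i + 0) (f - h).
  rewrite addr0 => -[[f1 _] f2]; exists f; last by rewrite subrr; exact: denom0.
  by split=> // r; exact: (killT r i).
have nD : noeth (hco D k) by apply: (noeth_inj gf) => //; exact: gi.
split=> // i; have := (fin_dim_iso gf gi gs (noeth_fin_dim nD)).2 i.
by rewrite addr0.
Qed.

End Filtration.

(** * Distinguished pairs *)

Section Towers.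
Variables (x y : int -> int -> int -> int).
Hypothesis ls : forall p, les (x p) (y (p + 1)) (y p).

(** In the application [y p k] belongs to H^k of the dual of the truncation at p, and [x p k] to the
    dual of the step from p to p + 1. Each [y p k] is composed of pieces bounded by the [x j k] with
    j < p. *)
Lemma tower_dimle p0 k c p : (forall i, y p0 k i = 0) -> p0 <= p ->
  (forall j, j < p -> dimle (x j k) c) -> dimle (y p k) c.
Proof.
move=> y0; move: p; apply: int_ge_ind => [_|p _ IH hx]; first exact: dimle_zero.
have [f [g [d [nn ra bE cE aE]]]] := ls p.
have [f0 g0 d0] := nn k; have [rf rg rd] := ra k.
have -> : y (p + 1) k = fun i => f k i + g k i by apply/funext => i; rewrite bE.
apply: dimle_add.
  apply: (dimle_le f0 rf) (hx p _); last by lia.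
  by move=> i; have := aE (k - 1) i; rewrite subrK; have [_ _ /(_ i) h] := nn (k - 1); lia.
apply: (dimle_le g0 rg) (IH _); first by move=> i; rewrite cE lerDl.
by move=> j jp; apply: hx; lia.
Qed.

(** Below i nothing contributes in degrees k and k - 1, so [y (i + 1) k] equals [x i k]. Afterwards
    a step to p + 1 adds a part of [x p k] and removes a part of [x p (k + 1)], both of dimension <
    d. *)
Lemma tower_rat p0 i k d e : (forall k j, y p0 k j = 0) -> p0 <= i ->
  (forall j, j < i -> x j k =1 (fun=> 0) /\ x j (k - 1) =1 fun=> 0) ->
  rat d (x i k) e ->
  (forall j, i < j -> dimle (x j k) (d%:Z - 1) /\ dimle (x j (k + 1)) (d%:Z - 1)) ->
  forall p, i + 1 <= p -> rat d (y p k) e.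
Proof.
move=> y0 pi lo mid hi.
have z1 : y i k =1 (fun=> 0).
  by apply: (@tower_dimle p0 k (-1) i) => // j /lo[].
have z2 : y i (k - 1) =1 (fun=> 0).
  by apply: (@tower_dimle p0 (k - 1) (-1) i) => // j /lo[].
apply: int_ge_ind => [|p ip IH].
  have [f [g [dl [nn ra bE cE aE]]]] := ls i.
  apply: eq_rat mid => j; have := aE (k - 1) j; rewrite subrK bE => ->.
  have := cE k j; have := cE (k - 1) j; rewrite z1 z2.
  have [_ /(_ j) g1 /(_ j) d1] := nn (k - 1); have [_ /(_ j) g2 /(_ j) d2] := nn k; lia.
have [f [g [dl [nn ra bE cE aE]]]] := ls p.
have [|h1 h2] := hi p; first by lia.
have [f0 g0 d0] := nn k; have [rf rg rd] := ra k.
have f1 : rat d (f k) 0.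
  apply: (@dimle_lt d _ (d%:Z - 1)); last by lia.
  apply: (dimle_le f0 rf _ h1) => j.
  by have := aE (k - 1) j; rewrite subrK; have [_ _ /(_ j) h] := nn (k - 1); lia.
have d1 : rat d (dl k) 0.
  apply: (@dimle_lt d _ (d%:Z - 1)); last by lia.
  apply: (dimle_le d0 rd _ h2) => j; rewrite aE lerDl.
  by have [/(_ j)] := nn (k + 1).
have := ratD f1 (ratB IH d1); rewrite subr0 add0r; apply: eq_rat => j.
by rewrite bE cE addrK.
Qed.

End Towers.

Section DistinguishedPairs.

Definition dist (H : int -> int -> int) (d : nat) (i : int) :=
  (exists2 e, rat d (H i) e & 0 < e) /\ forall j, j < i -> dimle (H j) (d%:Z + i - j - 1).

Variables (H G : int -> int -> int) (x y : int -> int -> int -> int) (p0 p1 : int).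
Hypotheses (ls : forall p, les (x p) (y (p + 1)) (y p))
  (H0 : forall j, nonneg (H j)) (rH : forall j, rational (H j)) (x0 : forall p k, nonneg (x p k))
  (Hlow : forall j, j <= p0 -> H j =1 fun=> 0) (Hhigh : forall j, p1 < j -> H j =1 fun=> 0)
  (ylow : forall p k i, p <= p0 -> y p k i = 0) (p01 : p0 <= p1)
  (GE : forall k, G k =1 y p1 k)
  (dd : forall p d e, rat d (H (p + 1)) e -> dual_dims (fun q => x p (q - (p + 1))) d e).

Lemma dd_le p k : dimle (x p k) (- (k + (p + 1))).
Proof. by have [d [e /dd[h _ _]]] := rH (p + 1); have := h (k + (p + 1)); rewrite addrK. Qed.

(** For q = k + p + 1 this is the vanishing of E^q when -q exceeds the dimension. The condition 0 <
    -q also covers a vanishing [H (p + 1)], which is treated in order 0. *)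
Lemma dd_zero p k c : dimle (H (p + 1)) c -> c < - (k + (p + 1)) -> 0 < - (k + (p + 1)) ->
  x p k =1 fun=> 0.
Proof.
have X d e : rat d (H (p + 1)) e -> d%:Z < - (k + (p + 1)) -> x p k =1 fun=> 0.
  by move=> /dd[_ h _] /h; rewrite addrK.
case: c => c /=; first by move=> [e /X h] ck _; exact: h.
by move=> h0 _ k0; apply: (X 0%N 0) => //; apply: eq_rat (rat0 0) => i; rewrite h0.
Qed.

Lemma dist_rat d i e : dist H d i -> rat d (H i) e -> rat d (G (- d%:Z - i)) e.
Proof.
move=> [[e' re' e0] lo] re.
have pi : p0 < i.
  rewrite ltNge; apply/negP => /Hlow h.
  by rewrite (rat_uniq re' (eq_rat (fun j => esym (h j)) (rat0 d))) in e0.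
have ip : i <= p1.
  rewrite leNgt; apply/negP => /Hhigh h.
  by rewrite (rat_uniq re' (eq_rat (fun j => esym (h j)) (rat0 d))) in e0.
apply: (@eq_rat _ (y p1 (- d%:Z - i))) => [j|]; first by rewrite GE.
(* The step with index i - 1 is the one that brings in [H i]. *)
apply: (@tower_rat x y ls p0 (i - 1)); try lia.
- by move=> k j; exact: ylow.
- move=> j ji; have /lo h : j + 1 < i by lia.
  by split; apply: (dd_zero h); lia.
- have h := @dd (i - 1); rewrite subrK in h; have [_ _ r] := h _ _ re.
  by move: r; congr (rat d (x _ _) e); lia.
- by move=> j ij; split; apply: dimle_mono (dd_le _ _) _; lia.
Qed.

(** For k < -d - i the terms from [H j] with j <= i vanish, and the others have dimension at most
    -(k + j) <= -k - i - 1, as required. *)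
Lemma dist_dual d i : dist H d i -> dist G d (- d%:Z - i).
Proof.
move=> hd; have [[e re e0] lo] := hd; split; first by exists e => //; exact: dist_rat hd re.
move=> k kd; have -> : G k = y p1 k by apply/funext => j; exact: GE.
apply: (tower_dimle ls (p0 := p0)) => // [j|j _]; first exact: ylow.
have [ji|ij] := ltP (j + 1) i; first by apply/dimle_zero/(dd_zero (lo _ ji)); lia.
have [ij'|ij'] := eqVneq (j + 1) i; last by apply: dimle_mono (dd_le _ _) _; lia.
apply/dimle_zero/(@dd_zero _ _ d%:Z); rewrite ?ij'; [by exists e|lia|lia].
Qed.

Lemma dist_of_dual d i : dist G d (- d%:Z - i) -> dist H d i.
Proof.
set k := - d%:Z - i => -[[e rG e0] lo].
(* If all steps had dimension < d in degree k, so would [G k]. *)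
have [j nj] : exists j, ~ dimle (x j k) (d%:Z - 1).
  apply: contrapT => nex.
  have : dimle (G k) (d%:Z - 1).
    have -> : G k = y p1 k by apply/funext => j; exact: GE.
    apply: (tower_dimle ls (p0 := p0)) => // [j|j _]; first exact: ylow.
    by apply: contrapT => h; apply: nex; exists j.
  by move/(rat_pos_dimle rG e0); lia.
have aj : d%:Z <= - (k + (j + 1)).
  rewrite leNgt; apply/negP => lt; apply: nj; apply: dimle_mono (dd_le _ _) _; lia.
(* [Q j] says that dim H j + j >= -k. For the least such index i0, all l < i0 satisfy dim H l + l <
   -k <= d1 + i0, which makes (d1, i0) distinguished. *)
pose Q j := exists d' e', [/\ rat d' (H j) e', 0 < e' & - k <= d'%:Z + j].
have Qj : Q (j + 1).
  have [r [e1 r1]] := rH (j + 1).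
  have [[d' [e' [rd ep]]]|z] := rat_minimal (H0 (j + 1)) r1; last first.
    have z0 : rat 0 (H (j + 1)) 0 by apply: eq_rat (rat0 0) => l; rewrite z.
    have [_ h1 h2] := dd z0; case: nj.
    have [pos|] := ltP 0 (- (k + (j + 1))).
      by apply: dimle_zero; have := h1 _ pos; rewrite addrK.
    move=> npos; have kj : k + (j + 1) = 0 by lia.
    apply: dimle_zero; apply: rat0_zero; first exact: x0.
    by move: h2; rewrite oppr0 -kj addrK.
  exists d', e'; split=> //; rewrite leNgt; apply/negP => lt; apply: nj.
  by apply/dimle_zero/(@dd_zero _ _ d'%:Z); [exists e'|lia|lia].
have Qlow l : Q l -> p0 < l.
  move=> [d' [e' [r ep _]]]; rewrite ltNge; apply/negP => /Hlow h.
  by rewrite (rat_uniq r (eq_rat (fun j => esym (h j)) (rat0 d'))) in ep.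
have [i0 Qi0 i0min] : exists2 i0, Q i0 & forall l, Q l -> i0 <= l.
  have ex : exists m, `[< Q (p0 + m%:Z) >].
    exists (absz (j + 1 - p0)%R); apply/asboolP.
    by have -> : p0 + (absz (j + 1 - p0)%R)%:Z = j + 1 by have := Qlow _ Qj; lia.
  case: (ex_minnP ex) => m /asboolP Qm mmin; exists (p0 + m%:Z) => // l Ql.
  have pl := Qlow _ Ql.
  have : (m <= absz (l - p0)%R)%N.
    by apply: mmin; apply/asboolP; have -> : p0 + (absz (l - p0)%R)%:Z = l by lia.
  lia.
have [d1 [e1 [r1 ep1 kd1]]] := Qi0.
have i0j := i0min _ Qj.
have hd : dist H d1 i0.
  split; first by exists e1.
  move=> l li; have [r [e' r']] := rH l.
  have [[d2 [e2 [r2 ep2]]]|z] := rat_minimal (H0 l) r'; last exact: dimle_zero.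
  apply: (@dimle_mono _ d2%:Z); first by exists e2.
  have [|] := leP (- k) (d2%:Z + l); last by lia.
  by move=> kl; have := i0min l (ex_intro _ d2 (ex_intro _ e2 (And3 r2 ep2 kl))); lia.
have rG1 := dist_rat hd r1.
(* If -d1 - i0 < k, the bound belonging to (d, k) would give d + k + i0 >= 1, whereas [aj] and i0 <=
   j + 1 give d + k + i0 <= 0. *)
have kE : k = - d1%:Z - i0.
  have [|lt] := ltP (- d1%:Z - i0) k; last by lia.
  by move=> /lo /(rat_pos_dimle rG1 ep1); lia.
rewrite -kE in rG1; have dE := rat_pos_uniq rG e0 rG1 ep1.
have -> : i = i0 by rewrite /k in kE; lia.
by rewrite dE.
Qed.

End DistinguishedPairs.

(** * The dualizing complex and the conclusion *)

Section Resolution.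
Variables (K : fieldType) (n : nat).
Local Notation S := {mpoly K[n]}.
Local Notation pih := (pihomog mdeg).
Local Notation Sn := (gshift (- n%:Z) (ring_gmod K n)).

(** The hypothesis k = 0 is there because the translated complex has in degree -n the object with
    index -n + n, which is 0 only propositionally. *)
Lemma single_generator k : k = 0 -> exists w : single_obj Sn k,
  [/\ gdeg n%:Z w, forall x, exists c : S, x = c *: w & forall c : S, c *: w = 0 -> c = 0].
Proof.
move=> ->; exists (1 : S); split.
- by rewrite /= /shift_deg subrr /=; exact: dhomog1.
- by move=> x; exists (x : S); rewrite [RHS](@mulr1 S).
- by move=> c; rewrite [_ *: _](@mulr1 S).
Qed.

Lemma single_zero k (x : single_obj Sn k) : k != 0 -> x = 0.
Proof. by move: x; rewrite /single_obj; case: eqP => // _ x _; exact: thinmx0. Qed.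

(** The resolved complex is S(-n) in cohomological degree -n. Its generator has internal degree n,
    and its image in omega is the required w. *)
Lemma resolution_concentrated (omega : gcomplex K n) (f : forall i, translate n%:Z (single Sn) i -> omega i) :
  quasi_iso f -> concentrated omega (fun p => p = 0) (- n%:Z).
Proof.
move=> [[fm fd] fq].
have dA i j (a : translate n%:Z (single Sn) i) : cdiff j a = 0 by rewrite /= /translate_diff scaler0.
have cocA i (a : translate n%:Z (single Sn) i) : a \in @cocycles K n _ i.
  by rewrite inE dA.
have cocW i (z : omega i) : (forall r, cdiff r z = 0) -> z \in @cocycles K n _ i.
  by move=> h; rewrite inE h.
have lf i : linear (f i) by case: (fm i).
split=> [q qn i z [[hz _] dz]|].
  have [_ /(_ z (cocW _ _ dz))[a _ [v zE]]] := fq q.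
  have a0 : a = 0 by apply: single_zero; apply: contraNneq qn => qn; apply/eqP; lia.
  rewrite a0 (lin0 (lf q)) subr0 in zE.
  have [v' hv' zE'] := homogeneous_coboundary hz zE.
  exists v'; last by rewrite /= -zE' subrr.
  by split=> // p ->; rewrite scale0r.
have [w0 [hw0 gen free]] := @single_generator (- n%:Z + n%:Z) (addNr _).
have [inj sur] := fq (- n%:Z).
exists n%:Z, (f _ w0); split.
- split; first by split; [have [_ h] := fm (- n%:Z); apply: h | move=> p ->; rewrite scale0r].
  by move=> r; rewrite -fd dA (lin0 (lf r)).
- move=> i z [[hz _] dz].
  have [a _ [v zE]] := sur z (cocW _ _ dz).
  have [c0 aE] := gen a.
  exists (pihz (i - n%:Z) c0); first exact: pihz_deg.
  have [m [e [y [hy vE]]]] := gdec v.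
  (* Neither c0 nor v need be homogeneous; all homogeneous terms of c0 f(w0) and of the coboundary
     are listed in one family, from which those of degree i are extracted. *)
  pose u (t : 'I_(msize c0) + 'I_m) : omega (- n%:Z) := match t with
    | inl k => pih k c0 *: f _ w0 | inr l => cdiff _ (y l) end.
  pose eu (t : 'I_(msize c0) + 'I_m) : int := match t with
    | inl k => n%:Z + k%:Z | inr l => e l end.
  have hu t : gdeg (eu t) (u t).
    case: t => [k|l] /=; last by apply: cdiff_deg; exact: hy.
    by apply: gdegZ; [exact: pihomogP|have [_ h] := fm (- n%:Z); exact: h].
  have zE' : z = \sum_t u t.
    rewrite big_sumType /= -linear_sum -vE -scaler_suml.
    rewrite -(pihomog_partitionE (mf := mdeg) (leqnn (msize c0))).
    by rewrite -(linZ (lf _)) -aE addrC; apply/eqP; rewrite -subr_eq; apply/eqP.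
  have := gdeg_component hz hu zE'; rewrite big_sumType /= sum_pihz // => ->.
  exists (\sum_(l | e l == i) y l).
    by split; [apply: gdeg_sum => l /eqP <-; exact: hy|move=> p ->; rewrite scale0r].
  by rewrite linear_sum [X in X - _]addrAC subrr add0r subrr.
- move=> j p _ [v [hv _] pE].
  have [|b bE] := inj (p *: w0) (cocA _ _).
    by exists v; apply/eqP; rewrite -subr_eq0 -pE (linZ (lf _)).
  by apply: free; rewrite bE dA.
Qed.

End Resolution.

Section Conclusion.
Variables (K : fieldType) (n : nat).

Lemma kdim_lt (N : gmod K n) (c : int) : fg (gq N) ->
  (kdim N < c%:E)%E <-> dimle (hf (gq N)) (c - 1).
Proof.
move=> fN; have [[-> z]|[d [e [-> r e0]]]] := kdim_cases fN.
  by rewrite ltNyr; split=> // _; exact: dimle_zero.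
rewrite lte_fin; split=> [dc|/(rat_pos_dimle r e0)]; last by lia.
by apply: (@dimle_mono _ d%:Z); [exists e|lia].
Qed.

Lemma distinguished_dist (C : gcomplex K n) d i : (forall j, noeth (hco C j)) ->
  distinguished C d i <-> dist (fun j => hf (hco C j)) d i.
Proof.
move=> nC; have fC j : fg (gq (cohomology C j)).
  by apply/noeth_fg/noeth_cohomology; exact: nC.
have hE j : hf (hco C j) = hf (gq (cohomology C j)).
  by apply/funext => k; rewrite (hf_cohomology (nC j)).
rewrite /distinguished /dist hE; split=> -[h lo]; split.
- have [[]|[d' [e []]]] := kdim_cases (fC i); rewrite h // => -[->] r e0.
  by exists e.
- by move=> j /lo /(kdim_lt _ (fC j)); rewrite hE.
- by have [e r e0] := h; exact: kdim_rat r e0.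
- by move=> j /lo; rewrite hE => /(kdim_lt _ (fC j)).
Qed.

End Conclusion.

Theorem theorem1p2 (K : fieldType) (n : nat) (omega : gcomplex K n)
  (homega : minimal_injective_resolution
     (translate n%:Z (single (gshift (- n%:Z) (ring_gmod K n)))) omega)
  (M : gcomplex K n) (hM : in_Db M) :
  (forall (d : nat) (i : int),
     distinguished M d i <-> distinguished (hom_complex M omega) d (- d%:Z - i)) /\
  (forall (d : nat) (i : int), distinguished M d i ->
     exists e : int, has_multiplicity (cohomology M i) e /\
       has_multiplicity (Ext (- d%:Z - i) M omega) e).
Proof.
have [bN inj [f /resolution_concentrated conc] _] := homega.
have [bM fM] := hM; have [a [b ab]] := bM.
have nM p : noeth (hco M p) by apply/noeth_cohomology/fg_noeth/fin_gen_fg.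
have fgM p : fg (hco M p) := noeth_fg (nM p).
have [nT ls] := tower_les inj bN conc fgM bM.
have dd p := (homq_step inj bN conc (fgM (p + 1))).2.
(* M vanishes in degrees up to [p0] and from [p1] on; the absolute values ensure p0 <= p1 even when
   b < a. *)
pose p0 := a - 1; pose p1 : int := `|a| + `|b| + 1.
have p01 : p0 <= p1 by rewrite /p0 /p1; lia.
have Mlow q : q <= p0 -> forall x : M q, x = 0 by move=> h; apply: ab; rewrite /p0 in h; lia.
have Mhigh q : p1 <= q -> forall x : M q, x = 0 by move=> h; apply: ab; rewrite /p1 in h; lia.
have hz j : (forall x : M j, x = 0) -> hf (hco M j) =1 fun=> 0.
  move=> z i; apply/(hf0P i (noeth_fin_dim (nM j))) => x _.
  by rewrite (z x); by case: (denomP (hco M j)).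
have Hlow j (h : j <= p0) := hz j (Mlow j h).
have Hhigh j (h : p1 < j) := hz j (Mhigh j (ltW h)).
have ylow p k i : p <= p0 -> hf (homq omega (@zero_trunc_le _ _ M p) k) i = 0.
  by move=> pp; apply: homq_low => // q qp; apply: Mlow; exact: le_trans qp pp.
have nD k := (hco_hom_complex k Mhigh (nT p1)).1.
have GE k := (hco_hom_complex k Mhigh (nT p1)).2.
have rH j := rational_fg (fgM j).
split=> [d i|d i].
  rewrite !distinguished_dist //; split.
    exact: (dist_dual ls rH Hlow Hhigh ylow p01 GE dd).
  apply: (dist_of_dual ls _ rH _ Hlow Hhigh ylow p01 GE dd).
    by move=> j k; exact: hf_ge0.
  by move=> p k j; exact: hf_ge0.
rewrite distinguished_dist // => h; have [[e re e0] _] := h; exists e.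
have rd := dist_rat ls rH Hlow Hhigh ylow p01 GE dd h re.
have mult C q c : noeth (hco C q) -> rat c (hf (hco C q)) e ->
    has_multiplicity (@cohomology K n C q) e.
  move=> nC r; apply: (@has_multiplicity_rat _ _ _ c) => //.
    by apply/noeth_fg/noeth_cohomology.
  by apply: eq_rat r => j; rewrite (hf_cohomology nC).
by split; [exact: mult (nM i) re|exact: mult (nD _) rd].
Qed.
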